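(* Let $\lambda>0$ and let $k,r$ be integers with $1\le r\le k-1$. For every sufficiently large $n$ let $p=p_n\in(0,1]$ be given by $\binom{n-r}{k-r}p=\lambda$, and let $H_n$ be the $k$-uniform random hypergraph $H(n,k,p)$, the $H_n$ being realized on a common probability space. Then, almost surely, the $r$-set local weak limit of $(H_n)$ is $\nu_{d,\lambda}$ with $d=\binom{k}{r}-1$; that is, almost surely, $$U_r(H_n)\rightsquigarrow \nu_{\binom{k}{r}-1,\lambda}\qquad\text{as } n\to\infty .$$
   Context: Random hypergraph: $H(n,k,p)$ is the random hypergraph with vertex set $[n]=\{1,\dots,n\}$ in which each $k$-element subset of $[n]$ is included as a hyperedge with probability $p$, independently. Line graph: for a $k$-uniform hypergraph $H$ on $[n]$ with hyperedge set $E(H)$, and $1\le r\le k-1$, the $r$-set weighted line graph $G_r(H)$ has as vertices all $r$-element subsets of $[n]$; two distinct $r$-sets $S_1,S_2$ are adjacent iff some $e\in E(H)$ satisfies $S_1,S_2\subset e$, and then the edge has weight $w_{r,H}(S_1,S_2)=|\{e\in E(H): S_1,S_2\subset e\}|$. Rooted weighted graphs: $\mathbb G^*_w$ is the set of isomorphism classes of connected locally finite weighted graphs $(G,w,o)$ with a root vertex $o$ (edge weights real and symmetric; isomorphisms preserve edges, non-edges, weights and the root). For an integer $t\ge 0$, $(G,o)_t$ is the weighted subgraph induced on the vertices at graph distance at most $t$ from $o$, rooted at $o$. The local topology on $\mathbb G^*_w$ is induced by the metric $m((G,u),(G',v))=1/(1+T)$, with $T=\sup\{t\ge 0:(G,u)_t\cong(G',v)_t\}$.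 $\rightsquigarrow$ denotes weak convergence of Borel probability measures on $(\mathbb G^*_w,m)$, i.e. convergence of integrals of all bounded continuous functions. For a finite weighted graph $(G,w)$ with vertex set $V$, $U(G,w)=\frac1{|V|}\sum_{o\in V}\delta_{[(G(o),w,o)]}$, where $G(o)$ is the connected component of $o$. Put $U_r(H)=U(G_r(H))$. If $U_r(H_n)\rightsquigarrow\nu$, then $\nu$ is called the $r$-set local weak limit of $(H_n)$. $d$-block Galton–Watson measure $\nu_{d,\lambda}$: the law on $\mathbb G^*_w$ of the random rooted graph, with all edge weights equal to $1$, constructed from a root $o$ as follows. Independently, every vertex (the root included) has a Poisson$(\lambda)$ number of $d$-block children; each $d$-block child is a set of $d$ new vertices which together with their parent form a $(d+1)$-clique (complete graph on $d+1$ vertices); each of these new vertices then reproduces independently in the same way. There are no other edges. *)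

(* Defs.v *)
From HB Require Import structures.
From mathcomp Require Import all_boot all_order all_algebra.
From mathcomp Require Import generic_quotient.
From mathcomp Require Import all_classical all_reals all_analysis.

Set Implicit Arguments.
Unset Strict Implicit.
Unset Printing Implicit Defensive.

Import Order.TTheory GRing.Theory Num.Theory.
Import numFieldTopology.Exports numFieldNormedType.Exports.

Local Open Scope classical_set_scope.
Local Open Scope ring_scope.
Local Open Scope quotient_scope.

(* The vertex set is a subset of a carrier type [V]; only the values of [wgt]
   on adjacent pairs are meaningful. *)
Record wgraph (R : realType) (V : Type) := WGraph {
  vset : set V ;
  adj : rel V ;
  wgt : V -> V -> R ;
  adj_vset : forall x y, adj x y -> vset x /\ vset y ;
  adj_irrefl : forall x, ~~ adj x x ;
  adj_sym : forall x y, adj x y = adj y x ;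
  wgt_sym : forall x y, adj x y -> wgt x y = wgt y x ;
  adj_locfin : forall x, finite_set [set y | adj x y] }.

Section induced.
Context {R : realType} {V : Type} (G : wgraph R V) (W : set V).

Definition induced_adj : rel V := fun x y => [&& x \in W, y \in W & adj G x y].

Lemma induced_adj_vset x y : induced_adj x y -> W x /\ W y.
Proof. by move=> /and3P[/set_mem Wx /set_mem Wy _]. Qed.

Lemma induced_adj_irrefl x : ~~ induced_adj x x.
Proof. by rewrite /induced_adj (negbTE (adj_irrefl G x)) !andbF. Qed.

Lemma induced_adj_sym x y : induced_adj x y = induced_adj y x.
Proof. by rewrite /induced_adj adj_sym andbCA. Qed.

Lemma induced_wgt_sym x y : induced_adj x y -> wgt G x y = wgt G y x.
Proof. by move=> /and3P[_ _]; exact: wgt_sym. Qed.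

Lemma induced_adj_locfin x : finite_set [set y | induced_adj x y].
Proof. by apply: sub_finite_set (adj_locfin G x) => y /= /and3P[]. Qed.

(* Meant for [W] included in the vertex set of [G]. *)
Definition induced : wgraph R V :=
  WGraph induced_adj_vset induced_adj_irrefl induced_adj_sym induced_wgt_sym induced_adj_locfin.

End induced.

Section rooted.
Context {R : realType} {V : Type} (G : wgraph R V) (o : V).

Definition within (t : nat) : set V :=
  [set x | exists s : seq V,
    [/\ path (adj G) o s, last o s = x & (size s <= t)%N]].

Definition connected_to : set V :=
  [set x | exists2 s : seq V, path (adj G) o s & last o s = x].

Definition gball (t : nat) : wgraph R V := induced G (within t).

Definition component : wgraph R V := induced G connected_to.

End rooted.

Definition riso (R : realType) (V V' : Type)
    (G : wgraph R V) (o : V) (G' : wgraph R V') (o' : V') : Prop :=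
  exists f : V -> V',
    [/\ set_bij (vset G) (vset G') f,
        f o = o',
        forall x y, vset G x -> vset G y -> adj G' (f x) (f y) = adj G x y &
        forall x y, adj G x y -> wgt G' (f x) (f y) = wgt G x y].

(* A connected locally finite graph is countable, so every isomorphism class
   has a representative whose vertices are natural numbers. *)
Record rgraph (R : realType) := RGraph {
  rgraph_of :> wgraph R nat ;
  root : nat ;
  rootP : vset rgraph_of root ;
  rconnected : forall x, vset rgraph_of x -> connected_to rgraph_of root x }.

Section iso_facts.
Context {R : realType}.

Lemma riso_refl V (G : wgraph R V) o : riso G o G o.
Proof.
by exists id; split=> //; split=> // x Gx; exists x.
Qed.

Lemma riso_sym V V' (G : wgraph R V) o (G' : wgraph R V') o' :
  vset G o -> riso G o G' o' -> riso G' o' G o.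
Proof.
move=> Go [f [[ffun finj fsurj] fo fadj fw]].
have [g gP] : exists g : V' -> V, forall y, vset G' y -> vset G (g y) /\ f (g y) = y.
  have h y : exists x, vset G' y -> vset G x /\ f x = y.
    have [G'y|nG'y] := pselect (vset G' y); last by exists o.
    by have [x Gx fx] := fsurj _ G'y; exists x.
  by exists (fun y => sval (cid (h y))) => y; exact: svalP (cid (h y)).
have gf x : vset G x -> g (f x) = x.
  move=> Gx; have [Gg fg] := gP _ (ffun _ Gx).
  by apply: finj; rewrite ?inE.
exists g; split.
- split.
  + by move=> y /gP[].
  + move=> y z; rewrite !inE => Gy Gz e.
    by rewrite -(gP y Gy).2 -(gP z Gz).2 e.
  + by move=> x Gx; exists (f x); [exact: ffun|exact: gf].
- by rewrite -fo gf.
- move=> x y Gx Gy; have [? ex] := gP _ Gx; have [? ey] := gP _ Gy.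
  by rewrite -fadj// ex ey.
- move=> x y xy; have [Gx Gy] := adj_vset xy.
  have [? ex] := gP _ Gx; have [? ey] := gP _ Gy.
  by rewrite -{2}ex -{2}ey fw// -fadj// ex ey.
Qed.

Lemma riso_trans V1 V2 V3 (G1 : wgraph R V1) o1 (G2 : wgraph R V2) o2
    (G3 : wgraph R V3) o3 :
  riso G1 o1 G2 o2 -> riso G2 o2 G3 o3 -> riso G1 o1 G3 o3.
Proof.
move=> [f [[ff fi fs] fo fa fw]] [g [[gf gi gs] go ga gw]].
exists (g \o f); split => /=.
- split.
  + by move=> x Gx; apply: gf; apply: ff.
  + move=> x y Gx Gy /= e; apply: fi => //; apply: gi => //.
      by rewrite inE; apply: ff; rewrite inE in Gx.
    by rewrite inE; apply: ff; rewrite inE in Gy.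
  + move=> z Gz; have [y Gy <-] := gs _ Gz; have [x Gx <-] := fs _ Gy.
    by exists x.
- by rewrite fo.
- by move=> x y Gx Gy; rewrite ga ?fa//; apply: ff.
- move=> x y xy; have [Gx Gy] := adj_vset xy.
  by rewrite gw ?fw// fa.
Qed.

Lemma within_root V (G : wgraph R V) o t : within G o t o.
Proof. by exists [::]. Qed.

Lemma within0 V (G : wgraph R V) o : within G o 0 = [set o].
Proof.
apply/seteqP; split => [x [[|y s] [//= _ <- _]]|_ ->//]; exact: within_root.
Qed.

Lemma connected_to_vset V (G : wgraph R V) o :
  vset G o -> connected_to G o `<=` vset G.
Proof.
move=> Go x [s]; case: (lastP s) => [_ <-//|{}s y].
rewrite rcons_path last_rcons => /andP[_ e] <-.
by have [] := adj_vset e.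
Qed.

Lemma within_connected_to V (G : wgraph R V) o t :
  within G o t `<=` connected_to G o.
Proof. by move=> x [s [? ? _]]; exists s. Qed.

Lemma sub_within V (G : wgraph R V) o s t : (s <= t)%N ->
  within G o s `<=` within G o t.
Proof.
by move=> st x [p [? ? ps]]; exists p; split => //; exact: leq_trans ps st.
Qed.

Lemma withinS V (G : wgraph R V) o t x y :
  within G o t x -> adj G x y -> within G o t.+1 y.
Proof.
move=> [p [op px pt]] xy; exists (rcons p y); split.
- by rewrite rcons_path op px.
- by rewrite last_rcons.
- by rewrite size_rcons.
Qed.

Lemma withinSP V (G : wgraph R V) o t y : within G o t.+1 y ->
  y = o \/ exists2 x, within G o t x & adj G x y.
Proof.
move=> [p [op <- pt]]; case: (lastP p) op pt => [|s z]; first by left.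
rewrite rcons_path last_rcons size_rcons ltnS => /andP[os sz] st.
by right; exists (last o s) => //; exists s.
Qed.

Lemma within_finite V (G : wgraph R V) o t : finite_set (within G o t).
Proof.
elim: t => [|t IH]; first by rewrite within0; exact: finite_set1.
apply: (@sub_finite_set _ _
  ([set o] `|` \bigcup_(x in within G o t) [set y | adj G x y])).
  move=> y yt; have [->|[x xt xy]] := withinSP yt; first by left.
  by right; exists x.
rewrite finite_setU; split; first exact: finite_set1.
by apply: bigcup_finite => // x _; exact: adj_locfin.
Qed.

Lemma riso_gball0 V V' (G : wgraph R V) o (G' : wgraph R V') o' :
  riso (gball G o 0) o (gball G' o' 0) o'.
Proof.
exists (fun=> o'); split => //=.
- rewrite !within0; split=> //.
  + by move=> x y; rewrite !inE => -> ->.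
  + by move=> y ->; exists o.
- rewrite !within0 => x y -> ->.
  by rewrite /induced_adj !(negbTE (adj_irrefl _ _)) !andbF.
- move=> x y /and3P[]; rewrite within0 !inE => -> ->.
  by rewrite (negbTE (adj_irrefl _ _)).
Qed.

Lemma riso_within V V' (G : wgraph R V) o (G' : wgraph R V') o' t f :
  set_bij (within G o t) (within G' o' t) f -> f o = o' ->
  (forall x y, within G o t x -> within G o t y ->
    adj (gball G' o' t) (f x) (f y) = adj (gball G o t) x y) ->
  forall s, (s <= t)%N -> set_bij (within G o s) (within G' o' s) f.
Proof.
move=> [ff fi fs] fo fa.
have fadj x y : within G o t x -> within G o t y ->
    adj G' (f x) (f y) = adj G x y.
  move=> Gx Gy; have /= := fa _ _ Gx Gy.
  by rewrite /induced_adj !mem_set//; apply: ff.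
have fwd s : (s <= t)%N -> forall x, within G o s x -> within G' o' s (f x).
  elim: s => [_ x|s IH st y].
    by rewrite !within0 => /= ->.
  move=> ys; have [->|[x xs xy]] := withinSP ys.
    by rewrite fo; exact: within_root.
  apply: (@withinS _ _ _ _ (f x)); first exact: IH (ltnW st) _ xs.
  rewrite fadj//; first exact: sub_within (ltnW st) _ xs.
  exact: sub_within st _ ys.
have bwd s : (s <= t)%N -> forall x, within G o t x ->
    within G' o' s (f x) -> within G o s x.
  elim: s => [_ x xt|s IH st y yt].
    rewrite !within0 /= -fo => fxo; apply: fi => //; rewrite inE//.
    exact: within_root.
  move=> h; have [|[x' x's x'y]] := withinSP h.
    rewrite -fo => fyo; suff -> : y = o by exact: within_root.
    by apply: fi => //; rewrite inE//; exact: within_root.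
  have [x xt xx'] := fs _ (sub_within (ltnW st) x's).
  rewrite -xx' fadj// in x'y.
  by apply: (@withinS _ _ _ _ x) => //; apply: IH; rewrite ?xx'// ltnW.
move=> s st; split.
- by move=> x; exact: fwd.
- move=> x y; rewrite !inE => xs ys; apply: fi; rewrite inE.
    exact: sub_within xs.
  exact: sub_within ys.
- move=> y ys; have [x xt xy] := fs _ (sub_within st ys).
  by exists x => //; apply: bwd => //; rewrite xy.
Qed.

Lemma riso_gball_le V V' (G : wgraph R V) o (G' : wgraph R V') o' s t :
  (s <= t)%N -> riso (gball G o t) o (gball G' o' t) o' ->
  riso (gball G o s) o (gball G' o' s) o'.
Proof.
move=> st [f [fb fo fa fw]]; have fbs := riso_within fb fo fa st.
have [ff _ _] := fb; have [ffs _ _] := fbs.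
exists f; split => // [x y xs ys|x y /=].
  have /= := fa _ _ (sub_within st xs) (sub_within st ys).
  rewrite /induced_adj !(mem_set (ffs _ _))// !(mem_set xs) !(mem_set ys).
  rewrite !(mem_set (sub_within st xs)) !(mem_set (sub_within st ys)).
  by rewrite !(mem_set (sub_within st (ffs _ xs)))
    !(mem_set (sub_within st (ffs _ ys))).
move=> /and3P[/set_mem xs /set_mem ys xy]; apply: fw => /=.
by rewrite /induced_adj xy !mem_set//; exact: sub_within st _ _.
Qed.

Definition riso_rel (G G' : rgraph R) : bool :=
  `[< riso G (root G) G' (root G') >].

Lemma riso_rel_equiv : equiv_class_of riso_rel.
Proof.
split.
- by move=> G; apply/asboolP; exact: riso_refl.
- move=> G G'; apply/asboolP/asboolP; apply: riso_sym; exact: rootP.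
- move=> G2 G1 G3 /asboolP h12 /asboolP h23; apply/asboolP.
  exact: riso_trans h12 h23.
Qed.

End iso_facts.

HB.instance Definition _ (R : realType) := gen_eqMixin (rgraph R).
HB.instance Definition _ (R : realType) := gen_choiceMixin (rgraph R).

Canonical riso_equiv (R : realType) := EquivRelPack (@riso_rel_equiv R).

(* The space G*_w of isomorphism classes. *)
Definition gstar (R : realType) : Type :=
  {eq_quot (@riso_equiv R)}.

HB.instance Definition _ (R : realType) := Choice.on (gstar R).
HB.instance Definition _ (R : realType) := EqQuotient.on (gstar R).

Section pi_gstar.
Context {R : realType}.

Lemma gstar_eqP (G G' : rgraph R) :
  (\pi_(gstar R) G = \pi_(gstar R) G') <-> riso G (root G) G' (root G').
Proof.
split; first by move/eqquotP => /asboolP.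
by move=> h; apply/eqquotP/asboolP.
Qed.

End pi_gstar.

Section local_metric.
Context {R : realType}.

Definition ball_iso (G G' : rgraph R) (t : nat) : Prop :=
  riso (gball G (root G) t) (root G) (gball G' (root G') t) (root G').

Definition iso_radius (G G' : rgraph R) : \bar R :=
  ereal_sup [set t%:R%:E | t in ball_iso G G'].

(* The supremum may be +oo, in which case the distance is 0. *)
Definition rdist (G G' : rgraph R) : R :=
  fine (1 / (1 + iso_radius G G'))%E.

Definition local_dist (c c' : gstar R) : R := rdist (repr c) (repr c').

Lemma rdistE G G' : rdist G G' = fine ((1 + iso_radius G G')^-1)%E.
Proof. by rewrite /rdist mul1e. Qed.

Lemma iso_radius_ge0 G G' : (0 <= iso_radius G G')%E.
Proof.
by apply: ereal_sup_ubound; exists 0%N => //; exact: riso_gball0.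
Qed.

Lemma rdist_ge0 G G' : 0 <= rdist G G'.
Proof.
rewrite rdistE; have := iso_radius_ge0 G G'.
case: (iso_radius G G') => [r| |]//= r0.
  rewrite -EFinD /inve; case: ifPn => //= _.
  by rewrite invr_ge0 addr_ge0.
Qed.

Lemma rdist_le G G' t : ball_iso G G' t -> rdist G G' <= (1 + t%:R)^-1.
Proof.
move=> h; have : (t%:R%:E <= iso_radius G G')%E.
  by apply: ereal_sup_ubound; exists t.
rewrite rdistE; case: (iso_radius G G') => [r| |]//=.
rewrite lee_fin => tr; have r0 : 0 < 1 + r.
  by rewrite ltr_pwDl// (le_trans _ tr).
by rewrite -EFinD /inve gt_eqF//= lef_pV2 ?posrE ?lerD2l// ltr_pwDl.
Qed.

Lemma rdist_ge G G' t : ~ ball_iso G G' t.+1 -> (1 + t%:R)^-1 <= rdist G G'.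
Proof.
move=> h; have : (iso_radius G G' <= t%:R%:E)%E.
  apply: ub_ereal_sup => _ [s /= sG <-]; rewrite lee_fin ler_nat.
  by rewrite leqNgt; apply/negP => ts; apply: h; exact: riso_gball_le ts sG.
have := iso_radius_ge0 G G'; rewrite rdistE.
case: (iso_radius G G') => [r| |]//=.
rewrite !lee_fin => r0 rt; rewrite -EFinD /inve gt_eqF ?ltr_pwDl//=.
by rewrite lef_pV2 ?posrE ?lerD2l ?ltr_pwDl.
Qed.

Lemma rdist_eq0 G G' : rdist G G' = 0 <-> forall t, ball_iso G G' t.
Proof.
split=> [e [|t]|h]; first exact: riso_gball0.
  have [//|/rdist_ge] := pselect (ball_iso G G' t.+1).
  by rewrite e leNgt invr_gt0 ltr_pwDl.
apply/eqP; rewrite eq_le rdist_ge0 andbT leNgt; apply/negP => d0.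
have [t] := ltr_add_invr d0; rewrite add0r -nat1r ltNge.
by rewrite (rdist_le (h t)).
Qed.

Lemma rdist_sym G G' : rdist G G' = rdist G' G.
Proof.
rewrite !rdistE /iso_radius.
congr (fine ((1 + ereal_sup (image _ _))^-1)%E).
by apply/seteqP; split => [t|t] /=; apply: riso_sym; exact: within_root.
Qed.

Lemma rdist_triangle G2 G1 G3 : rdist G1 G3 <= rdist G1 G2 + rdist G2 G3.
Proof.
have [/rdist_eq0 ->|d0] := pselect (forall t, ball_iso G1 G3 t).
  by rewrite addr_ge0 ?rdist_ge0.
have [t nt] : exists t, ~ ball_iso G1 G3 t by exact/existsNP.
have ex : exists t, ~~ `[< ball_iso G1 G3 t >] by exists t; apply/asboolPn.
case: (ex_minnP ex) => {nt t d0 ex} -[|t] /asboolPn nt tmin.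
  by exfalso; apply: nt; exact: riso_gball0.
have Gt : ball_iso G1 G3 t.
  by apply: contrapT => /asboolPn/tmin; rewrite ltnn.
apply: (le_trans (rdist_le Gt)).
have [h12|h12] := pselect (ball_iso G1 G2 t.+1).
  have h23 : ~ ball_iso G2 G3 t.+1.
    by move=> h23; apply: nt; exact: riso_trans h12 h23.
  by rewrite (le_trans (rdist_ge h23))// lerDr rdist_ge0.
by rewrite (le_trans (rdist_ge h12))// lerDl rdist_ge0.
Qed.

(* Koenig's lemma: two locally finite connected graphs all of whose balls are
   isomorphic are isomorphic. *)
Lemma riso_of_gball (G G' : rgraph R) :
  (forall t, ball_iso G G' t) -> riso G (root G) G' (root G').
Proof.
move=> /choice[F FP].
have inG x : vset G x -> exists t, within G (root G) t x.
  by move=> /rconnected[s ps ls]; exists (size s); exists s.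
have inG' x : vset G' x -> exists t, within G' (root G') t x.
  by move=> /rconnected[s ps ls]; exists (size s); exists s.
pose agree (h : nat -> nat) m t :=
  forall i, (i < m)%N -> vset G i -> F t i = h i.
pose good h m := forall N, exists2 t, (N <= t)%N & agree h m t.
have step h m : good h m -> exists v, good (fun i => if i == m then v else h i) m.+1.
  move=> hm; have [Gm|nGm] := pselect (vset G m); last first.
    exists 0%N => N; have [t Nt ht] := hm N; exists t => // i.
    rewrite ltnS leq_eqVlt => /orP[/eqP -> //|im] Gi; rewrite lt_eqF//.
    exact: ht.
  have [D mD] := inG _ Gm.
  have /finite_seqP[s sE] := within_finite G' (root G') D.
  apply: contrapT => /forallNP no.
  have {}no v : exists N, forall t, (N <= t)%N -> agree h m t -> F t m <> v.
    have /existsNP[N nN] := no v; exists N => t Nt ht Ftm; apply: nN.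
    exists t => // i; rewrite ltnS leq_eqVlt => /orP[/eqP -> _|im Gi].
      by rewrite eqxx.
    by rewrite lt_eqF//; exact: ht.
  have [N NP] := choice no.
  have [t Nt ht] := hm (maxn D (\max_(v <- s) N v)).
  have Dt : (D <= t)%N by rewrite (leq_trans _ Nt)// leq_maxl.
  have [fb fo fa _] := FP t.
  have [ff _ _] := riso_within fb fo fa Dt.
  have := ff _ mD; rewrite sE /= => Fs.
  apply: (NP (F t m) t) => //; apply: leq_trans Nt.
  by rewrite (leq_trans _ (leq_maxr _ _))//; apply: leq_bigmax_seq.
have {}step (p : nat * (nat -> nat)) : exists v, good p.2 p.1 ->
    good (fun i => if i == p.1 then v else p.2 i) p.1.+1.
  have [gp|ngp] := pselect (good p.2 p.1); last by exists 0%N.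
  by have [v] := step _ _ gp; exists v.
have [st stP] := choice step.
pose hs := fix hs m : nat -> nat := if m is m'.+1 then
  (fun i => if i == m' then st (m', hs m') else hs m' i) else (fun=> 0%N).
have hsP m : good (hs m) m.
  elim: m => [N|m IH]; first by exists N.
  exact: (stP (m, hs m)) IH.
pose g i := hs i.+1 i.
have hsg m i : (i < m)%N -> hs m i = g i.
  elim: m => // m IH; rewrite ltnS leq_eqVlt => /orP[/eqP ->//|im].
  by rewrite /= lt_eqF// IH.
have gP m N : exists2 t, (N <= t)%N &
    forall i, (i < m)%N -> vset G i -> F t i = g i.
  have [t Nt ht] := hsP m N; exists t => // i im Gi.
  by rewrite -(hsg m)//; exact: ht.
have F_within t s : (s <= t)%N ->
    set_bij (within G (root G) s) (within G' (root G') s) (F t).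
  by move=> st'; have [fb fo fa _] := FP t; exact: riso_within fb fo fa _ st'.
exists g; split.
- split.
  + move=> x Gx; have [D xD] := inG _ Gx.
    have [t Dt tg] := gP x.+1 D; rewrite -tg//.
    have [ff _ _] := F_within _ _ Dt.
    apply: (connected_to_vset (rootP G')).
    exact: within_connected_to (ff _ xD).
  + move=> x y; rewrite !inE => Gx Gy.
    have [D xD] := inG _ Gx; have [E yE] := inG _ Gy.
    have [t DEt tg] := gP (maxn x y).+1 (maxn D E).
    rewrite -!tg// ?ltnS ?leq_maxl ?leq_maxr// => e.
    have [_ fi _] := F_within _ _ DEt.
    apply: fi => //; rewrite inE.
      exact: sub_within (leq_maxl D E) _ xD.
    exact: sub_within (leq_maxr D E) _ yE.
  + move=> y /inG'[D yD].
    have /finite_seqP[s sE] := within_finite G (root G) D.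
    have [t Dt tg] := gP (\max_(v <- s) v).+1 D.
    have [_ _ fs] := F_within _ _ Dt.
    have [x xD xy] := fs _ yD.
    have Gx : vset G x.
      by apply: (connected_to_vset (rootP G)); exact: within_connected_to xD.
    exists x => //; rewrite -tg// ltnS.
    by move: xD; rewrite sE /= => xs; exact: (@leq_bigmax_seq _ s xpredT id x).
- have [t _ tg] := gP (root G).+1 0%N.
  by rewrite -tg//; [have [_ ->] := FP t|exact: rootP].
- move=> x y Gx Gy.
  have [D xD] := inG _ Gx; have [E yE] := inG _ Gy.
  have [t DEt tg] := gP (maxn x y).+1 (maxn D E).
  rewrite -!tg// ?ltnS ?leq_maxl ?leq_maxr//.
  have [[ff _ _] _ fa _] := FP t.
  have xt : within G (root G) t x.
    by apply: sub_within xD; rewrite (leq_trans (leq_maxl D E)).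
  have yt : within G (root G) t y.
    by apply: sub_within yE; rewrite (leq_trans (leq_maxr D E)).
  by have /= := fa _ _ xt yt; rewrite /induced_adj !mem_set//; exact: ff.
- move=> x y xy; have [Gx Gy] := adj_vset xy.
  have [D xD] := inG _ Gx; have [E yE] := inG _ Gy.
  have [t DEt tg] := gP (maxn x y).+1 (maxn D E).
  rewrite -!tg// ?ltnS ?leq_maxl ?leq_maxr//.
  have [_ _ _ fw] := FP t; apply: fw => /=.
  rewrite /induced_adj xy !mem_set//.
    by apply: sub_within yE; rewrite (leq_trans (leq_maxr D E)).
  by apply: sub_within xD; rewrite (leq_trans (leq_maxl D E)).
Qed.

Lemma local_distxx c : local_dist c c = 0.
Proof. by apply/rdist_eq0 => t; exact: riso_refl. Qed.

Lemma local_dist_positivity c c' : local_dist c c' = 0 -> c = c'.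
Proof.
move=> /rdist_eq0/riso_of_gball/gstar_eqP; by rewrite !reprK.
Qed.

Lemma local_dist_sym c c' : local_dist c c' = local_dist c' c.
Proof. exact: rdist_sym. Qed.

Lemma local_dist_triangle c2 c1 c3 :
  local_dist c1 c3 <= local_dist c1 c2 + local_dist c2 c3.
Proof. exact: rdist_triangle. Qed.

End local_metric.

HB.instance Definition _ (R : realType) := @isMetric.Build R (gstar R)
  local_dist local_distxx local_dist_positivity local_dist_sym
  local_dist_triangle.

Section encode.
Context {R : realType} {V : countType} (G : wgraph R V).

Definition encode_adj : rel nat := fun a b =>
  if (@pickle_inv V a, @pickle_inv V b) is (Some x, Some y) then adj G x y
  else false.

Definition encode_wgt (a b : nat) : R :=
  if (@pickle_inv V a, @pickle_inv V b) is (Some x, Some y) then wgt G x y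
  else 0.

Lemma encode_adjP a b : encode_adj a b ->
  exists x y, [/\ pickle x = a, pickle y = b & adj G x y].
Proof.
rewrite /encode_adj; case ea: (@pickle_inv V a) => [x|//].
case eb: (@pickle_inv V b) => [y|//] xy; exists x, y.
have := @pickle_invK V b; have := @pickle_invK V a.
by rewrite ea eb /= => -> ->.
Qed.

Lemma encode_adj_vset a b : encode_adj a b -> (pickle @` vset G) a /\ (pickle @` vset G) b.
Proof.
move=> /encode_adjP[x [y [<- <- xy]]]; have [Gx Gy] := adj_vset xy.
by split; [exists x|exists y].
Qed.

Lemma encode_adj_irrefl a : ~~ encode_adj a a.
Proof.
by rewrite /encode_adj; case: (@pickle_inv V a) => // x; exact: adj_irrefl.
Qed.

Lemma encode_adj_sym a b : encode_adj a b = encode_adj b a.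
Proof.
rewrite /encode_adj; case: (@pickle_inv V a) => [x|]; case: (@pickle_inv V b) => // y.
exact: adj_sym.
Qed.

Lemma encode_wgt_sym a b : encode_adj a b -> encode_wgt a b = encode_wgt b a.
Proof.
rewrite /encode_adj /encode_wgt; case: (@pickle_inv V a) => [x|//].
by case: (@pickle_inv V b) => // y; exact: wgt_sym.
Qed.

Lemma encode_adj_locfin a : finite_set [set b | encode_adj a b].
Proof.
case ea: (@pickle_inv V a) => [x|]; last first.
  apply: (@sub_finite_set _ _ set0); last exact: finite_set0.
  by move=> b /=; rewrite /encode_adj ea.
apply: (@sub_finite_set _ _ (pickle @` [set y | adj G x y])).
  move=> b /=; rewrite /encode_adj ea; have := @pickle_invK V b.
  by case: (@pickle_inv V b) => // y /= <- xy; exists y.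
exact/finite_image/adj_locfin.
Qed.

Definition encode : wgraph R nat :=
  WGraph encode_adj_vset encode_adj_irrefl encode_adj_sym encode_wgt_sym encode_adj_locfin.

Lemma riso_encode o : riso G o encode (pickle o).
Proof.
exists pickle; split=> //=.
- split; first by move=> x Gx; exists x.
  + by move=> x y _ _; exact: (pcan_inj pickleK_inv).
  + by move=> _ [x Gx <-]; exists x.
- by move=> x y _ _; rewrite /encode_adj !pickleK_inv.
- by move=> x y _; rewrite /encode_wgt !pickleK_inv.
Qed.

End encode.

Lemma path_component (R : realType) (V : Type) (G : wgraph R V) o s :
  path (adj G) o s -> path (adj (component G o)) o s.
Proof.
elim/last_ind: s => // s y IH; rewrite !rcons_path => /andP[os sy].
apply/andP; split; first exact: IH.
rewrite /= /induced_adj sy !mem_set//; last by exists s.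
by exists (rcons s y); rewrite ?last_rcons// rcons_path os.
Qed.

Section gclass.
Context {R : realType} {V : countType} (G : wgraph R V) (o : V).

Let H := encode (component G o).

Let Ho : vset H (pickle o).
Proof. by exists o => //; exists [::]. Qed.

Let Hconn a : vset H a -> connected_to H (pickle o) a.
Proof.
move=> [_ [s ps <-] <-].
exists (map pickle s); last by rewrite last_map.
rewrite path_map; apply: sub_path (path_component ps) => y z yz.
by rewrite /H /= /encode_adj !pickleK_inv.
Qed.

(* The class [(G(o), w, o)], where G(o) is the connected component of o. *)
Definition gclass : gstar R := \pi_(gstar R) (RGraph Ho Hconn).

Lemma gclassP : riso (component G o) o (repr gclass) (root (repr gclass)).
Proof.
apply: riso_trans (riso_encode _ _) _.
by apply: (proj1 (gstar_eqP (RGraph Ho Hconn) _)); rewrite reprK.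
Qed.

End gclass.

Definition edgeless (R : realType) (V : Type) : wgraph R V.
Proof.
by refine (@WGraph R V setT (fun _ _ => false) (fun _ _ => 0) _ _ _ _ _) => //;
  move=> x; apply: sub_finite_set (@finite_set0 V).
Defined.

(* Pointedness is only required by the library's generated sigma-algebras. *)
HB.instance Definition _ (R : realType) :=
  isPointed.Build (gstar R) (gclass (edgeless R nat) 0%N).

Definition borel (T : ptopologicalType) := g_sigma_algebraType (@open T).

HB.instance Definition _ (T : ptopologicalType) := Measurable.on (borel T).

Definition weak_cvg (R : realType) (T : ptopologicalType)
    (mu : nat -> {measure set (borel T) -> \bar R})
    (nu : {measure set (borel T) -> \bar R}) : Prop :=
  forall f : T -> R, continuous f -> (exists M, forall x, `|f x| <= M) ->
  (fun n => \int[mu n]_x (f x)%:E)%E @ \oo --> (\int[nu]_x (f x)%:E)%E.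

Section uniform_root.
Context {R : realType} {V : finType} (G : wgraph R V).
Local Open Scope ereal_scope.

Definition uniform_root (A : set (borel (gstar R))) : \bar R :=
  (#|[pred o | o \in vset G]|%:R^-1)%:E *
  \sum_(o | o \in vset G) \d_(gclass G o : borel (gstar R)) A.

Let uniform_root_measure :
  exists m : {measure set (borel (gstar R)) -> \bar R},
    forall A, uniform_root A = m A.
Proof.
pose c := #|[pred o | o \in vset G]|%:R^-1%R : R.
have c0 : (0 <= c)%R by rewrite invr_ge0.
have [m mE] : exists m : {measure set (borel (gstar R)) -> \bar R}, forall A,
    m A = \sum_(o <- enum [pred o | o \in vset G])
            \d_(gclass G o : borel (gstar R)) A.
  elim: (enum _) => [|o s [m mE]].
    by exists mzero => A; rewrite big_nil.
  exists (measure_add (\d_(gclass G o : borel (gstar R))) m) => A.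
  by rewrite big_cons -mE; exact: measure_addE.
exists (mscale (NngNum c0) m) => A.
rewrite /uniform_root -big_enum.
by rewrite -(mE A).
Qed.

Let uniform_root0 : uniform_root set0 = 0.
Proof. by have [m ->] := uniform_root_measure; rewrite measure0. Qed.

Let uniform_root_ge0 A : 0 <= uniform_root A.
Proof. by have [m ->] := uniform_root_measure; exact: measure_ge0. Qed.

Let uniform_root_additive : semi_sigma_additive uniform_root.
Proof.
have [m mE] := uniform_root_measure.
by rewrite (_ : uniform_root = m); [exact: measure_semi_sigma_additive
  |apply/funext].
Qed.

HB.instance Definition _ := isMeasure.Build _ _ _
  uniform_root uniform_root0 uniform_root_ge0 uniform_root_additive.

End uniform_root.

Notation subsets n k := {S : {set 'I_n} | #|S| == k}.

Section line_graph.
Context (R : realType) {n k : nat} (r : nat) (H : {set subsets n k}).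

Definition codegree (S1 S2 : subsets n r) : nat :=
  #|[pred e in H | (val S1 \subset val e) && (val S2 \subset val e)]|.

Definition line_adj : rel (subsets n r) :=
  fun S1 S2 => (S1 != S2) &&
    [exists e in H, (val S1 \subset val e) && (val S2 \subset val e)].

Lemma line_adj_irrefl S : ~~ line_adj S S. Proof. by rewrite /line_adj eqxx. Qed.

Lemma line_adj_sym S1 S2 : line_adj S1 S2 = line_adj S2 S1.
Proof.
by rewrite /line_adj eq_sym; under eq_existsb do rewrite andbA andbAC -andbA.
Qed.

Lemma codegree_sym S1 S2 : line_adj S1 S2 ->
  (codegree S1 S2)%:R = (codegree S2 S1)%:R :> R.
Proof.
move=> _; congr (_%:R); apply: eq_card => e.
by rewrite !inE; congr andb; exact: andbC.
Qed.

Definition line_graph : wgraph R (subsets n r) :=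
  @WGraph _ _ setT line_adj (fun S1 S2 => (codegree S1 S2)%:R)
    (fun _ _ _ => conj I I) line_adj_irrefl line_adj_sym codegree_sym
    (fun _ => finite_finset).

End line_graph.

Definition independent_events (d : measure_display) (T : measurableType d)
    (R : realType) (P : probability T R) (I : eqType) (E : I -> set T) : Prop :=
  forall s : seq I, uniq s ->
    P (\bigcap_(i in [set` s]) E i) = (\prod_(i <- s) fine (P (E i)))%:E.

Definition random_hypergraph (d : measure_display) (T : measurableType d)
    (R : realType) (P : probability T R) (n k : nat) (p : R)
    (H : T -> {set subsets n k}) : Prop :=
  [/\ forall e, measurable [set w | e \in H w],
      forall e, P [set w | e \in H w] = p%:E &
      independent_events P (fun e => [set w | e \in H w])].

(* The root is the empty word; [(i, j) :: u] is the [j]-th new vertex of the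
   [i]-th block child of [u]. *)
Notation gw_word b := (seq (nat * 'I_b)).

Section gw_graph.
Context (R : realType) {b : nat} (X : gw_word b -> nat).

Fixpoint gw_alive (u : gw_word b) : bool :=
  if u is (i, _) :: v then (i < X v)%N && gw_alive v else true.

Definition gw_parent (v u : gw_word b) : bool :=
  if u is _ :: u' then u' == v else false.

Definition gw_sibling (u v : gw_word b) : bool :=
  if (u, v) is ((i, j) :: u', (i', j') :: v') then
    [&& u' == v', i == i' & j != j'] else false.

Definition gw_adj : rel (gw_word b) := fun u v =>
  [&& gw_alive u, gw_alive v &
      [|| gw_parent u v, gw_parent v u | gw_sibling u v]].

Lemma gw_adj_alive u v : gw_adj u v -> [set` gw_alive] u /\ [set` gw_alive] v.
Proof. by move=> /and3P[]. Qed.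

Lemma gw_adj_irrefl u : ~~ gw_adj u u.
Proof.
rewrite /gw_adj orbA orbb; case: u => [|[i j] u] /=; first by [].
rewrite /gw_sibling !eqxx /= orbF.
suff /negbTE -> : u != (i, j) :: u by rewrite !andbF.
by apply/eqP => /(congr1 size) /= /eqP; rewrite eqn_leq ltnn andbF.
Qed.

Lemma gw_adj_sym u v : gw_adj u v = gw_adj v u.
Proof.
rewrite /gw_adj andbCA; congr [&& _, _ & _]; rewrite orbCA; congr [|| _, _ | _].
case: u v => [|[i j] u] [|[i' j'] v] //=.
by rewrite /gw_sibling (eq_sym u) (eq_sym i) (eq_sym j).
Qed.

Lemma gw_adj_locfin u : finite_set [set v | gw_adj u v].
Proof.
pose blk (v : gw_word b) := [set (i, j) :: v | i in `I_(X v) & j in [set: 'I_b]].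
have blk_fin v : finite_set (blk v).
  by apply: finite_image2; [exact: finite_II|exact: finite_finset].
apply: (@sub_finite_set _ _ (blk u `|` (blk (behead u) `|` [set behead u]))).
  move=> v /= /and3P[_ gv /or3P[|vu|]].
  - case: v gv => [//|[i j] v] /= /andP[iX _] /eqP vu; left.
    by rewrite -vu; exists i => //; exists j.
  - by right; right; case: u vu => // ? ? /eqP.
  - case: u => [//|[i j] u]; case: v gv => [//|[i' j'] v] /= /andP[iX _].
    move=> /and3P[/eqP -> _ _]; right; left.
    by exists i' => //; exists j'.
by rewrite !finite_setU; split=> //; split => //; exact: finite_set1.
Qed.

Definition gw_graph : wgraph R (gw_word b) :=
  @WGraph _ _ [set` gw_alive] gw_adj (fun _ _ => 1)
    gw_adj_alive gw_adj_irrefl gw_adj_sym (fun _ _ _ => erefl) gw_adj_locfin.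

End gw_graph.

(* [nu] is the law of the random rooted graph built from independent
   Poisson([lambda]) numbers [X u] of [b]-block children of the words [u]. *)
Definition block_GW (R : realType) (b : nat) (lambda : R)
    (nu : probability (borel (gstar R)) R) : Prop :=
  exists (d : measure_display) (T : measurableType d) (Q : probability T R)
    (X : gw_word b -> {RV Q >-> nat}) (Y : {RV Q >-> borel (gstar R)}),
    [/\ forall u (m : nat), Q (X u @^-1` [set m]) = (poisson_pmf lambda m)%:E,
        forall A : gw_word b -> set nat,
          independent_events Q (fun u => X u @^-1` A u),
        forall w, Y w = gclass (gw_graph R (fun u => X u w)) [::] &
        forall B, measurable B -> nu B = distribution Q Y B].

(* Main.v *)
(** Explore the line graph from an r-set S, reaching r-sets indexed by the words
of the Galton-Watson tree: the blocks at an r-set A are the sets d disjoint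
from A such that A :|: d is a hyperedge, other than the hyperedge through
which A was reached.  As long as all the blocks met are disjoint from each
other and from S, the ball of S in the line graph is the ball of the tree
whose offspring numbers are the numbers of blocks.

Weak convergence only requires, for every finite tree, an asymptotic lower
bound of the proportion of the roots S whose exploration gives that tree by
its probability under the limit law, since the latter sum to 1.  In
expectation this bound follows from counting the disjoint events "the blocks
are exactly these".  The number of such roots changes by a bounded amount when
one hyperedge is added, because the exploration that reaches a changed
hyperedge only goes through r-sets of bounded degree; as the expected number
of hyperedges is of the order of the number of r-sets, a Chernoff bound is
exponentially small in this number, and the Borel-Cantelli lemma applies
whatever the coupling of the hypergraphs is. *)
Require Import Defs.
From HB Require Import structures.
From mathcomp Require Import all_boot all_order all_algebra.
From mathcomp Require Import zify lra.
From mathcomp Require Import all_classical all_reals all_analysis.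
From mathcomp Require Import measurable_realfun.

Set Implicit Arguments.
Unset Strict Implicit.
Unset Printing Implicit Defensive.

Import Order.TTheory GRing.Theory Num.Theory.
Import numFieldTopology.Exports numFieldNormedType.Exports.

Local Open Scope classical_set_scope.
Local Open Scope ring_scope.

(** * Words and the exploration of a hypergraph *)

Section words.
Context {b : nat}.
Implicit Types (x : gw_word b -> nat) (u v : gw_word b) (t : nat).

(** Two recursions describe the same exploration: [explore] reads the blocks off a hypergraph,
    [walk] follows prescribed blocks. Types are defined by [explore], but counting needs [walk],
    whose blocks can be chosen freely; the two agree once the prescribed blocks give all the
    hyperedges through the [r]-sets met. Freshness makes this workable: a vertex lies in at most one
    block, at one word, so a word can be recognised from the vertices of its [r]-set. Injectivity,
    adjacency and weights are all obtained by tracing vertices back to the blocks that brought them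
    in. The concentration inequality has to involve the expected number of hyperedges: the number of
    [k]-sets, which a plain bounded difference inequality would give, is of larger order than the
    number of [r]-sets. Hence the estimate of the moment generating function, coordinate by
    coordinate, that keeps the factor [p]. *)

Fixpoint gw_level x t : seq (gw_word b) :=
  if t is t'.+1 then
    [seq ij :: u | u <- gw_level x t', ij <- [seq (i, j) | i <- iota 0 (x u), j <- enum 'I_b]]
  else [:: [::]].

Lemma mem_gw_level x t u : (u \in gw_level x t) = gw_alive x u && (size u == t).
Proof.
elim: t u => [|t IH] [|[i j] u]; rewrite ?andbF //=.
- by apply/negbTE/negP => /allpairsPdep[? [? []]].
- rewrite eqSS; apply/allpairsPdep/idP => [[v [ij [vt /allpairsPdep[i' [j' []]]]]]|].
    rewrite mem_iota add0n /= => i'x _ -> [iE _ uE].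
    by move: vt; rewrite iE uE IH i'x.
  move=> /andP[/andP[ix ua] ut]; exists u, (i, j); rewrite IH ua ut; split => //.
  by apply/allpairsPdep; exists i, j; rewrite mem_iota /= mem_enum.
Qed.

(** The absence of repetitions is used when independence turns a product over these words into a
    probability, and when blocks are stored by position; [undup] provides it at once. *)
Definition gw_inner x t : seq (gw_word b) :=
  undup (flatten [seq gw_level x s | s <- iota 0 t]).

Lemma mem_gw_inner x t u : (u \in gw_inner x t) = gw_alive x u && (size u < t)%N.
Proof.
rewrite mem_undup; apply/flatten_mapP/andP => [[s]|[ua ut]].
  by rewrite mem_iota mem_gw_level /= add0n => st /andP[-> /eqP ->].
by exists (size u); rewrite ?mem_iota // mem_gw_level ua eqxx.
Qed.

(* By [gw_codeP] and [gw_alive_eq], the code determines the words of length at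
   most [t], hence the ball of radius [t]. *)
Definition gw_code x t : seq (gw_word b * nat) := [seq (u, x u) | u <- gw_inner x t].

(** Each level is built from the offspring numbers on the level before, which are inner words. *)
Lemma eq_gw_inner x y t : {in gw_inner x t, x =1 y} -> gw_inner x t = gw_inner y t.
Proof.
move=> xy; congr undup; congr flatten; apply/eq_in_map => s; rewrite mem_iota add0n /=.
elim: s => //= s IH st; rewrite -(IH (ltnW st)).
congr flatten; apply/eq_in_map => u us.
rewrite xy // mem_gw_inner; move: us; rewrite mem_gw_level => /andP[-> /eqP ->] /=.
exact: ltnW.
Qed.

Lemma gw_codeP x y t : gw_code x t = gw_code y t <-> {in gw_inner x t, x =1 y}.
Proof.
split=> [cxy|xy].
  move=> u ux; have : (u, x u) \in gw_code y t by rewrite -cxy map_f.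
  by case/mapP => v _ [-> ->].
by rewrite /gw_code -(eq_gw_inner xy); apply/eq_in_map => u ux; rewrite xy.
Qed.

(** The length [t] itself is allowed, because [gw_alive] consults the offspring numbers at proper
    suffixes only. *)
Lemma gw_alive_eq x y t u : {in gw_inner x t, x =1 y} -> (size u <= t)%N ->
  gw_alive x u = gw_alive y u.
Proof.
move=> xy; elim: u => //= -[i j] u IH ut; rewrite -(IH (ltnW ut)).
have [ua|_] := boolP (gw_alive x u); last by rewrite !andbF.
by rewrite (xy u) // mem_gw_inner ua.
Qed.

Lemma gw_alive_cat x u i j v : gw_alive x (u ++ (i, j) :: v) ->
  (i < x v)%N && gw_alive x v.
Proof. by elim: u => //= -[i' j'] u IH /andP[_]. Qed.

(** Words absent from the list get the default value 0. Decoding lets the types range over the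
    countable set of lists instead of over functions. *)
Definition gw_decode (s : seq (gw_word b * nat)) (u : gw_word b) : nat :=
  nth 0%N (unzip2 s) (index u (unzip1 s)).

Lemma unzip1_gw_code x t : unzip1 (gw_code x t) = gw_inner x t.
Proof. by rewrite /gw_code /unzip1 -map_comp map_id. Qed.

Lemma gw_decodeK x t : {in gw_inner x t, gw_decode (gw_code x t) =1 x}.
Proof.
move=> u ux; rewrite /gw_decode unzip1_gw_code /gw_code /unzip2 -map_comp.
by rewrite (nth_map [::]) ?index_mem // nth_index.
Qed.

Lemma gw_code_decode x t : gw_code (gw_decode (gw_code x t)) t = gw_code x t.
Proof. by apply/esym/gw_codeP => u ux; rewrite gw_decodeK. Qed.

End words.

Section walk.
Context (n k r : nat).
Local Notation b := ('C(k, r) - 1)%N.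
Local Notation vs := {set 'I_n}.

Definition kids (e A : vs) : seq vs :=
  [seq B : {set 'I_n} <- enum {set 'I_n} | [&& B \subset e, #|B| == r & B != A]].

Lemma kids_uniq e A : uniq (kids e A).
Proof. by rewrite filter_uniq // enum_uniq. Qed.

Lemma mem_kids (e A B : vs) : (B \in kids e A) = [&& B \subset e, #|B| == r & B != A].
Proof. by rewrite mem_filter mem_enum andbT. Qed.

Lemma size_kids (e A : vs) : A \subset e -> #|A| = r -> #|e| = k -> size (kids e A) = b.
Proof.
move=> Ae Ar ek; rewrite -ek -cards_draws (cardsD1 A) inE Ae Ar eqxx /= add1n subn1 /=.
rewrite -(card_uniqP (kids_uniq _ _)); apply: eq_card => B.
by rewrite mem_kids !inE andbA andbC.
Qed.

(* [walk D S u] is the pair of the [r]-set reached by the word [u] from [S] when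
   the hyperedges met at [v] are the unions of the current [r]-set with the
   members of [D v], and of the hyperedge through which [u] has been reached. *)
Fixpoint walk (D : gw_word b -> {set vs}) (S : vs) (u : gw_word b) : vs * vs :=
  if u is (i, j) :: v then
    let A := (walk D S v).1 in
    let e := A :|: nth finset.set0 (enum (D v)) i in
    (nth finset.set0 (kids e A) j, e)
  else (S, finset.set0).

(** The hyperedge of arrival [w.2] is left out, as it is already a block at the parent. At the root
    [w.2] is empty, so nothing is left out when the hyperedges are nonempty. *)
Definition new_blocks (E : {set vs}) (w : vs * vs) : {set vs} :=
  [set d : vs | [&& [disjoint d & w.1], w.1 :|: d \in E & w.1 :|: d != w.2]].

Fixpoint explore (E : {set vs}) (S : vs) (u : gw_word b) : vs * vs :=
  if u is (i, j) :: v then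
    let w := explore E S v in
    let e := w.1 :|: nth finset.set0 (enum (new_blocks E w)) i in
    (nth finset.set0 (kids e w.1) j, e)
  else (S, finset.set0).

Definition blocks (E : {set vs}) (S : vs) (u : gw_word b) : {set vs} :=
  new_blocks E (explore E S u).

Lemma exploreE E S : explore E S =1 walk (blocks E S) S.
Proof. by elim=> //= -[i j] u <-. Qed.

(** The equality [d == d'] is tolerated at a single word only. When [r < k] the blocks are nonempty,
    so the same block at two different words counts as a collision. *)
Definition fresh (D : gw_word b -> {set vs}) (S : vs) (us : seq (gw_word b)) : bool :=
  all (fun u => [forall d in D u, (#|d| == k - r)%N && [disjoint d & S]]) us &&
  all (fun u => all (fun v => [forall d in D u, [forall d' in D v,
    ((u == v) && (d == d')) || [disjoint d & d']]]) us) us.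

End walk.

(** * The correspondence between words and [r]-sets in a fresh exploration *)

Section tree.
Context (n k r : nat) (r_lt_k : (r < k)%N).
Local Notation b := ('C(k, r) - 1)%N.
Local Notation vs := {set 'I_n}.
Variables (D : gw_word b -> {set vs}) (S : vs) (x : gw_word b -> nat) (T : nat).
Hypothesis Sr : #|S| = r.
Hypothesis xE : {in gw_inner x T, forall u, x u = #|D u|}.
Hypothesis Df : fresh D S (gw_inner x T).

Local Notation phi u := (walk D S u).1.
Local Notation blk u i := (nth finset.set0 (enum (D u)) i).

Lemma blkP u i : u \in gw_inner x T -> (i < x u)%N -> blk u i \in D u.
Proof. by move=> uT; rewrite xE // cardE => /(mem_nth finset.set0); rewrite mem_enum. Qed.

Lemma card_blk u i : u \in gw_inner x T -> (i < x u)%N -> #|blk u i| = (k - r)%N.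
Proof.
move=> uT /(blkP uT) du; have /andP[/allP/(_ _ uT)/forall_inP/(_ _ du)/andP[/eqP]] := Df.
by [].
Qed.

Lemma disjoint_blk_root u i z : u \in gw_inner x T -> (i < x u)%N -> z \in blk u i ->
  z \in S -> False.
Proof.
move=> uT /(blkP uT) du zd zS.
have /andP[/allP/(_ _ uT)/forall_inP/(_ _ du)/andP[_ /pred0P/(_ z)]] := Df.
by rewrite /= zd zS.
Qed.

Lemma blk_inj u i v j z : u \in gw_inner x T -> (i < x u)%N -> v \in gw_inner x T ->
  (j < x v)%N ->
  z \in blk u i -> z \in blk v j -> u = v /\ i = j.
Proof.
move=> uT iu vT jv zu zv.
have /andP[_ /allP/(_ _ uT)/allP/(_ _ vT)] := Df.
move=> /forall_inP/(_ _ (blkP uT iu))/forall_inP/(_ _ (blkP vT jv)).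
case/orP => [/andP[/eqP uv /eqP ij]|/pred0P/(_ z)]; last by rewrite /= zu zv.
split=> //; move: ij jv; rewrite -uv => ij jv; apply/eqP.
rewrite -(nth_uniq finset.set0 _ _ (enum_uniq (D u))) ?ij // -cardE -xE //.
Qed.

Lemma inner_alive u : gw_alive x u -> (size u < T)%N -> u \in gw_inner x T.
Proof. by rewrite mem_gw_inner => -> ->. Qed.

(** A child is contained in the union of its parent and one block, so vertices enter the walk only
    through the blocks at proper suffixes of the word. *)
Lemma phi_support u z : gw_alive x u -> (size u <= T)%N -> z \in phi u ->
  z \in S \/ exists w i j v,
    [/\ u = w ++ (i, j) :: v, v \in gw_inner x T, (i < x v)%N & z \in blk v i].
Proof.
elim: u z => [|[i j] u IH] z /=; first by left.
move=> /andP[iu ua] uT zu; have uI := inner_alive ua uT.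
have : z \in phi u :|: blk u i.
  move: zu; set s := kids _ _ _; have [js|sj] := ltnP j (size s);
    last by rewrite nth_default // inE.
  by have := mem_nth finset.set0 js; rewrite mem_kids => /and3P[/fintype.subsetP h _ _] /h.
rewrite inE => /orP[zpu|zb].
  have [|[w [i' [j' [v [-> vI iv zv]]]]]] := IH z ua (ltnW uT) zpu; first by left.
  by right; exists ((i, j) :: w), i', j', v.
by right; exists [::], i, j, u.
Qed.

(** A common vertex would also belong to a block at a proper suffix of [u]; freshness would make
    this suffix equal to [u]. *)
Lemma phi_disjoint_blk u i z : u \in gw_inner x T -> (i < x u)%N -> z \in phi u ->
  z \in blk u i -> False.
Proof.
move=> uI iu zp zb; move: (uI); rewrite mem_gw_inner => /andP[ua uT].
have [|[w [i' [j' [v [uE vI iv zv]]]]]] := phi_support ua (ltnW uT) zp.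
  exact: disjoint_blk_root uI iu zb.
have [uv _] := blk_inj uI iu vI iv zb zv.
move: uE; rewrite uv => /(congr1 size)/eqP; rewrite size_cat /= addnS -addSn.
by rewrite -{1}[size v]add0n eqn_add2r.
Qed.

Lemma card_phi u : gw_alive x u -> (size u <= T)%N -> #|phi u| = r.
Proof.
elim: u => [//|[i j] u IH] /= /andP[iu ua] uT; have uI := inner_alive ua uT.
have pr := IH ua (ltnW uT).
set e := _ :|: _.
(* The hyperedge has exactly [k] elements, hence [b] kids: the position [j] is in range and the
   default of [nth] is not taken. *)
have : nth finset.set0 (kids r e (phi u)) j \in kids r e (phi u).
  have ek : #|e| = k.
    rewrite /e cardsU (_ : _ :&: _ = finset.set0); last first.
      apply/setP => z; rewrite !inE; apply/negP => /andP[zp zb].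
      exact: phi_disjoint_blk zp zb.
    by rewrite cards0 subn0 pr card_blk // subnKC // ltnW.
  by apply: mem_nth; rewrite (@size_kids _ k) // finset.subsetUl.
by rewrite mem_kids => /and3P[_ /eqP].
Qed.

Lemma card_edge u i : u \in gw_inner x T -> (i < x u)%N -> #|phi u :|: blk u i| = k.
Proof.
move=> uI iu; move: (uI); rewrite mem_gw_inner => /andP[ua uT].
rewrite cardsU (_ : _ :&: _ = finset.set0); last first.
  apply/setP => z; rewrite !inE; apply/negP => /andP[zp zb].
  exact: phi_disjoint_blk zp zb.
by rewrite cards0 subn0 (card_phi ua (ltnW uT)) card_blk // subnKC // ltnW.
Qed.

Lemma size_kids_phi u i : u \in gw_inner x T -> (i < x u)%N ->
  size (kids r (phi u :|: blk u i) (phi u)) = b.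
Proof.
move=> uI iu; move: (uI); rewrite mem_gw_inner => /andP[ua uT].
by rewrite (@size_kids _ k) ?finset.subsetUl ?card_edge ?(card_phi ua (ltnW uT)).
Qed.

(** The child meets the new block because it differs from its parent and has the same cardinality,
    so that it is not included in it. *)
Lemma phi_consP i j u : u \in gw_inner x T -> (i < x u)%N ->
  [/\ phi ((i, j) :: u) \subset phi u :|: blk u i, phi ((i, j) :: u) != phi u &
   exists2 z, z \in phi ((i, j) :: u) & z \in blk u i].
Proof.
move=> uI iu /=; have : nth finset.set0 (kids r (phi u :|: blk u i) (phi u)) j \in
    kids r (phi u :|: blk u i) (phi u).
  by apply: mem_nth; rewrite size_kids_phi.
set A := nth _ _ _.
rewrite mem_kids => /and3P[Ae /eqP Ar Ap]; split => //.
move: (uI); rewrite mem_gw_inner => /andP[ua uT].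
have : ~~ (A \subset phi u).
  apply: contra Ap => Ap; by rewrite eqEcard Ap (card_phi ua (ltnW uT)) Ar /=.
case/fintype.subsetPn => z zA zp; exists z => //.
by have := fintype.subsetP Ae _ zA; rewrite inE (negbTE zp).
Qed.

(** A vertex of a block betrays the block it came from. The last label [j'] stays unknown, since the
    members of one block clique can share vertices. *)
Lemma phi_sub_blk_ancestor i j v u : gw_alive x ((i, j) :: v) -> (size v < T)%N ->
  gw_alive x u -> (size u <= T)%N ->
  (exists2 z, z \in phi u & z \in blk v i) -> exists w j', u = w ++ (i, j') :: v.
Proof.
move=> /= /andP[iv va] vT ua uT [z zu zv].
have vI := inner_alive va vT.
have [zS|[w [i' [j' [v' [-> vI' iv' zv']]]]]] := phi_support ua uT zu.
  by case: (disjoint_blk_root vI iv zv zS).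
by have [-> ->] := blk_inj vI iv vI' iv' zv zv'; exists w, j'.
Qed.

(** If neither word is empty, each [r]-set meets the last block of the other, so each word descends
    from the last block of the other. Comparing lengths, both end with the same block at the same
    parent, and the label follows from the uniqueness of [kids]. *)
Lemma phi_inj u v : gw_alive x u -> (size u <= T)%N -> gw_alive x v -> (size v <= T)%N ->
  phi u = phi v -> u = v.
Proof.
move=> ua uT va vT uv.
have root_case i j w : gw_alive x ((i, j) :: w) -> (size w < T)%N -> S = phi ((i, j) :: w) ->
  False.
  move=> /andP[iw wa] wT SE; have wI := inner_alive wa wT.
  have [_ _ [z]] := phi_consP j wI iw; rewrite -SE => zS zw.
  exact: disjoint_blk_root wI iw zw zS.
case: u v ua uT va vT uv => [|[i j] u] [|[i' j'] v] // ua uT va vT uv.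
- by case: (root_case _ _ _ va vT uv).
- by case: (root_case _ _ _ ua uT (esym uv)).
have meet i1 j1 w : gw_alive x ((i1, j1) :: w) -> (size w < T)%N ->
    exists2 z, z \in phi ((i1, j1) :: w) & z \in blk w i1.
  by move=> /= /andP[iw wa] wT; have [] := phi_consP j1 (inner_alive wa wT) iw.
have [w1 [j1 vE]] : exists w j1, (i', j') :: v = w ++ (i, j1) :: u.
  apply: (phi_sub_blk_ancestor ua uT va vT); rewrite -uv; exact: meet.
have [w2 [j2 uE]] : exists w j2, (i, j) :: u = w ++ (i', j2) :: v.
  apply: (phi_sub_blk_ancestor va vT ua uT); rewrite uv; exact: meet.
have w10 : w1 = [::].
  apply: size0nil; have := congr1 size vE; have := congr1 size uE.
  by rewrite !size_cat /=; clear; lia.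
move: vE uv va; rewrite w10 /= => -[-> -> ->] uv va.
move: ua => /= /andP[iu ua]; have uI := inner_alive ua uT.
have /eqP := uv; rewrite nth_uniq ?kids_uniq ?size_kids_phi // => /eqP/val_inj jj.
by rewrite jj.
Qed.

(** If [phi w] avoids the block, it is included in [phi v], hence equal to it. Otherwise [w]
    descends from the block; were it deeper than a child, a vertex of its own last block would lie
    in [phi v], and [v] would descend from [w]. *)
Lemma phi_sub_edge w v i : gw_alive x w -> (size w <= T)%N -> v \in gw_inner x T ->
  (i < x v)%N ->
  phi w \subset phi v :|: blk v i -> w = v \/ exists j, w = (i, j) :: v.
Proof.
move=> wa wT vI iv /fintype.subsetP sub; move: (vI); rewrite mem_gw_inner => /andP[va vT].
have eqsub : (forall z, z \in phi w -> z \notin blk v i) -> w = v.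
  move=> nb; apply: phi_inj => //; first exact: ltnW.
  apply/eqP; rewrite eqEcard !card_phi ?leqnn ?andbT //; last exact: ltnW.
  by apply/fintype.subsetP => z zw; have := sub z zw; rewrite inE (negbTE (nb _ zw)) orbF.
case: w wa wT sub eqsub => [|[i' j'] u] wa wT sub eqsub.
  by left; apply: eqsub => z zS; apply/negP => zb; exact: disjoint_blk_root vI iv zb zS.
have [/existsP[z /andP[zw zv]]|/existsPn h] :=
    boolP [exists z, (z \in phi ((i', j') :: u)) && (z \in blk v i)]; last first.
  by left; apply: eqsub => z zw; have := h z; rewrite zw.
have vc : exists j, gw_alive x ((i, j) :: v) by exists j'; rewrite /= iv va.
have [j jv] := vc.
have [w1 [j1 wE]] := phi_sub_blk_ancestor jv vT wa wT (ex_intro2 _ _ z zw zv).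
move: (wa) => /= /andP[iu ua]; have uI := inner_alive ua wT.
have [_ _ [z' z'w z'u]] := phi_consP j' uI iu.
have := sub _ z'w; rewrite inE => /orP[z'v|z'v]; last first.
  by have [-> ->] := blk_inj uI iu vI iv z'u z'v; right; exists j'.
have [w2 [j2 vE]] := phi_sub_blk_ancestor wa wT va (ltnW vT) (ex_intro2 _ _ z' z'v z'u).
have := congr1 size vE; have := congr1 size wE; rewrite !size_cat /=; clear; lia.
Qed.

End tree.

(** * Isomorphisms of balls *)

Section balls.
Local Notation within := Defs.within.
Context {R : realType}.

(** Surjectivity onto the ball is reduced to lifting one edge at a vertex at distance less than [t];
    the lifting then propagates along paths. *)
Lemma riso_gball_of (V V' : Type) (G : wgraph R V) o (G' : wgraph R V') o' t (f : V -> V') :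
  f o = o' ->
  (forall x y, within G o t x -> within G o t y -> f x = f y -> x = y) ->
  (forall x y, within G o t x -> within G o t y -> adj G' (f x) (f y) = adj G x y) ->
  (forall x y, within G o t x -> within G o t y -> adj G x y ->
    wgt G' (f x) (f y) = wgt G x y) ->
  (forall s x y', (s < t)%N -> within G o s x -> adj G' (f x) y' -> exists2 y,
    adj G x y & f y = y') ->
  riso (gball G o t) o (gball G' o' t) o'.
Proof.
move=> fo finj fadj fwgt fsur.
have fwd s : (s <= t)%N -> forall x, within G o s x -> within G' o' s (f x).
  elim: s => [_ x|s IH st y ys]; first by rewrite !within0 => /= ->.
  have [->|[x xs xy]] := withinSP ys; first by rewrite fo; exact: within_root.
  apply: (@withinS _ _ _ _ _ (f x)); first exact: IH (ltnW st) _ xs.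
  by rewrite fadj //; [exact: sub_within (ltnW st) _ xs|exact: sub_within st _ ys].
have bwd s : (s <= t)%N -> forall y, within G' o' s y -> exists2 x, within G o s x & f x = y.
  elim: s => [_ y|s IH st y' ys].
    by rewrite within0 => /= ->; exists o => //; exact: within_root.
  have [->|[x' xs xy]] := withinSP ys; first by exists o => //; exact: within_root.
  have [x xs' xE] := IH (ltnW st) _ xs; rewrite -xE in xy.
  by have [y xy' fy] := fsur _ _ _ st xs' xy; exists y => //; exact: withinS xs' xy'.
exists f; split => //=.
- split; first by move=> x; exact: fwd.
  + by move=> x y; rewrite !inE; exact: finj.
  + by move=> y /(bwd _ (leqnn t))[x xt <-]; exists x.
- move=> x y xt yt; rewrite /induced_adj fadj // !mem_set //; exact: fwd.
- by move=> x y /and3P[/set_mem xt /set_mem yt xy]; exact: fwgt.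
Qed.

Lemma within_vset V (G : wgraph R V) o t : vset G o -> within G o t `<=` vset G.
Proof. by move=> Go x xt; exact: connected_to_vset Go _ (within_connected_to xt). Qed.

Lemma riso_gball (V V' : Type) (G : wgraph R V) o (G' : wgraph R V') o' t :
  vset G o -> riso G o G' o' -> riso (gball G o t) o (gball G' o' t) o'.
Proof.
move=> Go [f [[ffun finj fsurj] fo fadj fwgt]].
have inG := within_vset Go.
apply: (@riso_gball_of _ _ _ _ _ _ _ f) => //.
- by move=> x y /inG Gx /inG Gy; apply: finj; rewrite inE.
- by move=> x y /inG Gx /inG Gy; exact: fadj.
- by move=> x y _ _; exact: fwgt.
- move=> s x y' _ /inG Gx xy'; have [_ Gy'] := adj_vset xy'.
  have [y Gy fy] := fsurj _ Gy'; exists y => //.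
  by rewrite -fadj // fy.
Qed.

Lemma riso_gball_component V (G : wgraph R V) o t :
  riso (gball (component G o) o t) o (gball G o t) o.
Proof.
have wc s : within (component G o) o s `<=` connected_to G o.
  move=> x xt; have [p ps <-] := within_connected_to xt; exists p => //.
  by apply: sub_path ps => y z /and3P[].
apply: (@riso_gball_of _ _ _ _ _ _ _ id) => //=.
- move=> x y /wc/mem_set xo /wc/mem_set yo.
  by rewrite /induced_adj xo yo.
- move=> s x y _ xs xy; exists y => //.
  have [p pp px] := wc _ _ xs; rewrite /induced_adj xy !mem_set //.
    by exists (rcons p y); rewrite ?last_rcons // rcons_path pp px.
  by exists p.
Qed.

Lemma gclass_gball (V : countType) (G : wgraph R V) o t :
  riso (gball G o t) o
    (gball (repr (gclass G o)) (Defs.root (repr (gclass G o))) t) (Defs.root (repr (gclass G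
      o))).
Proof.
have h : riso (gball G o t) o (gball (component G o) o t) o.
  by apply: riso_sym (riso_gball_component G o t); exact: within_root.
apply: (riso_trans h).
by apply: riso_gball; [exists [::]|exact: gclassP].
Qed.

End balls.

Section gw.
Local Notation within := Defs.within.
Context {R : realType} {b : nat}.
Implicit Types x : gw_word b -> nat.

(** A step to a parent or a child changes the length by one, a step to a sibling keeps it;
    conversely the suffixes of a word form a path from the root. *)
Lemma within_gw x t : within (gw_graph R x) [::] t = [set u | gw_alive x u && (size u <= t)%N].
Proof.
apply/seteqP; split=> u /=.
  elim: t u => [|t IH] u; first by rewrite within0 => /= ->.
  move=> us; have [->//|[v vs /and3P[_ ua]]] := withinSP us; rewrite ua /=.
  have /andP[va vt] := IH _ vs; clear us vs.
  case/or3P.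
  - by case: u {ua} => // ij u /eqP ->.
  - by case: v {va} vt => // ij v vt /eqP <-; exact: leq_trans (ltnW vt) (leqnSn _).
  - case: u {ua} => [|[i j] u]; case: v {va} vt => [|[i' j'] v] //= vt.
    by move=> /and3P[/eqP <- _ _]; exact: ltnW.
elim: t u => [|t IH] [|ij u] //=; try by move=> _; exact: within_root.
  by rewrite andbF.
move=> /andP[ijua ut]; have ua : gw_alive x u by case: ij ijua => i j /andP[].
apply: (@withinS _ _ _ _ _ u); first by apply: IH; rewrite ua.
by rewrite /= /gw_adj ua /= eqxx andbT.
Qed.

Lemma gw_code_gball x y t : gw_code x t = gw_code y t ->
  riso (gball (gw_graph R x) [::] t) [::] (gball (gw_graph R y) [::] t) [::].
Proof.
move=> /gw_codeP xy.
have alive_xy u : (size u <= t)%N -> gw_alive x u = gw_alive y u by move=> ut;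
  apply: gw_alive_eq ut.
apply: (@riso_gball_of _ _ _ _ _ _ _ _ id) => //=.
- rewrite within_gw => u v /andP[ua ut] /andP[va vt].
  by rewrite /gw_adj -!alive_xy ?ua ?va.
- move=> s u v st; rewrite within_gw /= => /andP[ua us].
have uvt : gw_adj y u v -> (size v <= t)%N.
  move=> /and3P[_ _ /or3P[]].
  - by case: v => // ij v /eqP ->; rewrite /= (leq_ltn_trans us).
  - by case: u us {ua} => // ij u us /eqP <-; exact: leq_trans (ltnW us) (ltnW st).
  - case: u us {ua} => [|[i j] u] us; case: v => [|[i' j'] v] //=.
    by move=> /and3P[/eqP <- _ _]; exact: leq_trans us (ltnW st).
move=> uv; exists v => //; move: (uv); rewrite /gw_adj !alive_xy // ?(uvt uv) //.
exact: leq_trans us (ltnW st).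
Qed.

End gw.

(** * The ball of a root whose exploration meets no cycle *)

Definition in_block {b} (v : gw_word b) (i : nat) (u : gw_word b) : Prop :=
  u = v \/ exists j, u = (i, j) :: v.

(** Two cliques of the tree share at most one vertex. This is what makes the edge weights of the
    line graph equal to 1. *)
Lemma in_block_uniq b (v : gw_word b) i (v' : gw_word b) i' (u w : gw_word b) : u <> w ->
  in_block v i u -> in_block v i w -> in_block v' i' u -> in_block v' i' w -> v = v' /\ i = i'.
Proof.
move=> uw [uv|[j uv]] [wv|[j' wv]] [uv'|[j1 uv']] [wv'|[j1' wv']].
all: try by case: uw; congruence.
all: try by (split; congruence).
all: exfalso; move: uw uv wv uv' wv'; clear.
all: do ?[move=> uw /(congr1 size) h1 /(congr1 size) h2 /(congr1 size) h3 /(congr1 size) h4;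
  move: h1 h2 h3 h4 => /=; lia].
Qed.

Section explored_ball.
Context (n k r : nat) (r_lt_k : (r < k)%N).
Local Notation b := ('C(k, r) - 1)%N.
Local Notation vs := {set 'I_n}.

Definition nblocks (E : {set vs}) (S : vs) (u : gw_word b) : nat := #|blocks E S u|.

Definition treelike (E : {set vs}) (S : vs) (t : nat) : bool :=
  fresh (blocks E S) S (gw_inner (nblocks E S) t).

Definition hedges (H : {set subsets n k}) : {set vs} := [set val e | e in H].

Lemma mem_hedges (H : {set subsets n k}) e : (val e \in hedges H) = (e \in H).
Proof. by rewrite mem_imset //; exact: val_inj. Qed.

Lemma hedgesP (H : {set subsets n k}) (e : vs) : reflect (exists2 e',
  e' \in H & e = val e') (e \in hedges H).
Proof. by apply: (iffP imsetP). Qed.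

Variables (E : {set vs}) (S : vs).
Hypothesis Ek : forall e, e \in E -> #|e| = k.
Hypothesis Sr : #|S| = r.

Local Notation x := (nblocks E S).
Local Notation D := (blocks E S).
Local Notation phi u := (walk D S u).1.
Local Notation blk u i := (nth finset.set0 (enum (D u)) i).

Lemma blocksP (u : gw_word b) (d : vs) : reflect
  [/\ [disjoint d & phi u]%B, phi u :|: d \in E & phi u :|: d != (walk D S u).2] (d \in D u).
Proof. by rewrite -exploreE inE; exact: and3P. Qed.

Lemma nth_blocks (u : gw_word b) i : (i < x u)%N -> blk u i \in D u.
Proof. by rewrite /nblocks cardE => /(mem_nth finset.set0); rewrite mem_enum. Qed.

Lemma block_edge (u : gw_word b) i : (i < x u)%N -> phi u :|: blk u i \in E.
Proof. by move=> /nth_blocks/blocksP[]. Qed.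

Lemma edge_cases (u : gw_word b) (e : vs) : e \in E -> phi u \subset e ->
  (exists2 i, (i < x u)%N & e = phi u :|: blk u i) \/
  exists v i j, u = (i, j) :: v /\ e = phi v :|: blk v i.
Proof.
move=> eE ue; have [eq2|neq2] := eqVneq e (walk D S u).2.
  right; move: eE eq2; case: (u) => [|[i j] v] eE /=.
    (* At the root the hyperedge of arrival is empty, whereas [e] has [k > r] elements. *)
    by move=> e0; move: (Ek eE); rewrite e0 cards0 => k0; move: r_lt_k; rewrite -k0.
  by exists v, i, j.
left; have UE : phi u :|: (e :\: phi u) = e by rewrite finset.setDE finset.setUIr finset.setUCr
  finset.setIT; apply/finset.setUidPr.
have dD : e :\: phi u \in D u.
  apply/blocksP; rewrite UE; split => //.
  by rewrite disjoint_sym finset.disjoints_subset finset.setDE finset.setCI finset.setCK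
    finset.subsetUr.
exists (index (e :\: phi u) (enum (D u))).
  by rewrite /nblocks cardE index_mem mem_enum.
by rewrite nth_index ?UE // mem_enum.
Qed.

Section good.
Variable t : nat.
Hypothesis tl : treelike E S t.+1.

Local Notation T := t.+1.

Let xE : {in gw_inner x T, forall u, x u = #|D u|}. Proof. by []. Qed.

Let alive_inner u : gw_alive x u -> (size u <= t)%N -> u \in gw_inner x T.
Proof. by move=> ua ut; rewrite mem_gw_inner ua. Qed.

Lemma edge_block u (e : vs) : gw_alive x u -> (size u <= t)%N -> e \in E -> phi u \subset e ->
  exists v i, [/\ v \in gw_inner x T, (i < x v)%N & e = phi v :|: blk v i].
Proof.
move=> ua ut eE ue; have [[i iu ->]|[v [i [j [uE ->]]]]] := edge_cases eE ue.
  by exists u, i; split=> //; exact: alive_inner.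
exists v, i; move: ua ut; rewrite uE /= => /andP[iv va] vt; split=> //.
by apply: alive_inner => //; exact: ltnW.
Qed.

Lemma in_blockP u v i : gw_alive x u -> (size u <= t)%N -> v \in gw_inner x T -> (i < x v)%N ->
  phi u \subset phi v :|: blk v i -> in_block v i u.
Proof.
by move=> ua ut vI iv; apply: (phi_sub_edge r_lt_k Sr xE tl ua (leqW ut) vI iv).
Qed.

Lemma phi_in_block u v i : v \in gw_inner x T -> (i < x v)%N -> in_block v i u ->
  phi u \subset phi v :|: blk v i.
Proof.
move=> vI iv [->|[j ->]]; first exact: finset.subsetUl.
by have [] := phi_consP r_lt_k Sr xE tl j vI iv.
Qed.

Lemma in_block_adj v i u w : gw_alive x u -> gw_alive x w -> u <> w ->
  in_block v i u -> in_block v i w -> gw_adj x u w.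
Proof.
move=> ua wa; rewrite /gw_adj ua wa /= => uw [uv|[j uv]] [wv|[j' wv]].
- by case: uw; congruence.
- by rewrite wv uv /= eqxx.
- by rewrite wv uv /= eqxx orbT.
- rewrite wv uv /gw_sibling /= !eqxx /=; apply/orP; right; apply/orP; right.
  by apply/eqP => jj; case: uw; congruence.
Qed.

Lemma adj_in_block u w : gw_adj x u w -> (size u <= t)%N -> (size w <= t)%N ->
  exists v i, [/\ v \in gw_inner x T, (i < x v)%N, in_block v i u & in_block v i w].
Proof.
move=> /and3P[ua wa] + ut wt; case/or3P.
- case: w wa wt => // -[i j] w /andP[iw wa] wt /eqP <-; exists w, i.
  split=> //; [by apply: alive_inner => //; exact: ltnW|by left|by right; exists j].
- case: u ua ut => // -[i j] u /andP[iw wa'] ut /eqP <-; exists u, i.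
  split=> //; [by apply: alive_inner => //; exact: ltnW|by right; exists j|by left].
- case: u ua ut => [|[i j] u]; case: w wa wt => [|[i' j'] w] //.
  move=> /andP[iw wa] wt /andP[iu ua] ut /and3P[/eqP uw /eqP ii _].
  exists u, i; rewrite -uw -ii; split=> //.
  + by apply: alive_inner => //; exact: ltnW.
  + by right; exists j.
  + by right; exists j'.
Qed.

Lemma mem_block_alive v i u : v \in gw_inner x T -> (i < x v)%N -> in_block v i u ->
  gw_alive x u.
Proof. by rewrite mem_gw_inner => /andP[va _] iv [->//|[j ->]]; rewrite /= iv. Qed.

(** [kids] lists all the [r]-subsets of a hyperedge except the current one, so the exploration
    misses no neighbour in the line graph. *)
Lemma subset_block (A : vs) v i : v \in gw_inner x T -> (i < x v)%N ->
  A \subset phi v :|: blk v i -> #|A| = r -> exists2 u, in_block v i u & phi u = A.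
Proof.
move=> vI iv Ae Ar; have [->|Av] := eqVneq A (phi v); first by exists v => //; left.
have Ak : A \in kids r (phi v :|: blk v i) (phi v) by rewrite mem_kids Ae Ar eqxx.
have jb : (index A (kids r (phi v :|: blk v i) (phi v)) < b)%N.
  by rewrite -(size_kids_phi r_lt_k Sr xE tl vI iv) index_mem.
exists ((i, Ordinal jb) :: v); first by right; exists (Ordinal jb).
by rewrite /= nth_index.
Qed.

End good.
End explored_ball.

Section line_graph_ball.
Context (R : realType) (n k r : nat) (r_lt_k : (r < k)%N).
Local Notation b := ('C(k, r) - 1)%N.
Variables (H : {set subsets n k}) (S : subsets n r).
Local Notation E := (hedges H).
Local Notation x := (@nblocks n k r E (val S)).

Let Ek e : e \in E -> #|e| = k.
Proof. by case/hedgesP => e' _ ->; exact/eqP/(valP e'). Qed.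

Let Sr : #|val S| = r. Proof. exact/eqP/(valP S). Qed.

Lemma codegree1 (S1 S2 : subsets n r) (e : subsets n k) :
  e \in H -> val S1 \subset val e -> val S2 \subset val e ->
  (forall e', e' \in H -> val S1 \subset val e' -> val S2 \subset val e' -> e' = e) ->
  codegree H S1 S2 = 1%N.
Proof.
move=> eH e1 e2 uniq_e; apply/eqP/card1P; exists e => e'.
apply/and3P/eqP => [[e'H e'1 e'2]|->]; last by split.
exact: uniq_e.
Qed.

(** The default [S] only serves the words for which the walk does not yield an [r]-set. *)
Definition explored (u : gw_word b) : subsets n r := insubd S (walk (blocks E (val S)) (val S)
  u).1.

(** One more level is required than the radius: a hyperedge through two [r]-sets at distance [t]
    from [S] adds an edge to the ball, so the blocks at the words of length [t] have to be fresh
    too. *)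
Lemma line_graph_gball t : treelike k r E (val S) t.+1 ->
  riso (gball (gw_graph R x) [::] t) [::] (gball (line_graph R r H) S t) S.
Proof.
move=> tl; pose T := t.+1.
have xE : {in gw_inner x T, forall u, x u = #|blocks E (val S) u|} by [].
have phr u : gw_alive x u -> (size u <= T)%N -> #|(walk (blocks E (val S)) (val S) u).1| = r.
  by move=> ua ut; apply: (card_phi r_lt_k Sr xE tl ua ut).
have val_f u : gw_alive x u -> (size u <= T)%N -> val (explored u) = (walk (blocks E (val S))
  (val S) u).1.
  by move=> ua ut; rewrite /explored val_insubd phr ?eqxx.
have f_inj u v : gw_alive x u -> (size u <= T)%N -> gw_alive x v -> (size v <= T)%N ->
    explored u = explored v -> u = v.
  move=> ua ut va vt uv; apply: (phi_inj r_lt_k Sr xE tl ua ut va vt).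
  by rewrite -!val_f // uv.
have f_edge u e : gw_alive x u -> (size u <= t)%N -> e \in H ->
  val (explored u) \subset val e ->
    exists v i, [/\ v \in gw_inner x T, (i < x v)%N &
      val e = (walk (blocks E (val S)) (val S) v).1 :|: nth finset.set0 (enum (blocks E (val S)
        v)) i].
  move=> ua ut eH; rewrite val_f ?(leqW ut) // => ue.
  by apply: (edge_block r_lt_k Ek ua ut _ ue); rewrite mem_hedges.
have blockE v i : v \in gw_inner x T -> (i < x v)%N -> exists2 e : subsets n k, e \in H &
    val e = (walk (blocks E (val S)) (val S) v).1 :|: nth finset.set0 (enum (blocks E (val S)
      v)) i.
  by move=> vI iv; have := block_edge iv; case/hedgesP => e eH eE; exists e.
have f_in u v i : v \in gw_inner x T -> (i < x v)%N -> gw_alive x u -> (size u <= t)%N ->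
    (in_block v i u <-> val (explored u) \subset
      (walk (blocks E (val S)) (val S) v).1 :|: nth finset.set0 (enum (blocks E (val S) v)) i).
  move=> vI iv ua ut; rewrite val_f ?(leqW ut) //; split.
    exact: (phi_in_block r_lt_k Sr tl vI iv).
  exact: (in_blockP r_lt_k Sr tl ua ut vI iv).
have adjE u v : gw_alive x u -> (size u <= t)%N -> gw_alive x v -> (size v <= t)%N ->
    line_adj H (explored u) (explored v) = gw_adj x u v.
  move=> ua ut va vt; apply/idP/idP.
    move=> /andP[/eqP uv /exists_inP[e eH /andP[ue ve]]].
    have [w [i [wI iw eE]]] := f_edge _ _ ua ut eH ue.
    rewrite eE in ue ve.
    apply: (in_block_adj ua va _ (proj2 (f_in _ _ _ wI iw ua ut) ue) (proj2 (f_in _ _ _ wI iw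
      va vt) ve)).
    by move=> uv'; apply: uv; rewrite uv'.
  move=> uv; have [w [i [wI iw wu wv]]] := adj_in_block uv ut vt.
  apply/andP; split.
    apply/eqP => /f_inj uvE; have := adj_irrefl (gw_graph R x) u.
    by rewrite /= {2}uvE ?uv // leqW.
  have [e eH eE] := blockE _ _ wI iw; apply/exists_inP; exists e => //.
  by rewrite eE; apply/andP; split; apply/f_in.
apply: (@riso_gball_of _ _ _ _ _ _ _ _ explored); rewrite ?within_gw /=.
- by apply: val_inj; rewrite val_f.
- by move=> u v /andP[ua ut] /andP[va vt]; apply: f_inj => //; exact: leqW.
- by move=> u v /andP[ua ut] /andP[va vt]; exact: adjE.
- move=> u v /andP[ua ut] /andP[va vt] uv; rewrite /=.
  have [w [i [wI iw wu wv]]] := adj_in_block uv ut vt.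
  have [e eH eE] := blockE _ _ wI iw.
  (* A second hyperedge through both [r]-sets would be a second clique containing [u] and [v]. *)
  rewrite (@codegree1 _ _ e) // => [||e' e'H ue' ve']; try by rewrite eE; apply/f_in.
  have [w' [i' [wI' iw' eE']]] := f_edge _ _ ua ut e'H ue'.
  rewrite eE' in ue' ve'; apply: val_inj; rewrite eE' eE.
  have [] := in_block_uniq _ wu wv (proj2 (f_in _ _ _ wI' iw' ua ut) ue') (proj2 (f_in _ _ _
    wI' iw' va vt) ve').
    by move=> uvE; have := adj_irrefl (gw_graph R x) u; rewrite /= {2}uvE uv.
  by move=> -> ->.
- move=> s u A st; rewrite within_gw /= => /andP[ua us] /andP[/eqP uA /exists_inP[e eH /andP[ue
  Ae]]].
  have ut := leq_trans us (ltnW st).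
  have [w [i [wI iw eE]]] := f_edge _ _ ua ut eH ue.
  rewrite eE in ue Ae.
  have Ar : #|val A| = r by exact/eqP/(valP A).
  have [v wv vA] := subset_block r_lt_k Sr tl wI iw Ae Ar.
  have wu := proj2 (f_in _ _ _ wI iw ua ut) ue.
  have va := mem_block_alive wI iw wv.
  (* The word [u] has length less than [t] and shares the block with [v], so [v] is at most one
     longer. *)
  have vt : (size v <= t)%N.
    move: wI; rewrite mem_gw_inner ltnS => /andP[wa wt].
    case: wv => [->//|[j ->]] /=.
    case: wu us => [->|[j' ->]] us; first exact: leq_ltn_trans us st.
    exact: leq_trans us (ltnW st).
  exists v; last by apply: val_inj; rewrite val_f // leqW.
  apply: (in_block_adj ua va _ wu wv) => uv; apply: uA; apply: val_inj.
  by rewrite val_f ?(leqW ut) // uv vA.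
Qed.

End line_graph_ball.

(** * Stability of the exploration under the change of one hyperedge *)

Section local_type.
Context (n k r : nat) (r_lt_k : (r < k)%N).
Local Notation b := ('C(k, r) - 1)%N.
Local Notation vs := {set 'I_n}.
Implicit Types (E : {set vs}) (S A e : vs) (s : seq (gw_word b * nat)).

(* The blocks at the words of length [t - 1] are part of the type but lie beyond
   the ball of radius [t - 1] that the type determines: thus every word of the
   type has a known degree, without which a single hyperedge joining two leaves
   could destroy unboundedly many explorations. *)
Definition has_type (E : {set vs}) (S : vs) (t : nat) (s : seq (gw_word b * nat)) : bool :=
  treelike k r E S t && (gw_code (nblocks E S) t == s).

Lemma eq_fresh (D D' : gw_word b -> {set vs}) S us : {in us, D =1 D'} ->
  fresh D S us = fresh D' S us.
Proof.
move=> DD; rewrite /fresh; congr andb.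
  by apply: eq_in_all => u uus; rewrite DD.
apply: eq_in_all => u uus; apply: eq_in_all => v vus; by rewrite !DD.
Qed.

(** The premise compares the blocks at [u] only under the assumption that both explorations have
    reached [u] in the same way; the induction on words supplies this assumption. *)
Lemma has_type_eq (E E' : {set vs}) S t :
  (forall u : gw_word b, u \in gw_inner (nblocks E S) t ->
     explore E S u = explore E' S u -> blocks E S u = blocks E' S u) ->
  has_type E S t =1 has_type E' S t.
Proof.
move=> EE s; set x := @nblocks n k r E S.
have ex (u : gw_word b) : gw_alive x u -> (size u <= t)%N -> explore E S u = explore E' S u.
  elim: u => //= -[i j] u IH /andP[iu ua] ut.
  have uI : u \in gw_inner x t by rewrite mem_gw_inner ua.
  have eu := IH ua (ltnW ut); have := EE u uI eu.
  by rewrite /blocks eu => ->.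
have bl : {in gw_inner x t, blocks E S =1 blocks E' S}.
  move=> u uI; apply: EE => //; move: uI; rewrite mem_gw_inner => /andP[ua ut].
  exact: ex ua (ltnW ut).
have nb : {in gw_inner x t, x =1 nblocks E' S} by move=> u uI; rewrite /x /nblocks bl.
rewrite /has_type /treelike -(eq_gw_inner nb) (eq_fresh _ bl); congr andb.
by move/gw_codeP: nb => ->.
Qed.

(* The [r]-sets joined to a subset of [e0] by a path of length [j] whose
   intermediate vertices have degree at most [K], traversed from [e0]. *)
Fixpoint reach E K e0 j : {set vs} :=
  if j is j'.+1 then
    \bigcup_(A in [set A in reach E K e0 j' | (#|[set e in E | A \subset e]| <= K)%N])
      \bigcup_(e in [set e in E | A \subset e]) [set B : vs | (B \subset e) && (#|B| == r)]
  else [set A : vs | (A \subset e0) && (#|A| == r)].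

Lemma card_bigcup_leq (I J : finType) (Q : {set I}) (F : I -> {set J}) M :
  (forall i, i \in Q -> (#|F i| <= M)%N) -> (#|(\bigcup_(i in Q) F i)%SET| <= #|Q| * M)%N.
Proof.
move=> FM; apply: (@leq_trans (\sum_(i in Q) #|F i|)).
  elim/big_rec2: _ => [|i y1 y2 _ IH]; first by rewrite cards0.
  by rewrite (leq_trans (leq_card_setU _ _)) // leq_add2l.
by rewrite -sum_nat_const; apply: leq_sum.
Qed.

Lemma card_reach E K e0 j : (forall e, e \in E -> #|e| = k) -> #|e0| = k ->
  (#|reach E K e0 j| <= 'C(k, r) * (K * 'C(k, r)) ^ j)%N.
Proof.
move=> Ek e0k; elim: j => [|j IH] /=.
  by rewrite muln1 cards_draws e0k.
rewrite expnSr mulnA; apply: (@leq_trans (#|reach E K e0 j| * (K * 'C(k, r))));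
  last by rewrite leq_mul2r IH orbT.
apply: leq_trans (card_bigcup_leq (M := (K * 'C(k, r))%N) _) _.
  move=> A; rewrite inE => /andP[_ AK].
  apply: (@leq_trans (#|[set e in E | A \subset e]| * 'C(k, r)));
    last by rewrite leq_mul2r AK orbT.
  by apply: card_bigcup_leq => e; rewrite inE => /andP[eE _]; rewrite cards_draws Ek.
rewrite leq_mul2r; apply/orP; right; apply: subset_leq_card.
by apply/fintype.subsetP => A; rewrite inE => /andP[].
Qed.

Section reached.
Variables (E : {set vs}) (S e0 : vs) (t : nat) (K : nat).
Hypothesis Ek : forall e, e \in E -> #|e| = k.
Hypothesis Sr : #|S| = r.
Hypothesis tl : treelike k r E S t.

Local Notation x := (@nblocks n k r E S).
Local Notation phi u := (walk (@blocks n k r E S) S u).1.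

Hypothesis xK : forall u, u \in gw_inner x t -> (x u < K)%N.

Let xE : {in gw_inner x t, forall u, x u = #|blocks E S u|}. Proof. by []. Qed.

(** A hyperedge through [phi u] is the one of arrival or comes from one of the [x u] blocks; the
    former accounts for the strict inequality in [xK]. *)
Lemma degree_phi u : u \in gw_inner x t -> (#|[set e in E | phi u \subset e]| <= K)%N.
Proof.
move=> uI; apply: leq_trans (xK uI).
apply: (@leq_trans #|(walk (blocks E S) S u).2 |: [set phi u :|: d | d in blocks E S u]|).
  apply: subset_leq_card; apply/fintype.subsetP => e; rewrite !inE => /andP[eE ue].
  have [//|neq] := eqVneq e (walk (blocks E S) S u).2; apply/orP; right; apply/imsetP.
  have UE : phi u :|: (e :\: phi u) = e.
    by rewrite finset.setDE finset.setUIr finset.setUCr finset.setIT; apply/finset.setUidPr.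
  exists (e :\: phi u); last by rewrite UE.
  apply/blocksP; rewrite UE; split => //.
  by rewrite disjoint_sym finset.disjoints_subset finset.setDE finset.setCI finset.setCK
    finset.subsetUr.
by rewrite cardsU1 (leq_add (leq_b1 _)) // leq_imset_card.
Qed.

(** The path from [S] to [phi u] is run backwards; it leaves only [r]-sets at inner words, whose
    degree is bounded. *)
Lemma root_reach u : u \in gw_inner x t -> phi u \subset e0 -> S \in reach E K e0 (size u).
Proof.
move=> uI ue0; have [ua ut] : gw_alive x u /\ (size u < t)%N by apply/andP;
  rewrite -mem_gw_inner.
(* The suffix [v] goes from [u] itself to the empty word, while the prefix [w] counts the steps made
   from [e0]. *)
suff h (w v : gw_word b) : u = w ++ v -> phi v \in reach E K e0 (size w).
  by apply: (h u [::]); rewrite cats0.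
elim/last_ind: w v => [|w [i j] IH] v /= uE.
  by rewrite -uE inE ue0 (card_phi r_lt_k Sr xE tl ua (ltnW ut)) eqxx.
rewrite cat_rcons in uE; rewrite size_rcons /=.
have /andP[iv va] : (i < x v)%N && gw_alive x v by apply: (@gw_alive_cat _ _ w i j);
  rewrite -uE.
have vt : (size ((i, j) :: v) < t)%N.
  by apply: leq_ltn_trans ut; rewrite uE size_cat leq_addl.
have vI : v \in gw_inner x t by rewrite mem_gw_inner va ltnW.
have ijI : (i, j) :: v \in gw_inner x t by rewrite mem_gw_inner /= iv va.
apply/bigcupP; exists (phi ((i, j) :: v)).
  by rewrite inE; apply/andP; split; [exact: IH|exact: degree_phi].
have [sub _ _] := phi_consP r_lt_k Sr xE tl j vI iv.
apply/bigcupP; exists (phi v :|: nth finset.set0 (enum (blocks E S v)) i).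
  by rewrite inE block_edge.
by rewrite inE finset.subsetUl (card_phi r_lt_k Sr xE tl va (ltnW (ltnW vt))) eqxx.
Qed.

End reached.

(** The bounds of [card_reach] summed over the path lengths, with the largest degree that the type
    permits. It depends neither on [n] nor on the hypergraph. *)
Definition type_bound (t : nat) s : nat :=
  (\sum_(j < t) 'C(k, r) * ((\max_(um <- s) um.2.+1) * 'C(k, r)) ^ j)%N.

(** An exploration none of whose [r]-sets is included in [e0] cannot see whether [e0] is a
    hyperedge. *)
Lemma has_type_change E E' S e0 t s : (forall e, e \in E -> #|e| = k) -> #|S| = r ->
  (forall e, e != e0 -> (e \in E) = (e \in E')) ->
  has_type E S t s -> ~~ has_type E' S t s ->
  exists2 j, (j < t)%N & S \in reach E (\max_(um <- s) um.2.+1) e0 j.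
Proof.
move=> Ek Sr EE tE ntE'.
have /existsNP[u /not_implyP[uI nu]] : ~ (forall u : gw_word b,
  u \in gw_inner (nblocks E S) t -> ~ (explore E S u).1 \subset e0).
  move=> h; case/negP: ntE'; rewrite -(@has_type_eq E) // => u uI eu.
  apply/setP => d; rewrite !inE -eu EE //.
  by apply/eqP => de; apply: (h u uI); rewrite -de finset.subsetUl.
move/contrapT: nu; rewrite exploreE => nu.
move: tE => /andP[tl /eqP cE].
exists (size u); first by move: uI; rewrite mem_gw_inner => /andP[].
apply: (root_reach Sr tl _ uI nu) => v vI.
apply: (@leq_bigmax_seq _ s xpredT (fun um => um.2.+1) (v, nblocks E S v)) => //.
by rewrite -cE map_f.
Qed.

End local_type.

Section type_count.
Context (n k r : nat) (r_lt_k : (r < k)%N).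
Local Notation b := ('C(k, r) - 1)%N.

Definition type_count (t : nat) (s : seq (gw_word b * nat)) (H : {set subsets n k}) : nat :=
  #|[set S : subsets n r | has_type (hedges H) (val S) t s]%SET|.

(** The roots that lose the type lie within reach of [e0], through degrees controlled by the type
    they have in [H]. Exchanging [H] and [H'] gives the two-sided estimate. *)
Lemma type_count_leq (H H' : {set subsets n k}) (e0 : subsets n k) t s :
  (forall e, e != e0 -> (e \in H) = (e \in H')) ->
  (type_count t s H <= type_count t s H' + type_bound t s)%N.
Proof.
move=> HH; rewrite /type_count.
have Ek (H1 : {set subsets n k}) e : e \in hedges H1 -> #|e| = k.
  by case/hedgesP => e' _ ->; exact/eqP/(valP e').
set A := [set S : subsets n r | _]%SET; set A' := [set S : subsets n r | _]%SET.
rewrite -(finset.setID A A') cardsU; apply: leq_trans (leq_subr _ _) _; apply: leq_add.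
  by apply: subset_leq_card; exact: finset.subsetIr.
set K := (\max_(um <- s) um.2.+1)%N.
apply: (@leq_trans #|(\bigcup_(j < t) reach r (hedges H) K (val e0) j)%SET|).
  rewrite -(card_imset _ val_inj); apply: subset_leq_card.
  apply/fintype.subsetP => _ /imsetP[S + ->]; rewrite !inE => /andP[ntE' tE].
  have [] := @has_type_change n k r r_lt_k (hedges H) (hedges H') (val S) (val e0) t s _ _ _ tE
    ntE'.
  - exact: Ek.
  - exact/eqP/(valP S).
  - move=> e ee0; apply/hedgesP/hedgesP => -[e' e'H eE]; exists e' => //.
      by rewrite -HH //; apply: contra_neq ee0; rewrite eE => ->.
    by rewrite HH //; apply: contra_neq ee0; rewrite eE => ->.
  - by move=> j jt Sj; apply/bigcupP; exists (Ordinal jt).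
apply: (@leq_trans (\sum_(j < t) #|reach r (hedges H) K (val e0) j|)).
  elim/big_rec2: _ => [|i y1 y2 _ IH]; first by rewrite cards0.
  by rewrite (leq_trans (leq_card_setU _ _)) // leq_add2l.
apply: leq_sum => j _; apply: card_reach; first exact: Ek.
exact/eqP/(valP e0).
Qed.

Lemma type_count_lipschitz (R : realType) t s (H : {set subsets n k}) e :
  `|(type_count t s (e |: H))%:R - (type_count t s H)%:R| <= (type_bound t s)%:R :> R.
Proof.
have h1 := @type_count_leq (e |: H) H e t s; have h2 := @type_count_leq H (e |: H) e t s.
rewrite ler_distl; apply/andP; split.
  rewrite lerBlDr -natrD ler_nat; apply: h2 => e' ee'; by rewrite !inE (negbTE ee').
rewrite -natrD ler_nat; apply: h1 => e' ee'; by rewrite !inE (negbTE ee').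
Qed.

End type_count.

(** * Random subsets with independent members *)

Section bernoulli_set.
Context {R : realType} {E : finType} (p : R).
Hypothesis p01 : 0 <= p <= 1.
Implicit Types (A B F : {set E}) (f g : {set E} -> R) (s : seq E).

Definition set_weight A : R := p ^+ #|A| * (1 - p) ^+ #|~: A|.

(** The expectation of [f] at a random subset of [s], conditioning on one member after the other,
    which suits induction on the coordinates. *)
Fixpoint bexp s f : R :=
  if s is e :: s' then p * bexp s' (fun A => f (e |: A)) + (1 - p) * bexp s' f else f
    finset.set0.

Let p0 : 0 <= p. Proof. by case/andP: p01. Qed.
Let q0 : 0 <= 1 - p. Proof. by case/andP: p01 => _; rewrite subr_ge0. Qed.

Lemma set_weight_ge0 A : 0 <= set_weight A.
Proof. by rewrite mulr_ge0 // exprn_ge0. Qed.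

Lemma eq_bexp s f g : f =1 g -> bexp s f = bexp s g.
Proof. by elim: s f g => [|e s IH] f g fg //=; rewrite (IH _ _ fg) (IH (fun A => f (e |: A))
  (fun A => g (e |: A))). Qed.

Lemma ler_bexp s f g : (forall A, f A <= g A) -> bexp s f <= bexp s g.
Proof.
elim: s f g => [|e s IH] f g fg //=.
by rewrite lerD // ler_wpM2l // IH.
Qed.

Lemma bexpD_cst s f c : bexp s (fun A => f A + c) = bexp s f + c.
Proof. by elim: s f => [|e s IH] f //=; rewrite !IH; lra. Qed.

(** Generalised for the induction: [F] has been decided to be in, [B] to be out, and [s] lists the
    undecided members. The case of empty [F] and [B] is the plain expectation, the case of constant
    [f] the probability of a cylinder. *)
Lemma sum_set_weight_bexp F B s f :
  uniq s -> (forall e, e \in s = (e \notin F) && (e \notin B)) -> F :&: B = finset.set0 ->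
  \sum_(A : {set E} | (F \subset A) && (A \subset ~: B)) set_weight A * f A =
  p ^+ #|F| * (1 - p) ^+ #|B| * bexp s (fun A => f (F :|: A)).
Proof.
elim: s F B f => [|e s IH] F B f.
  move=> _ sE FB.
  have BF : ~: B = F.
    apply/setP => e; rewrite inE; have := sE e; rewrite in_nil.
    have : (e \in F :&: B) = false by rewrite FB inE.
    by rewrite inE; case: (e \in F); case: (e \in B).
  rewrite (big_pred1 F) /= => [|A]; last by rewrite BF andbC -finset.eqEsubset.
  by rewrite finset.setU0 /set_weight -BF finset.setCK.
move=> /= /andP[es us] sE FB.
have /andP[eF eB] : (e \notin F) && (e \notin B) by rewrite -sE mem_head.
rewrite (bigID (fun A : {set E} => e \in A)) /=.
rewrite (eq_bigl (fun A : {set E} => (e |: F \subset A) && (A \subset ~: B))); last first.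
  by move=> A; rewrite finset.subUset finset.sub1set andbC andbA.
rewrite [X in _ + X](eq_bigl (fun A : {set E} => (F \subset A) && (A \subset ~: (e |: B))));
  last first.
  move=> A; rewrite -andbA; congr andb; apply/andP/fintype.subsetP => [[/fintype.subsetP AB eA]
    x xA|h].
    rewrite !inE negb_or; have := AB x xA; rewrite inE => ->; rewrite andbT.
    by apply: contraNneq eA => <-.
  split; first by apply/fintype.subsetP => x /h; rewrite !inE negb_or => /andP[].
  by apply/negP => /h; rewrite !inE eqxx.
rewrite IH //; last 2 first.
- move=> x; have := sE x; rewrite !inE.
  have [->|xe] := eqVneq x e; last by rewrite /= => ->.
  by rewrite (negbTE es).
- apply/setP => x; rewrite !inE; have := congr1 (fun C : {set E} => x \in C) FB; rewrite !inE.
  by have [->|xe] := eqVneq x e; rewrite ?(negbTE eB) ?andbF //=.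
rewrite IH //; last 2 first.
- move=> x; have := sE x; rewrite !inE.
  have [->|xe] := eqVneq x e; last by rewrite /= => ->.
  by rewrite (negbTE es) andbF.
- apply/setP => x; rewrite !inE; have := congr1 (fun C : {set E} => x \in C) FB; rewrite !inE.
  by have [->|xe] := eqVneq x e; rewrite ?(negbTE eF) //=.
rewrite !cardsU1 eF eB /= !add1n !exprS.
rewrite (eq_bexp s (g := fun A => f (F :|: (e |: A)))); last first.
  by move=> A; congr f; rewrite finset.setUCA finset.setUA.
lra.
Qed.

Lemma sum_set_weightE f : \sum_(A : {set E}) set_weight A * f A = bexp (enum E) f.
Proof.
have := @sum_set_weight_bexp finset.set0 finset.set0 (enum E) f (enum_uniq _).
rewrite !cards0 !expr0 !mul1r => h; rewrite (eq_bexp (enum E) (g := fun A => f (finset.set0 :|: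
  A))); last first.
  by move=> A; rewrite finset.set0U.
rewrite -h ?finset.setI0 //; last by move=> e; rewrite mem_enum !inE.
by apply: eq_bigl => A; rewrite finset.sub0set finset.setC0 finset.subsetT.
Qed.

(** From [1 - x <= expR (- x)], it suffices that the product of [1 - x] with the right-hand side,
    namely [1 + x ^+ 2 * (1 - 2 * x)], is at least 1. *)
Lemma expR_le_quad (x : R) : `|x| <= 2^-1 -> expR x <= 1 + x + 2 * x ^+ 2.
Proof.
rewrite ler_norml => /andP[x1 x2].
have h : 1 - x <= expR (- x) by rewrite -[leLHS]/(1 + - x) expR_ge1Dx.
have : 0 < 1 - x by lra.
move=> x0; rewrite -[x in expR x]opprK expRN.
have /le_trans -> // : (expR (- x))^-1 <= (1 - x)^-1 by rewrite lef_pV2 // posrE //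
  (lt_le_trans x0).
rewrite -[leRHS]mulr1 -ler_pdivrMl //; last by nra.
rewrite -invfM invf_le1; last by nra.
nra.
Qed.

(* Induction on the coordinates: the conditional expectations given the first
   coordinate differ by at most [l], and
   [p * expR x + (1 - p) <= expR (p * (x + 2 * x ^+ 2))]. *)
Lemma bexp_expR_le s f (l : R) : 0 <= l <= 2^-1 -> (forall A e, `|f (e |: A) - f A| <= l) ->
  bexp s (fun A => expR (f A)) <= expR (bexp s f + (size s)%:R * (p * 2 * l ^+ 2)).
Proof.
move=> /andP[l0 l1].
elim: s f => [|e s IH] f fl /=; first by rewrite mul0r addr0.
have fl' A e' : `|f (e |: (e' |: A)) - f (e |: A)| <= l.
  by rewrite finset.setUCA; exact: fl.
have := IH _ fl; have := IH (fun A => f (e |: A)) fl'.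
set a := bexp s (fun A => f (e |: A)); set b := bexp s f; set c := (_ * (p * 2 * _)).
move=> h1 h2.
have ab : `|a - b| <= l.
  rewrite ler_distl; apply/andP; split.
    rewrite -[b - l]/(b + - l) -bexpD_cst; apply: ler_bexp => A.
    by have := fl A e; rewrite ler_distl => /andP[].
  rewrite -bexpD_cst; apply: ler_bexp => A.
  by have := fl A e; rewrite ler_distl => /andP[].
apply: (@le_trans _ _ (p * expR (a + c) + (1 - p) * expR (b + c))).
  by rewrite lerD // ler_wpM2l.
pose x := a - b.
have -> : a + c = x + (b + c) by rewrite /x; lra.
rewrite -nat1r [(1 + (size s)%:R) * _]mulrDl mul1r -/c.
have -> : p * a + (1 - p) * b + (p * 2 * l ^+ 2 + c) = (p * (x + 2 * l ^+ 2)) + (b + c) by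
  rewrite /x; lra.
rewrite [expR (x + _)]expRD [expR (_ + (b + c))]expRD.
rewrite [leLHS](_ : _ = (1 + p * (expR x - 1)) * expR (b + c)); last by lra.
rewrite ler_wpM2r ?expR_ge0 //.
apply: le_trans (expR_ge1Dx _).
rewrite lerD2l ler_wpM2l //.
have := @expR_le_quad x (le_trans ab l1).
have : x ^+ 2 <= l ^+ 2 by rewrite -[x ^+ 2]real_normK ?num_real // ler_pXn2r ?nnegrE.
lra.
Qed.

(** Exponential Markov inequality for [- tau * N]. The quadratic term carries the expected number
    [#|E| * p] of members instead of [#|E|]. *)
Lemma sum_set_weight_lower_tail (N : {set E} -> R) (L tau m delta : R) :
  0 <= L -> 0 <= tau -> tau * L <= 2^-1 -> (forall A e, `|N (e |: A) - N A| <= L) ->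
  m <= \sum_(A : {set E}) set_weight A * N A ->
  \sum_(A : {set E} | N A <= m - delta) set_weight A <=
    expR (#|E|%:R * (p * 2 * (tau * L) ^+ 2) - tau * delta).
Proof.
move=> L0 t0 tL NL mN.
apply: (@le_trans _ _ (\sum_(A : {set E}) set_weight A * expR (- tau * N A + tau * (m -
  delta)))).
  rewrite [leRHS](bigID (fun A => N A <= m - delta)) /= -[leLHS]addr0 lerD //; last first.
    by apply: sumr_ge0 => A _; rewrite mulr_ge0 ?expR_ge0 // set_weight_ge0.
  apply: ler_sum => A NA; rewrite -[leLHS]mulr1 ler_wpM2l ?set_weight_ge0 //.
  by rewrite -[X in X <= _]expR0 ler_expR mulNr addrC -mulrBr mulr_ge0 // subr_ge0.
rewrite sum_set_weightE.
apply: (le_trans (@bexp_expR_le _ _ (tau * L) _ _)).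
- by rewrite mulr_ge0.
- move=> A e; rewrite [X in `|X|](_ : _ = - tau * (N (e |: A) - N A)); last by lra.
  by rewrite normrM normrN (ger0_norm t0) ler_wpM2l.
rewrite ler_expR bexpD_cst -cardE.
have -> : bexp (enum E) (fun A => - tau * N A) = - tau * \sum_(A : {set E}) set_weight A * N A.
  rewrite -sum_set_weightE mulr_sumr; apply: eq_bigr => A _; lra.
nra.
Qed.

End bernoulli_set.

Section random_set.
Context {d : measure_display} {T : measurableType d} {R : realType} (P : probability T R).
Context {E : finType} (p : R) (X : T -> {set E}).
Hypothesis Xm : forall e, measurable [set w | e \in X w].
Hypothesis Xp : forall e, P [set w | e \in X w] = p%:E.
Hypothesis Xi : independent_events P (fun e => [set w | e \in X w]).

Let incl (fs bs : seq E) := [set w | all (fun e => e \in X w) fs && all (fun e => e \notin X w)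
  bs].

Lemma measurable_random_set (Q : pred {set E}) : measurable [set w | Q (X w)].
Proof.
have mA A : measurable [set w | X w = A].
  have -> : [set w | X w = A] =
      \bigcap_(e in [set: E]) (if e \in A then [set w | e \in X w] else ~` [set w | e \in X w]).
    apply/seteqP; split => w /=.
      by move=> <- e _; case: ifPn => //= /negP.
    move=> h; apply/setP => e; have := h e I; case: ifPn => //= eA /negP/negbTE ->;
      by rewrite ?(negbTE eA).
  apply: fin_bigcap_measurable; first exact: finite_finset.
  by move=> e _; case: ifP => // _; exact: measurableC.
have -> : [set w | Q (X w)] = \bigcup_(A in [set A | Q A]) [set w | X w = A].
  apply/seteqP; split => w /=; first by move=> Qw; exists (X w).
  by move=> [A QA /= ->].
apply: fin_bigcup_measurable; last by move=> A _; exact: mA.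
exact: finite_finset.
Qed.

(** Independence is assumed for inclusions only; each exclusion is introduced by subtracting the
    event where the element is included. *)
Lemma random_set_incl (fs bs : seq E) : uniq (fs ++ bs) ->
  P [set w | all (fun e => e \in X w) fs && all (fun e => e \notin X w) bs] =
  (p ^+ size fs * (1 - p) ^+ size bs)%:E.
Proof.
elim: bs fs => [|b bs IH] fs.
  rewrite cats0 => ufs; rewrite mulr1.
  have -> : [set w | all (fun e => e \in X w) fs && all (fun e => e \notin X w) [::]] =
     \bigcap_(e in [set` fs]) [set w | e \in X w].
    apply/seteqP; split => w /=; rewrite andbT; first by move=> /allP h e /= /h.
    by move=> h; apply/allP => e; exact: h.
  rewrite Xi //; congr (_%:E); under eq_bigr do rewrite Xp /=.
  by rewrite big_const_seq iter_mulr_1 count_predT.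
move=> ufb; have ufb' : uniq (fs ++ bs).
  by move: ufb; rewrite !cat_uniq /= negb_or => /and3P[-> /andP[_ ->] /andP[_ ->]].
have ubf : uniq ((b :: fs) ++ bs).
  by rewrite -[b :: fs]cat1s -catA uniq_catCA.
have mI fs' bs' : measurable (incl fs' bs').
  exact: (measurable_random_set (fun A : {set E} => all (fun e => e \in A) fs' && all (fun e =>
    e \notin A) bs')).
have -> : [set w | all (fun e => e \in X w) fs && all (fun e => e \notin X w) (b :: bs)] =
   incl fs bs `\` incl (b :: fs) bs.
  apply/seteqP; split => w; rewrite /incl /=.
    by move=> /andP[-> /andP[/negbTE -> ->]].
  by move=> [/andP[-> ->]] /=; rewrite !andbT => /negP ->.
rewrite measureD //; last first.
  by rewrite -ge0_fin_numE ?measure_ge0 // fin_num_measure.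
have -> : incl fs bs `&` incl (b :: fs) bs = incl (b :: fs) bs.
  apply/setIidPr => w; rewrite /incl /= => /andP[/andP[_ ->] ->] //.
change (P (incl fs bs) - P (incl (b :: fs) bs) = (p ^+ size fs * (1 - p) ^+ size (b ::
  bs))%:E)%E.
rewrite /incl.
have -> := IH _ ufb'; have -> := IH _ ubf; rewrite -EFinB /= exprS; congr (_%:E).
rewrite [in RHS]exprS; lra.
Qed.

Lemma random_setE (A : {set E}) : P [set w | X w = A] = (set_weight p A)%:E.
Proof.
have -> : [set w | X w = A] = [set w | all (fun e => e \in X w) (enum A) && all (fun e => e
  \notin X w) (enum (~: A))].
  apply/seteqP; split => w /=.
    move=> ->; apply/andP; split; apply/allP => e; rewrite mem_enum //.
    by rewrite inE.
  move=> /andP[/allP h1 /allP h2]; apply/setP => e; apply/idP/idP => [eX|eA].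
    by have := h2 e; rewrite mem_enum inE eX => /contraTT; apply.
  by apply: h1; rewrite mem_enum.
rewrite random_set_incl; first by rewrite -!cardE.
rewrite cat_uniq !enum_uniq /= andbT; apply/hasPn => e.
by rewrite !mem_enum inE.
Qed.

Lemma random_set_pred (Q : pred {set E}) :
  P [set w | Q (X w)] = (\sum_(A : {set E} | Q A) set_weight p A)%:E.
Proof.
have seqE (s : seq {set E}) : uniq s -> P [set w | X w \in s] = (\sum_(A <- s) set_weight p
  A)%:E.
  elim: s => [|A s IH] /=; first by rewrite big_nil (_ : [set w | _] = set0) ?measure0 //;
    apply/seteqP; split.
  move=> /andP[As us]; rewrite big_cons EFinD -random_setE -IH // -measureU.
  - congr (P _); apply/seteqP; split => w /=; rewrite inE.
      by move=> /orP[/eqP|]; [left|right].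
    by move=> [->|->]; rewrite ?eqxx ?orbT.
  - rewrite (_ : [set w | X w = A] = [set w | pred1 A (X w)]);
    first exact: measurable_random_set.
    by apply/seteqP; split => w /= /eqP.
  - exact: (measurable_random_set (mem s)).
  - by apply/seteqP; split => // w [/= ->]; rewrite (negbTE As).
rewrite -big_filter -seqE ?filter_uniq ?index_enum_uniq //.
congr (P _); apply/seteqP; split => w /=; rewrite mem_filter mem_index_enum andbT //.
Qed.

End random_set.

(** * Counting explorations *)

Section families.
Context (n j : nat) (j_gt0 : (0 < j)%N).
Local Notation vs := {set 'I_n}.
Implicit Types (W d : vs) (X : {set vs}).

(* Choosing the blocks at a word as a set, rather than as a sequence, is what
   yields the factor [1 / m`!] of the Poisson law. *)
Definition block_sets m W : {set {set vs}} :=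
  [set X : {set vs} | [&& #|X| == m,
    [forall d in X, (#|d| == j) && [disjoint d & W]] &
    [forall d in X, [forall d' in X, (d == d') || [disjoint d & d']]]]]%SET.

Lemma block_setsP m W X : reflect
  [/\ #|X| = m, forall d, d \in X -> #|d| = j /\ [disjoint d & W]%B &
     forall d d', d \in X -> d' \in X -> d != d' -> [disjoint d & d']%B]
  (X \in block_sets m W).
Proof.
rewrite inE; apply: (iffP and3P) => [[/eqP Xm /forall_inP X1 /forall_inP X2]|[Xm X1 X2]];
  split => //.
- by move=> d /X1/andP[/eqP].
- by move=> d d' /X2/forall_inP/[apply] /orP[->|].
- exact/eqP.
- by apply/forall_inP => d /X1[-> ->]; rewrite eqxx.
- apply/forall_inP => d dX; apply/forall_inP => d' dX'.
  by have [//|dd'] := eqVneq d d'; exact: X2.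
Qed.

Lemma card_cover_block_sets m W X : X \in block_sets m W -> (#|finset.cover X| <= m * j)%N.
Proof.
move=> /block_setsP[Xm X1 _]; rewrite /finset.cover -Xm; apply: card_bigcup_leq => d /X1[-> //].
Qed.

(** Double counting: adding a new block [d] to [X] maps the pairs [(X, d)] injectively to sets of
    [m.+1] blocks with a marked member. At most [w] vertices are excluded when [d] is chosen. *)
Lemma block_sets_succ m W w : (#|W| + m.+1 * j <= w)%N ->
  (#|block_sets m W| * 'C(n - w, j) <= #|block_sets m.+1 W| * m.+1)%N.
Proof.
move=> Ww.
pose new X : {set vs} := [set d : vs | (d \subset ~: (W :|: finset.cover X)) && (#|d|
  == j)]%SET.
have newP X d : d \in new X -> [/\ #|d| = j, [disjoint d & W]%B & [disjoint d & finset.cover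
  X]%B].
  rewrite inE => /andP[/fintype.subsetP dW /eqP dj]; split=> //; apply/pred0P => z /=;
    apply/negP => /andP[zd zW]; have := dW z zd; by rewrite !inE zW ?orbT.
pose P1 := [set Xd : {set vs} * vs | (Xd.1 \in block_sets m W) && (Xd.2 \in new Xd.1)]%SET.
pose P2 := [set Xd : {set vs} * vs | (Xd.1 \in block_sets m.+1 W) && (Xd.2 \in Xd.1)]%SET.
have P1P X d : ((X, d) \in P1) = (X \in block_sets m W) && (d \in new X) by rewrite inE.
have P2P X d : ((X, d) \in P2) = (X \in block_sets m.+1 W) && (d \in X) by rewrite inE.
have cP2 : #|P2| = (#|block_sets m.+1 W| * m.+1)%N.
  rewrite -sum1_card (eq_bigl (fun Xd : {set vs} * vs => (Xd.1 \in block_sets m.+1 W) && (Xd.2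
    \in Xd.1))); last by move=> Xd; rewrite inE.
  rewrite -(pair_big_dep (fun X => X \in block_sets m.+1 W) (fun X d => d \in X) (fun _ _ =>
    1%N)) /=.
  rewrite -sum_nat_const; apply: eq_bigr => X /block_setsP[Xm _ _]; by rewrite sum1_card Xm.
have cP1 : (#|block_sets m W| * 'C(n - w, j) <= #|P1|)%N.
  rewrite -[#|P1|]sum1_card (eq_bigl (fun Xd : {set vs} * vs => (Xd.1 \in block_sets m W) &&
    (Xd.2 \in new Xd.1))); last by move=> Xd; rewrite inE.
  rewrite -(pair_big_dep (fun X => X \in block_sets m W) (fun X d => d \in new X) (fun _ _ =>
    1%N)) /=.
  rewrite -sum_nat_const; apply: leq_sum => X XW; rewrite sum1_card cards_draws.
  apply: leq_bin2l; have := finset.cardsC (W :|: finset.cover X); rewrite card_ord.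
  have [+ _] := leq_card_setU W (finset.cover X); have := card_cover_block_sets XW.
  have : (m * j <= m.+1 * j)%N by rewrite leq_mul2r leqnSn orbT.
  lia.
rewrite -cP2; apply: leq_trans cP1 _.
pose h (Xd : {set vs} * vs) := (Xd.2 |: Xd.1, Xd.2).
have nin X d : d \in new X -> d \notin X.
  move=> /newP[dj _ dc]; apply/negP => dX.
  have /card_gt0P[z zd] : (0 < #|d|)%N by rewrite dj.
  have /pred0P/(_ z) := dc; rewrite /= zd /=.
  move=> /negbT/negP; apply; apply/finset.bigcupP; exists d => //.
rewrite -(card_in_imset (f := h) (D := mem P1)); last first.
  move=> [X d] [Y e]; rewrite !P1P => /andP[_ dX] /andP[_ eY] [] + de.
  rewrite -de in eY *; move=> XY; congr pair.
  by rewrite -(setU1K (nin _ _ dX)) XY setU1K // nin.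
apply: subset_leq_card; apply/fintype.subsetP => _ /imsetP[[X d] + ->].
rewrite P1P P2P => /andP[/block_setsP[Xm X1 X2] dX]; rewrite finset.setU11 andbT.
have [dj dW dc] := newP _ _ dX.
have dX' d' : d' \in X -> [disjoint d & d']%B.
  move=> d'X; apply: disjointWr dc; exact: finset.bigcup_sup.
apply/block_setsP; split.
- by rewrite cardsU1 nin // Xm.
- by move=> d' /setU1P[->//|/X1].
- move=> d1 d2 /setU1P[->|d1X] /setU1P[->|d2X]; rewrite ?eqxx // => ne.
  + exact: dX'.
  + by rewrite disjoint_sym dX'.
  + exact: X2.
Qed.

Lemma card_block_sets m W w : (#|W| + m * j <= w)%N ->
  ('C(n - w, j) ^ m <= #|block_sets m W| * m`!)%N.
Proof.
elim: m => [|m IH] Ww.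
  rewrite expn0 fact0 muln1 card_gt0; apply/set0Pn; exists finset.set0.
  by apply/block_setsP; split => [|d|d d']; rewrite ?cards0 // inE.
have Ww' : (#|W| + m * j <= w)%N by apply: leq_trans Ww;
  rewrite leq_add2l leq_mul2r leqnSn orbT.
rewrite expnSr factS mulnA; apply: leq_trans (leq_mul (IH Ww') (leqnn _)) _.
by rewrite mulnAC leq_mul2r block_sets_succ ?orbT.
Qed.

(** One set of blocks per word, [ms] being the offspring numbers; the forbidden vertices grow with
    each choice, which makes the whole family fresh. *)
Fixpoint families (ms : seq nat) W : seq (seq {set vs}) :=
  if ms is m :: ms' then
    [seq X :: l | X <- enum (block_sets m W), l <- families ms' (W :|: finset.cover X)]
  else [:: [::]].

Lemma families_uniq ms W : uniq (families ms W).
Proof.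
elim: ms W => //= m ms IH W; apply: allpairs_uniq_dep; first exact: enum_uniq.
  by move=> X _; exact: IH.
by move=> [X l] [Y l'] /= _ _ [-> ->].
Qed.

Lemma size_families ms W w : (#|W| + sumn ms * j <= w)%N ->
  ('C(n - w, j) ^ sumn ms <= size (families ms W) * \prod_(m <- ms) m`!)%N.
Proof.
elim: ms W => [|m ms IH] W /= Ww; first by rewrite big_nil.
have Wm : (#|W| + m * j <= w)%N by apply: leq_trans Ww; rewrite leq_add2l mulnDl leq_addr.
rewrite expnD big_cons size_allpairs_dep.
rewrite [sumn [seq size _ | _ <- _]]sumnE big_map big_enum /=.
apply: leq_trans (leq_mul (card_block_sets Wm) (leqnn _)) _.
rewrite [leqRHS]mulnCA mulnAC [leqLHS]mulnC leq_mul2l -sum_nat_const; apply/orP; right.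
rewrite big_distrl; apply: leq_sum => X XW.
apply: IH; apply: leq_trans Ww; rewrite mulnDl addnA leq_add2r.
apply: leq_trans (leq_card_setU _ _) _; rewrite leq_add2l; exact: card_cover_block_sets XW.
Qed.

Lemma familiesP ms W l : l \in families ms W -> size l = size ms /\
  (forall i, (i < size ms)%N -> nth finset.set0 l i \in block_sets (nth 0%N ms i) W) /\
  (forall i i' d d', (i < i')%N -> (i' < size ms)%N -> d \in nth finset.set0 l i ->
     d' \in nth finset.set0 l i' -> [disjoint d & d']%B).
Proof.
elim: ms W l => [|m ms IH] W l /=; first by rewrite inE => /eqP ->; split=> //; split.
case/allpairsPdep => X [l' [XW l'W ->]]; rewrite mem_enum in XW.
have [sl' [l1 l2]] := IH _ _ l'W; rewrite /= sl'; split=> //.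
have wk i : (i < size ms)%N -> nth finset.set0 l' i \in block_sets (nth 0%N ms i) W.
  move=> /l1/block_setsP[h1 h2 h3]; apply/block_setsP; split=> //.
  move=> d /h2[-> dW]; split=> //; apply: disjointWr dW; exact: finset.subsetUl.
split; first by case=> [//|i]; rewrite ltnS => /wk.
move=> [|i] [|i'] d d' //=; rewrite !ltnS; last exact: l2.
move=> _ /l1/block_setsP[_ h2 _] dX /h2[_ d'W]; rewrite disjoint_sym.
apply: disjointWr d'W; apply: fintype.subset_trans (finset.subsetUr _ _);
  exact: finset.bigcup_sup.
Qed.

End families.

(** * Hypergraphs that realise prescribed blocks *)

Section explore_match.
Context (n k r : nat) (r_lt_k : (r < k)%N).
Local Notation b := ('C(k, r) - 1)%N.
Local Notation vs := {set 'I_n}.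
Variables (D : gw_word b -> {set vs}) (S : vs) (x : gw_word b -> nat) (t : nat) (E : {set vs}).
Hypothesis Sr : #|S| = r.
Hypothesis xE : {in gw_inner x t, forall u, x u = #|D u|}.
Hypothesis Df : fresh D S (gw_inner x t).

Local Notation phi u := (walk D S u).1.
Local Notation blk u i := (nth finset.set0 (enum (D u)) i).

Hypothesis DE : forall u d, u \in gw_inner x t -> d \in D u -> phi u :|: d \in E.
Hypothesis ED : forall u e, u \in gw_inner x t -> e \in E -> phi u \subset e ->
  exists v d, [/\ v \in gw_inner x t, d \in D v & e = phi v :|: d].

Lemma mem_blkP u d : u \in gw_inner x t -> d \in D u -> exists2 i, (i < x u)%N & d = blk u i.
Proof.
move=> uI dD; exists (index d (enum (D u))); first by rewrite xE // cardE index_mem mem_enum.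
by rewrite nth_index // mem_enum.
Qed.

(** A hyperedge through [phi u] belongs to a block at some [v] by [ED], and [phi_sub_edge] leaves
    only [v = u] or the hyperedge of arrival. Conversely a prescribed block at [u] is not part of
    the hyperedge of arrival, because its vertices are fresh. *)
Lemma new_blocks_walk u : u \in gw_inner x t -> new_blocks E (walk D S u) = D u.
Proof.
move=> uI; have [ua ut] : gw_alive x u /\ (size u < t)%N by apply/andP; rewrite -mem_gw_inner.
apply/setP => d; rewrite inE; apply/and3P/idP => [[d_phi dE dne]|dD].
  have [v [d' [vI dD' eE]]] := ED uI dE (finset.subsetUl _ _).
  have [i iv d'E] := mem_blkP vI dD'.
  have sub : phi u \subset phi v :|: blk v i by rewrite -d'E -eE finset.subsetUl.
  have [uv|[j uE]] := phi_sub_edge r_lt_k Sr xE Df ua (ltnW ut) vI iv sub; last first.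
    by move: dne; rewrite {2}uE /= eE d'E eqxx.
  suff -> : d = d' by rewrite uv.
  rewrite -uv in eE.
  apply/setP => z; have := congr1 (fun A : vs => z \in A) eE; rewrite !inE.
  have d'_phi : z \in phi u -> z \in d' = false.
    move=> zu; apply/negP; rewrite d'E -uv => zd.
    rewrite -uv in iv; exact: (phi_disjoint_blk xE Df uI iv zu zd).
  have := pred0P d_phi z; rewrite /=.
  by case: (boolP (z \in phi u)) d'_phi => [_ -> //|_ _]; rewrite ?andbT //= => _ ->.
have [i iu dE] := mem_blkP uI dD.
split.
- apply/pred0P => z /=; apply/negP => /andP[zd zu].
  by apply: (phi_disjoint_blk xE Df uI iu zu); rewrite -dE.
- exact: DE.
- have /card_gt0P[z zd] : (0 < #|d|)%N.
    by rewrite dE (card_blk xE Df uI iu) subn_gt0.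
  apply/eqP => eE; have : z \in (walk D S u).2 by rewrite -eE inE zd orbT.
  rewrite dE in zd; clear dE eE dD.
  move: ua ut uI iu zd; case: (u) => [|[i' j'] v]; first by rewrite inE.
  move=> ua ut uI iu zd; move: (ua) => /= /andP[iv va].
  have vI : v \in gw_inner x t by rewrite mem_gw_inner va ltnW.
  rewrite /= inE => /orP[zv|zb].
    have [zS|[w [i1 [j1 [v1 [vE v1I i1v z1]]]]]] := phi_support va (ltnW (ltnW ut)) zv.
      exact: (disjoint_blk_root xE Df uI iu zd zS).
    have [uE _] := blk_inj xE Df uI iu v1I i1v zd z1.
    by have := congr1 size uE; rewrite vE /= size_cat /=; clear; lia.
  have [uE _] := blk_inj xE Df uI iu vI iv zd zb.
  by have := congr1 size uE => /=; clear; lia.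
Qed.

Lemma explore_walk u : gw_alive x u -> (size u <= t)%N -> explore E S u = walk D S u.
Proof.
elim: u => //= -[i j] u IH /andP[iu ua] ut.
have uI : u \in gw_inner x t by rewrite mem_gw_inner ua.
by rewrite IH ?(ltnW ut) // new_blocks_walk.
Qed.

Lemma blocks_walk : {in gw_inner x t, blocks E S =1 D}.
Proof.
move=> u uI; rewrite /blocks explore_walk ?new_blocks_walk //.
  by move: uI; rewrite mem_gw_inner => /andP[].
by move: uI; rewrite mem_gw_inner => /andP[_ /ltnW].
Qed.

Lemma has_type_walk : has_type E S t (gw_code x t).
Proof.
have xb : {in gw_inner x t, x =1 @nblocks n k r E S}.
  by move=> u uI; rewrite /nblocks blocks_walk // xE.
rewrite /has_type /treelike -(eq_gw_inner xb) (eq_fresh _ blocks_walk) Df /=.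
by apply/eqP/esym/gw_codeP.
Qed.

End explore_match.

Section set_weight_incl.
Context {R : realType} {E : finType} (p : R).

Lemma bexp1 (s : seq E) : bexp p s (fun=> 1) = 1.
Proof. by elim: s => //= e s ->; lra. Qed.

Lemma sum_set_weight_incl (F B : {set E}) : F :&: B = finset.set0 ->
  \sum_(A : {set E} | (F \subset A) && (A \subset ~: B)) set_weight p A = p ^+ #|F|
    * (1 - p) ^+ #|B|.
Proof.
move=> FB; have := @sum_set_weight_bexp R E p F B (enum [pred e |
  (e \notin F) && (e \notin B)]) (fun=> 1) (enum_uniq _).
rewrite bexp1 mulr1 => <- //; first by apply: eq_bigr => A _; rewrite mulr1.
by move=> e; rewrite mem_enum.
Qed.

End set_weight_incl.

Section type_prob.
Context {R : realType} (n k r : nat) (r_lt_k : (r < k)%N) (p : R) (p01 : 0 <= p <= 1).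
Local Notation b := ('C(k, r) - 1)%N.
Local Notation vs := {set 'I_n}.
Variables (S : subsets n r) (x : gw_word b -> nat) (t : nat).

Let us := gw_inner x t.
Let ms := [seq x u | u <- us].
Let Sr : #|val S| = r. Proof. exact/eqP/(valP S). Qed.
Let fams := families (k - r) ms (val S).

Let Dl (l : seq {set vs}) (u : gw_word b) : {set vs} := nth finset.set0 l (index u us).

Let index_us u : u \in us -> (index u us < size ms)%N.
Proof. by rewrite size_map index_mem. Qed.

Let ms_index u : u \in us -> nth 0%N ms (index u us) = x u.
Proof. by move=> uI; rewrite (nth_map [::]) ?index_mem // nth_index. Qed.

Let Dl_card l : l \in fams -> {in us, forall u, x u = #|Dl l u|}.
Proof.
move=> /familiesP[_ [h _]] u uI; have /block_setsP[h1 _ _] := h _ (index_us uI).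
by rewrite -(ms_index uI) -h1.
Qed.

Let Dl_fresh l : l \in fams -> fresh (Dl l) (val S) us.
Proof.
move=> /familiesP[_ [h h']]; apply/andP; split; apply/allP => u uI.
  apply/forall_inP => d dD; have /block_setsP[_ h1 _] := h _ (index_us uI).
  by have [-> ->] := h1 _ dD; rewrite eqxx.
apply/allP => v vI; apply/forall_inP => d dD; apply/forall_inP => d' dD'.
have [uv|uv] := eqVneq u v.
  have [//|dd'] := eqVneq d d'; have /block_setsP[_ _ h2] := h _ (index_us uI).
  by apply: h2 => //; rewrite uv.
have iuv : index u us != index v us.
  by apply: contra_neq uv => iuv; rewrite -(nth_index [::] uI) iuv nth_index.
case: (ltngtP (index u us) (index v us)) iuv => // iuv _ /=.
  exact: h' iuv (index_us vI) dD dD'.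
by rewrite disjoint_sym; exact: h' iuv (index_us uI) dD' dD.
Qed.

Let phil l u := (walk (Dl l) (val S) u).1.

Let edges_in (l : seq {set vs}) : {set subsets n k} :=
  [set e : subsets n k | has (fun u => [exists d in Dl l u, val e == phil l u :|: d]) us]%SET.

(** The hyperedges that would give an explored [r]-set a block other than the prescribed ones. *)
Let edges_out (l : seq {set vs}) : {set subsets n k} :=
  [set e : subsets n k | (e \notin edges_in l) && has (fun u => phil l u \subset val e) us]%SET.

Let event (l : seq {set vs}) (H : {set subsets n k}) : bool :=
  (edges_in l \subset H) && (H \subset ~: edges_out l).

Let event_match l (H : {set subsets n k}) : l \in fams -> event l H ->
  has_type (hedges H) (val S) t (gw_code x t) /\ {in us, blocks (hedges H) (val S) =1 Dl l}.
Proof.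
move=> lf /andP[/fintype.subsetP inH /fintype.subsetP outH].
have xE := Dl_card lf; have Df := Dl_fresh lf.
have DE (u : gw_word b) d : u \in us -> d \in Dl l u -> phil l u :|: d \in hedges H.
  move=> uI dD; have [i iu dE] := mem_blkP xE uI dD.
  have ek : #|phil l u :|: d| == k by rewrite dE (card_edge r_lt_k Sr xE Df uI iu).
  apply/hedgesP; exists (exist _ (phil l u :|: d) ek) => //.
  apply: inH; rewrite inE; apply/hasP; exists u => //; apply/exists_inP; exists d => //.
have ED (u : gw_word b) (e : vs) : u \in us -> e \in hedges H -> phil l u \subset e ->
    exists v d, [/\ v \in us, d \in Dl l v & e = phil l v :|: d].
  move=> uI /hedgesP[e' e'H eE] ue; have := outH _ e'H; rewrite !inE negb_and negbK => /orP[|].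
    case/hasP => v vI /exists_inP[d dD /eqP e'E]; exists v, d; split=> //; by rewrite eE.
  by move/hasP; case; exists u => //; rewrite -eE.
split; first exact: (has_type_walk r_lt_k Sr xE Df DE ED).
exact: (blocks_walk r_lt_k Sr xE Df DE ED).
Qed.

Let sum_event (H : {set subsets n k}) :
  (\sum_(l <- fams) event l H <= has_type (hedges H) (val S) t (gw_code x t))%N.
Proof.
have [tH|ntH] := boolP (has_type (hedges H) (val S) t (gw_code x t)); last first.
  rewrite leqn0 big_seq; apply/eqP; apply: big1 => l lf; apply/eqP; rewrite eqb0.
  by apply: contra ntH => /(event_match lf)[].
pose l0 := [seq blocks (hedges H) (val S) u | u <- us].
apply: (@leq_trans (count (pred1 l0) fams)); last first.
  by rewrite count_uniq_mem ?families_uniq //; case: (_ \in _).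
rewrite -sum1_count [leqRHS]big_mkcond /= big_seq [leqRHS]big_seq; apply: leq_sum => l lf.
case: (boolP (event l H)) => // /(event_match lf)[_ bl].
rewrite (_ : l == l0) //; apply/eqP.
have [sl _] := familiesP lf.
apply: (@eq_from_nth _ finset.set0); first by rewrite sl !size_map.
move=> i; rewrite sl size_map => il; rewrite (nth_map [::]) // bl ?mem_nth //.
by rewrite /Dl index_uniq // undup_uniq.
Qed.

Let card_edges_in l : l \in fams -> (#|edges_in l| <= sumn ms)%N.
Proof.
move=> lf; rewrite -(card_imset _ val_inj).
pose es := flatten [seq [seq phil l u :|: d | d <- enum (Dl l u)] | u <- us].
apply: (@leq_trans (size es)).
  apply: leq_trans (card_size es); apply: subset_leq_card;
    apply/fintype.subsetP => _ /imsetP[e + ->].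
  rewrite inE => /hasP[u uI /exists_inP[d dD /eqP ->]].
  by apply/flatten_mapP; exists u => //; apply: map_f; rewrite mem_enum.
rewrite size_flatten /shape -map_comp; apply/eq_leq; congr sumn; apply/eq_in_map => u uI /=.
by rewrite size_map -cardE -(Dl_card lf uI).
Qed.

Let card_edges_out l : l \in fams -> (#|edges_out l| <= size us * 'C(n - r, k - r))%N.
Proof.
move=> lf; have xE := Dl_card lf; have Df := Dl_fresh lf.
have cu u : u \in us -> (#|[set e : subsets n k | phil l u \subset val e]%SET| <= 'C(n - r,
  k - r))%N.
  rewrite mem_gw_inner => /andP[ua ut].
  have ur : #|phil l u| = r := card_phi r_lt_k Sr xE Df ua (ltnW ut).
  have cC : #|~: phil l u| = (n - r)%N by have := finset.cardsC (phil l u); rewrite card_ord;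
    lia.
  rewrite -cC -cards_draws -(card_in_imset (f := fun e : subsets n k => val e :\: phil l u)).
    apply: subset_leq_card; apply/fintype.subsetP => _ /imsetP[e + ->]; rewrite !inE => ue.
    rewrite finset.setDE finset.subsetIr /= -finset.setDE cardsD (finset.setIidPr ue) ur.
    by rewrite (eqP (valP e)).
  move=> e e'; rewrite !inE => ue ue' ee'; apply: val_inj.
  by rewrite -(finset.setID (val e) (phil l u)) ee' (finset.setIidPr ue) -[RHS](finset.setID _
    (phil l u)) (finset.setIidPr ue').
apply: (@leq_trans (\sum_(u <- us) #|[set e : subsets n k | phil l u \subset val e]%SET|)).
  apply: (@leq_trans #|[set e : subsets n k | has (fun u => phil l u \subset val e) us]%SET|).
    by apply: subset_leq_card; apply/fintype.subsetP => e; rewrite !inE => /andP[].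
  elim: us => [|u s IH]; first by rewrite big_nil leqn0 cards_eq0; apply/eqP/setP => e;
    rewrite !inE.
  rewrite big_cons (_ : [set e : subsets n k | _]%SET =
    [set e : subsets n k | phil l u \subset val e]%SET :|: [set e : subsets n k |
      has (fun u => phil l u \subset val e) s]%SET).
    by apply: leq_trans (leq_card_setU _ _) _; rewrite leq_add2l.
  by apply/setP => e; rewrite !inE.
rewrite big_seq; apply: (@leq_trans (\sum_(u <- us | u \in us) 'C(n - r, k - r)));
  first by apply: leq_sum => u /cu.
by rewrite -big_seq big_const_seq count_predT iter_addn_0 mulnC.
Qed.

(* The events indexed by the families of fresh blocks are disjoint because
   [H] determines its blocks; each of them forbids at most
   [size us * 'C(n - r, k - r)] hyperedges, by a union bound. *)
Lemma type_prob_ge :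
  \prod_(u <- us) (('C(n - (r + sumn ms * (k - r)), k - r)%:R * p) ^+ x u / (x u)`!%:R) *
    (1 - p) ^+ (size us * 'C(n - r, k - r)) <=
  \sum_(H : {set subsets n k} | has_type (hedges H) (val S) t (gw_code x t)) set_weight p H.
Proof.
have /andP[p0 p1] := p01; have q01 : 0 <= 1 - p <= 1 by rewrite subr_ge0 p1 /= gerBl.
have k_r : (0 < k - r)%N by rewrite subn_gt0.
set B := sumn ms; set M := 'C(n - (r + B * _), _).
apply: (@le_trans _ _ (\sum_(l <- fams) p ^+ B * (1 - p) ^+ (size us * 'C(n - r, k - r))));
  last first.
  apply: (@le_trans _ _ (\sum_(l <- fams) \sum_(H : {set subsets n k} |
    event l H) set_weight p H)).
    rewrite !big_seq; apply: ler_sum => l lf.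
    (* Since [p] and [1 - p] are at most 1, upper bounds on the numbers of prescribed and forbidden
       hyperedges give a lower bound of the probability. *)
    rewrite (sum_set_weight_incl p); last first.
      by apply/setP => e; rewrite !inE; case: (has _ _); rewrite ?andbF.
    rewrite ler_pM ?exprn_ge0 //; try by case/andP: q01.
      by apply: ler_wiXn2l => //; exact: card_edges_in.
    by case/andP: q01 => q0 q1; apply: ler_wiXn2l => //; exact: card_edges_out.
  under eq_bigr do rewrite big_mkcond.
  rewrite exchange_big /= [leRHS]big_mkcond; apply: ler_sum => H _.
  rewrite (_ : \sum_(l <- fams) _ = (\sum_(l <- fams) event l H)%N%:R * set_weight p H);
    last first.
    rewrite natr_sum mulr_suml; apply: eq_bigr => l _; by case: (event l H);
      rewrite ?mul1r ?mul0r.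
  have := sum_event H; case: ifP => _; last by rewrite leqn0 => /eqP ->; rewrite mul0r.
  by move=> h; rewrite ler_piMl ?set_weight_ge0 // lern1.
(* All families have the same lower bound, so what remains is their number, given by
   [size_families]. *)
rewrite big_const_seq count_predT iter_addr_0 -[leRHS]mulr_natl mulrA ler_wpM2r ?exprn_ge0 //;
  first by case/andP: q01.
have -> : \prod_(u <- us) ((M%:R * p) ^+ x u / (x u)`!%:R) = M%:R ^+ B * p ^+ B / (\prod_(m <-
  ms) m`!)%N%:R.
  rewrite big_split /= natr_prod big_map -prodfV; congr (_ * _).
  rewrite -exprMn /B /ms; elim: us => [|u s IH] /=; first by rewrite big_nil.
  by rewrite big_cons IH exprD.
have fact_gt0' : 0 < (\prod_(m <- ms) m`!)%N%:R :> R.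
  by rewrite ltr0n; apply: prodn_gt0 => m; exact: fact_gt0.
rewrite ler_pdivrMr // mulrAC ler_wpM2r ?exprn_ge0 //.
rewrite -natrX -natrM ler_nat; apply: size_families => //.
by rewrite Sr.
Qed.

End type_prob.

(** * Asymptotics *)

Definition type_mass {R : realType} {b : nat} (lambda : R) (x : gw_word b ->
  nat) (t : nat) : R :=
  \prod_(u <- gw_inner x t) poisson_pmf lambda (x u).

Section asymptotics.
Context {R : realType} (lambda : R) (k r : nat) (p : nat -> R).
Hypothesis lambda_gt0 : 0 < lambda.
Hypothesis r_lt_k : (r < k)%N.
Hypothesis pE : \forall n \near \oo, 0 < p n <= 1 /\ 'C(n - r, k - r)%:R * p n = lambda.
Local Notation b := ('C(k, r) - 1)%N.

Lemma cvg_inv_subn (c : nat) : (fun n => (n - c)%N%:R^-1 : R) @ \oo --> (0 : R).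
Proof.
rewrite -(cvg_shiftn c.+1); apply: cvg_trans (@cvg_harmonic R).
by apply: near_eq_cvg; near=> n => /=; rewrite addnS subSn ?leq_addl // addnK.
Unshelve. all: by end_near.
Qed.

(** Removing one of [m] vertices multiplies the binomial coefficient by [1 - (k - r) / m], which
    tends to 1; thus the boundedly many vertices already used do not change the limit. *)
Lemma cvg_bin_p i : (fun n => 'C(n - (r + i), k - r)%:R * p n) @ \oo --> lambda.
Proof.
elim: i => [|i IH].
  apply: cvg_near_cst; near=> n; rewrite addn0.
  by have [_ ->] : 0 < p n <= 1 /\ 'C(n - r, k - r)%:R * p n = lambda by near: n.
have h : (fun n => 'C(n - (r + i), k - r)%:R * p n * (1 - (k - r)%:R * (n - (r + i))%N%:R^-1))
  @ \oo --> lambda.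
  have e : lambda = lambda * (1 - (k - r)%:R * 0) by rewrite mulr0 subr0 mulr1.
  rewrite [X in _ --> X]e.
  apply: cvgM IH _; apply: cvgB; first exact: cvg_cst.
  by apply: cvgM; [exact: cvg_cst|exact: cvg_inv_subn].
apply: cvg_trans h; apply: near_eq_cvg; near=> n => /=.
have nk : (r + i + k < n)%N by near: n; exact: nbhs_infty_gt.
set m := (n - (r + i))%N.
have -> : (n - (r + i.+1))%N = m.-1 by rewrite addnS subnS.
have m0 : (0 < m)%N by rewrite /m; lia.
have km : (k - r <= m)%N by rewrite /m; lia.
have mR : m%:R != 0 :> R by rewrite pnatr_eq0 -lt0n.
have /(congr1 (fun a => a%:R : R)) := mul_bin_down m (k - r).
rewrite !natrM (natrB R km) => e.
rewrite mulrAC; congr (_ * _); apply: (mulfI mR); rewrite e mulrCA -/m.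
rewrite mulrBr mulr1 mulrCA divff // mulr1 mulrC //.
Unshelve. all: by end_near.
Qed.

(** A linear lower bound: it yields both [p n --> 0] and the growth of the number of roots. *)
Lemma leq_bin_succ i j : (i.+1 <= 'C(i + j.+1, j.+1))%N.
Proof.
elim: j => [|j IH]; first by rewrite addn1 bin1.
by rewrite addnS binS; apply: leq_trans IH _; rewrite leq_addl.
Qed.

Lemma cvg_p0 : p @ \oo --> (0 : R).
Proof.
apply: (@squeeze_cvgr _ _ _ _ (fun=> 0) (fun n => lambda * (n - k)%N%:R^-1)); last 2 first.
- exact: cvg_cst.
- by rewrite -[X in _ --> X](mulr0 lambda); apply: cvgM; [exact: cvg_cst|exact: cvg_inv_subn].
near=> n.
have [/andP[p0 p1] pn] : 0 < p n <= 1 /\ 'C(n - r, k - r)%:R * p n = lambda by near: n.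
have nk : (k < n)%N by near: n; exact: nbhs_infty_gt.
have nk0 : 0 < (n - k)%N%:R :> R by rewrite ltr0n subn_gt0.
apply/andP; split; first exact: ltW.
rewrite -pn ler_pdivlMr // mulrC ler_pM2r // ler_nat.
have := leq_bin_succ (n - k) (k - r).-1.
rewrite prednK ?subn_gt0 // (_ : n - k + (k - r) = n - r)%N; last by lia.
by move=> h; apply: leq_trans h; rewrite leqnSn.
Unshelve. all: by end_near.
Qed.

Lemma cvg_prod_seq (I : Type) (s : seq I) (f : I -> nat -> R) (l : I -> R) :
  (forall i, f i @ \oo --> l i) -> (fun n => \prod_(i <- s) f i n) @ \oo --> \prod_(i <- s) l i.
Proof.
move=> fl; elim: s => [|i s IH].
  by rewrite big_nil; under eq_fun do rewrite big_nil; exact: cvg_cst.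
rewrite big_cons; under eq_fun do rewrite big_cons.
exact: cvgM.
Qed.

Lemma cvg_exp (f : nat -> R) (l : R) m : f @ \oo --> l -> (fun n => f n ^+ m) @ \oo --> l ^+ m.
Proof.
move=> fl; elim: m => [|m IH].
  by rewrite expr0; under eq_fun do rewrite expr0; exact: cvg_cst.
by rewrite exprS; under eq_fun do rewrite exprS; exact: cvgM.
Qed.

Lemma type_prob_near (x : gw_word b -> nat) (t : nat) (eps : R) : 0 < eps ->
  \forall n \near \oo, forall S : subsets n r, type_mass lambda x t - eps <=
    \sum_(H : {set subsets n k} | has_type (hedges H) (val S) t (gw_code x t)) set_weight (p n)
      H.
Proof.
move=> eps0.
set us := gw_inner x t; set B := sumn [seq x u | u <- us].
(* The last factor comes from [expR (- (p / (1 - p))) <= 1 - p], raised to the number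
   ['C(n - r, k - r)] of hyperedges forbidden per word, whose product with [p] is [lambda]. *)
pose LB n := \prod_(u <- us) (('C(n - (r + B * (k - r)), k - r)%:R * p n) ^+ x u / (x u)`!%:R) *
  expR (- (lambda / (1 - p n))) ^+ size us.
have LBl : LB @ \oo --> type_mass lambda x t.
  have -> : type_mass lambda x t = \prod_(u <- us) (lambda ^+ x u / (x u)`!%:R) * expR (-
    (lambda / (1 - 0))) ^+ size us.
    rewrite subr0 divr1 /type_mass -/us; under eq_bigr do rewrite /poisson_pmf lambda_gt0.
    by rewrite big_split /= big_const_seq count_predT iter_mulr_1.
  apply: cvgM.
    apply: cvg_prod_seq => u; apply: cvgM; last exact: cvg_cst.
    exact: cvg_exp (cvg_bin_p _).
  apply: cvg_exp; apply: continuous_cvg; first exact: continuous_expR.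
  apply: cvgN; apply: cvgM; first exact: cvg_cst.
  apply: cvgV; first by rewrite subr0 oner_eq0.
  by apply: cvgB; [exact: cvg_cst|exact: cvg_p0].
have near1 : \forall n \near \oo, type_mass lambda x t - eps <= LB n.
  move/cvgrPdist_le : LBl => /(_ eps eps0); apply: filterS => n.
  by rewrite ler_distl => /andP[_]; rewrite lerBlDr.
near=> n => S.
have [/andP[p0 p1] pn] : 0 < p n <= 1 /\ 'C(n - r, k - r)%:R * p n = lambda by near: n.
have plt1 : p n < 1.
  near: n; move/cvgrPdist_lt : cvg_p0 => /(_ 1 ltr01); apply: filterS => n.
  by rewrite sub0r normrN => /(le_lt_trans (ler_norm _)).
have p01 : 0 <= p n <= 1 by rewrite ltW.
have h1 : type_mass lambda x t - eps <= LB n by near: n.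
apply: le_trans h1 _; apply: le_trans (type_prob_ge r_lt_k p01 S x t).
rewrite /LB -/us -/B exprM exprAC ler_wpM2l //.
  by apply: prodr_ge0 => u _; rewrite divr_ge0 // exprn_ge0 // mulr_ge0 // ltW.
apply: lerXn2r; rewrite ?nnegrE ?expR_ge0 ?exprn_ge0 ?subr_ge0 //.
have q0 : 0 < 1 - p n by rewrite subr_gt0.
rewrite -pn -mulrA -mulrN expRM_natl.
apply: lerXn2r; rewrite ?nnegrE ?expR_ge0 ?(ltW q0) //.
rewrite expRN -[leRHS]invrK lef_pV2 ?posrE ?expR_gt0 ?invr_gt0 //.
apply: le_trans (expR_ge1Dx _).
rewrite -[X in _ <= X + _](divff (lt0r_neq0 q0)) -mulrDl subrK mul1r //.
Unshelve. all: by end_near.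
Qed.

End asymptotics.

Lemma card_subsets n k : #|{: subsets n k}| = 'C(n, k).
Proof.
rewrite card_sig -[in RHS](card_ord n) -card_draws; apply: eq_card => A.
by rewrite !inE.
Qed.

(** Pairs of a [k]-set and an [r]-subset of it. It makes the expected number of hyperedges equal to
    [lambda * 'C(n, r) / 'C(k, r)]. *)
Lemma mul_bin_bin n k r : (r <= k)%N -> (k <= n)%N ->
  ('C(n, k) * 'C(k, r) = 'C(n, r) * 'C(n - r, k - r))%N.
Proof.
move=> rk kn; have rn := leq_trans rk kn.
have e1 := bin_fact kn; have e2 := bin_fact rk; have e3 := bin_fact rn.
have e4 : ('C(n - r, k - r) * ((k - r)`! * (n - k)`!) = (n - r)`!)%N.
  have -> : (n - k = n - r - (k - r))%N by lia.
  by apply: bin_fact; rewrite leq_sub2r.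
have c0 : (0 < r`! * (k - r)`! * (n - k)`!)%N by rewrite !muln_gt0 !fact_gt0.
apply/eqP; rewrite -(eqn_pmul2r c0); apply/eqP.
transitivity n`!.
  by rewrite -e1 -e2; nia.
by rewrite -e3 -e4; nia.
Qed.

(** * Almost sure lower bounds of the proportions of the types *)

Section almost_sure.
Context {R : realType} (lambda : R) (k r : nat).
Context (d : measure_display) (Omega : measurableType d) (P : probability Omega R).
Variables (p : nat -> R) (H : forall n : nat, Omega -> {set subsets n k}).
Hypothesis lambda_gt0 : 0 < lambda.
Hypothesis r_gt0 : (0 < r)%N.
Hypothesis r_lt_k : (r < k)%N.
Hypothesis pE : \forall n \near \oo, 0 < p n <= 1 /\ 'C(n - r, k - r)%:R * p n = lambda.
Hypothesis HP : \forall n \near \oo, random_hypergraph P (p n) (H n).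
Local Notation b := ('C(k, r) - 1)%N.

(** Here [0 < r] enters: a bound exponentially small in the number of roots becomes a geometric
    series in [n]. *)
Lemma bin_r_ge n : (r <= n)%N -> (n - r <= 'C(n, r))%N.
Proof.
move=> rn; have := leq_bin_succ (n - r) r.-1; rewrite prednK // subnK //; exact: ltnW.
Qed.

Lemma sum_geometric_lty (F : nat -> set Omega) (a z : R) : 0 <= z < 1 ->
  (forall n, (P (F n) <= (a * z ^+ n)%:E)%E) -> (\sum_(n <oo) P (F n) < +oo)%E.
Proof.
move=> /andP[z0 z1] PF; apply: (@le_lt_trans _ _ (\sum_(n <oo) (a * z ^+ n)%:E)%E).
  by apply: lee_nneseries.
have -> : (\sum_(n <oo) (a * z ^+ n)%:E)%E = (lim (series (geometric a z) @ \oo))%:E.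
  rewrite -EFin_lim; last by apply: is_cvg_geometric_series; rewrite ger0_norm.
  by apply/congr_lim/funext => n /=; rewrite /series /= sumEFin.
exact: ltry.
Qed.

Lemma expected_type_count n t (s : seq (gw_word b * nat)) (p01 : 0 <= p n <= 1) (q : R) :
  (forall S : subsets n r, q <= \sum_(A : {set subsets n k} |
    has_type (hedges A) (val S) t s) set_weight (p n) A) ->
  q * 'C(n, r)%:R <= \sum_(A : {set subsets n k}) set_weight (p n) A * (type_count t s A)%:R.
Proof.
move=> h; rewrite -card_subsets mulr_natr -sumr_const.
rewrite (eq_bigr (fun A : {set subsets n k} => \sum_(S : subsets n r)
    if has_type (hedges A) (val S) t s then set_weight (p n) A else 0)); last first.
  move=> A _; rewrite /type_count -sum1_card natr_sum mulr_sumr -big_mkcond /=.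
  by apply: eq_big => S; rewrite ?inE ?mulr1.
rewrite exchange_big /=; apply: ler_sum => S _; rewrite -big_mkcond; exact: h.
Qed.

(** Half of [eps] pays for the convergence of the expected proportion, the other half for the
    deviation from it. *)
Lemma type_count_ae (x : gw_word b -> nat) (t : nat) (eps : R) : 0 < eps ->
  {ae P, forall w, \forall n \near \oo,
     (type_mass lambda x t - eps) * 'C(n, r)%:R <= (type_count t (gw_code x t) (H n w))%:R}.
Proof.
move=> eps0; set s := gw_code x t; set q := type_mass lambda x t.
have e20 : 0 < eps / 2 by rewrite divr_gt0.
pose L : R := (type_bound t s)%:R.
have L0 : 0 <= L by rewrite ler0n.
pose D := 2 * L + 8 * lambda * L ^+ 2 / eps + 1.
have lL0 : 0 <= 8 * lambda * L ^+ 2 / eps.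
  by rewrite divr_ge0 ?(ltW eps0) // mulr_ge0 ?exprn_ge0 // mulr_ge0 // ltW.
have D0 : 0 < D by rewrite /D; lra.
(* This choice gives [tau * L <= 1 / 2] and [8 * lambda * tau * L ^+ 2 <= eps]. *)
pose tau := D^-1.
have tau0 : 0 < tau by rewrite invr_gt0.
have tauL : tau * L <= 2^-1.
  rewrite mulrC ler_pdivrMr // /D; lra.
have tauL2 : 8 * lambda * tau * L ^+ 2 <= eps.
  have -> : 8 * lambda * tau * L ^+ 2 = (8 * lambda * L ^+ 2) / D by rewrite /tau mulrAC.
  rewrite ler_pdivrMr // /D mulrDr mulrDr mulr1 [X in _ <= _ + X + _]mulrC divfK ?gt_eqF //.
  by rewrite -[leLHS]add0r -[leLHS]addr0 lerD ?(ltW eps0) // lerD // mulr_ge0 ?(ltW eps0) //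
    mulr_ge0.
(* With [V] roots, the deviation contributes [- tau * eps / 2 * V] to the exponent and the quadratic
   term at most [tau * eps / 4 * V]; their sum is at most [- c * V]. *)
pose c := tau * eps / 4.
have c0 : 0 < c by rewrite divr_gt0 // mulr_gt0.
have [N0 _ HN] : \forall n \near \oo, [/\ 0 < p n <= 1 /\ 'C(n - r, k - r)%:R * p n = lambda,
    random_hypergraph P (p n) (H n),
    (forall S : subsets n r, q - eps / 2 <=
      \sum_(A : {set subsets n k} | has_type (hedges A) (val S) t s) set_weight (p n) A) & (k
        <= n)%N].
  near=> n; split; near: n; [exact: pE|exact: HP| |exact: nbhs_infty_ge].
  exact: (type_prob_near lambda_gt0 r_lt_k pE).
pose bad n w := (type_count t s (H n w))%:R <= (q - eps / 2) * 'C(n, r)%:R - (eps / 2) * 'C(n,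
  r)%:R.
(* Before [N0] the law of [H n] is unconstrained and the bad event might not even be measurable. *)
pose F n := if (n < N0)%N then set0 else [set w | bad n w].
have mF n : measurable (F n).
  rewrite /F; case: ltnP => // /HN[_ [Hm Hp Hi] _ _].
  exact: (measurable_random_set Hm (fun A => (type_count t s A)%:R <= _)).
have PF n : (P (F n) <= (expR (c * r%:R) * expR (- c) ^+ n)%:E)%E.
  rewrite /F; case: ltnP => [_|/HN[[/andP[p0 p1] pn] [Hm Hp Hi] hS kn]].
    by rewrite measure0 lee_fin mulr_ge0 ?exprn_ge0 ?expR_ge0.
  have p01 : 0 <= p n <= 1 by rewrite ltW.
  rewrite (random_set_pred Hm Hp Hi (fun A => (type_count t s A)%:R <= (q - eps / 2) * 'C(n,
    r)%:R - (eps / 2) * 'C(n, r)%:R)) lee_fin.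
  have lip (A : {set subsets n k}) e : `|(type_count t s (e |: A))%:R - (type_count t s A)%:R|
    <= L :> R.
    exact: type_count_lipschitz.
  apply: le_trans (@sum_set_weight_lower_tail R _ (p n) p01 (fun A : {set subsets n k} =>
    (type_count t s A)%:R)
    L tau _ (eps / 2 * 'C(n, r)%:R) L0 (ltW tau0) tauL lip (expected_type_count p01 hS)) _.
  rewrite -expRM_natl -expRD ler_expR card_subsets.
  have Vn : n%:R - r%:R <= 'C(n, r)%:R :> R.
    rewrite -natrB ?ler_nat ?bin_r_ge //; apply: leq_trans (ltnW r_lt_k) kn.
  have Ekn : 'C(n, k)%:R * p n <= lambda * 'C(n, r)%:R.
    have := mul_bin_bin (ltnW r_lt_k) kn => /(congr1 (fun a => a%:R : R)); rewrite !natrM => e.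
    rewrite -pn mulrAC [X in _ <= X * _]mulrC -e mulrAC ler_peMr ?mulr_ge0 ?(ltW p0) //.
    by rewrite (_ : 1 = 1%:R) // ler_nat bin_gt0 ltnW.
  have V0 : 0 <= 'C(n, r)%:R :> R by [].
  set V := 'C(n, r)%:R in Vn Ekn V0 *; set M := 'C(n, k)%:R * p n in Ekn.
  have -> : 'C(n, k)%:R * (p n * 2 * (tau * L) ^+ 2) = M * (2 * (tau * L) ^+ 2) by rewrite /M;
    lra.
  have h1 : M * (2 * (tau * L) ^+ 2) <= lambda * V * (2 * (tau * L) ^+ 2).
    by rewrite ler_wpM2r // mulr_ge0 // exprn_ge0 // mulr_ge0 // ltW.
  have h2 : V * tau * (8 * lambda * tau * L ^+ 2) <= V * tau * eps.
    by rewrite ler_wpM2l // mulr_ge0 // ltW.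
  have h3 : c * (n%:R - r%:R) <= c * V by rewrite ler_wpM2l // ltW.
  have h4 : c * V = V * tau * eps / 4 by rewrite /c; lra.
  rewrite expr2 in h1 h2; rewrite expr2; lra.
have lim0 : P (lim_sup_set F) = 0.
  apply: lim_sup_set_cvg0 => //; apply: (@sum_geometric_lty _ (expR (c * r%:R)) (expR (- c)))
    => //.
  by rewrite expR_ge0 expR_lt1 oppr_lt0.
exists (lim_sup_set F); split => //.
  by apply: bigcapT_measurable => n; apply: bigcup_measurable => m _; exact: mF.
move=> w /= ngood n _; apply: contrapT => nF; apply: ngood.
exists (maxn n N0) => // m /=; rewrite geq_max => /andP[nm N0m].
rewrite leNgt; apply/negP => lt; apply: nF; exists m => //.
rewrite /F ltnNge N0m /= /bad -mulrBl; apply: le_trans (ltW lt) _.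
by rewrite ler_wpM2r // -addrA -opprD -splitr.
Unshelve. all: by end_near.
Qed.

(** A countable union of null sets: the lists [s] are countably many, and the inverses of integers
    suffice for [eps]. *)
Lemma type_count_ae_all : {ae P, forall w, forall t (s : seq (gw_word b * nat)) (eps : R),
  0 < eps ->
   \forall n \near \oo,
     (type_mass lambda (gw_decode s) t - eps) * 'C(n, r)%:R <=
     (type_count t (gw_code (gw_decode s) t) (H n w))%:R}.
Proof.
pose Q (i : nat * seq (gw_word b * nat) * nat) w := \forall n \near \oo,
     (type_mass lambda (gw_decode i.1.2) i.1.1 - i.2.+1%:R^-1) * 'C(n, r)%:R <=
     (type_count i.1.1 (gw_code (gw_decode i.1.2) i.1.1) (H n w))%:R.
have : {ae P, forall w, forall j : nat, if @unpickle (nat * seq (gw_word b * nat) * nat)%type j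
  is Some i then Q i w else True}.
  apply: ae_foralln => j; case: unpickle => [i|]; last exact: aeW.
  by apply: type_count_ae; rewrite invr_gt0.
apply: filterS => w h t s eps eps0.
have [m meps] : exists m : nat, m.+1%:R^-1 < eps.
  by have [m] := ltr_add_invr eps0; rewrite add0r => me; exists m.
have := h (pickle (t, s, m)); rewrite pickleK /Q /=; apply: filterS => n; apply: le_trans.
by rewrite ler_wpM2r // lerB // ltW.
Qed.

End almost_sure.

(** * Independent variables with a given law on the unit interval *)

Section affine.
Context {R : realType}.
Local Notation mu := (@lebesgue_measure R).

(** The rescaled pushforward agrees with Lebesgue measure on half-open intervals, which determine
    it. *)
Lemma lebesgue_measure_affine (c q : R) (A : set (measurableTypeR R)) : 0 < q -> measurable A ->
  mu ((fun x => (x - c) / q) @^-1` A) = (q%:E * mu A)%E.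
Proof.
move=> q0 mA; pose g : measurableTypeR R -> measurableTypeR R := fun x => (x - c) / q.
have mg : measurable_fun setT g.
  exact: (measurable_funM (measurable_funB (@measurable_id _ _ _) (@measurable_cst _ _ _ _ _
    _)) (@measurable_cst _ _ _ _ _ _)).
have qi0 : 0 <= q^-1 by rewrite invr_ge0 ltW.
have h X : ocitv X -> mu X = mscale (NngNum qi0) (pushforward mu g) X; last first.
  rewrite [X in (_ * X)%E](lebesgue_measure_unique (h mg) mA).
  by rewrite /mscale /= muleA -EFinM divff ?gt_eqF// mul1e.
case=> -[a b] _ <-; rewrite /mscale /= /pushforward.
have -> : g @^-1` `]a, b]%classic = `]a * q + c, b * q + c]%classic.
  apply/seteqP; split => x /=; rewrite !in_itv /= /g => /andP[h1 h2]; apply/andP; split.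
  - by rewrite -ltrBrDr -ltr_pdivlMr.
  - by rewrite -lerBlDr -ler_pdivrMr.
  - by rewrite ltr_pdivlMr // ltrBrDr.
  - by rewrite ler_pdivrMr // lerBlDr.
rewrite !lebesgue_measure_itv /= !lte_fin ltrD2r ltr_pM2r //; case: ifPn => _;
  last by rewrite mule0.
rewrite -!EFinB -EFinM; congr (_%:E).
by rewrite opprD addrACA subrr addr0 -mulrBl mulrC mulfK ?gt_eqF.
Qed.

End affine.


Section bernoulli_shift.
Context {R : realType} (q : nat -> R).
Hypothesis q_gt0 : forall n, 0 < q n.
Hypothesis q_sum : series q @ \oo --> (1 : R).

Local Notation F := (series q).
Local Notation mu := (@lebesgue_measure R).
Local Notation J := (`[0, 1[%classic : set (measurableTypeR R)).

Lemma series_succ n : F n.+1 = F n + q n.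
Proof. by rewrite !seriesEord /= big_ord_recr. Qed.

Lemma series_homo : {homo F : m n / (m <= n)%N >-> m <= n}.
Proof.
apply: (homo_leq (@lexx _ R) (@le_trans _ R)) => n.
by rewrite series_succ lerDl ltW.
Qed.

Lemma series0 : F 0%N = 0. Proof. by rewrite seriesEord /= big_ord0. Qed.

Lemma series_le1 n : F n <= 1.
Proof.
have -> : (1 : R) = lim (F @ \oo) by apply/esym/cvg_lim.
by apply: nondecreasing_cvgn_le; [exact: series_homo|apply/cvg_ex; exists 1].
Qed.

(** The inverse distribution function of [q]: the partial sums cut the unit interval into pieces of
    lengths [q m]. *)
Definition shift_index (x : R) : nat := xget 0%N [set m | F m <= x < F m.+1].

Lemma shift_indexE x m : F m <= x < F m.+1 -> shift_index x = m.
Proof.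
move=> xm; rewrite /shift_index; apply: xget_unique => // n /= xn.
have le (i j : nat) : F i <= x < F i.+1 -> F j <= x < F j.+1 -> (i <= j)%N.
  move=> /andP[xi _] /andP[_ xj]; rewrite -ltnS ltnNge; apply/negP => ji.
  by have := lt_le_trans xj (le_trans (series_homo ji) xi); rewrite ltxx.
by apply/eqP; rewrite eqn_leq !le.
Qed.

Lemma shift_indexP x : 0 <= x < 1 -> F (shift_index x) <= x < F (shift_index x).+1.
Proof.
move=> /andP[x0 x1]; have ex : exists n, x < F n.
  have /cvgrPdist_lt/(_ (1 - x)) := q_sum; rewrite subr_gt0 => /(_ x1)[n _ /(_ n (leqnn n))] /=
    h.
  exists n; rewrite -ltrN2 -(ltrD2l 1) (le_lt_trans _ h) //; exact: ler_norm.
case: (ex_minnP ex) => -[|n]; first by rewrite series0 ltNge x0.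
move=> xn nmin; rewrite (@shift_indexE _ n) ?xn ?andbT leNgt; apply/negP => /nmin;
  rewrite ltnn //.
Qed.

(* [shift] maps each interval on which [shift_index] is constant affinely onto the
   unit interval, hence preserves the measure and is independent of [shift_index]. *)
Definition shift (x : R) : R := (x - F (shift_index x)) / q (shift_index x).

Let mJ : measurable J. Proof. exact: measurable_itv. Qed.

Lemma preimage_shift_index m (B : set R) :
  J `&` [set x | shift_index x = m /\ B (shift x)] = (fun x => (x - F m) / q m) @^-1` (B `&` J).
Proof.
apply/seteqP; split => x /=; rewrite !in_itv /=.
  move=> [/shift_indexP + [xm]]; rewrite /shift xm series_succ => /andP[h1 h2] Bx; split=> //.
  by rewrite divr_ge0 ?subr_ge0 ?(ltW (q_gt0 _)) //= ltr_pdivrMr // mul1r ltrBlDl.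
rewrite ltr_pdivrMr // mul1r ltrBlDl -series_succ pmulr_lge0 ?invr_gt0 // subr_ge0 => -[Bx xm].
have xE := shift_indexE xm; split; last by rewrite /shift xE.
have /andP[h1 h2] := xm; rewrite (lt_le_trans h2 (series_le1 _)) andbT.
by apply: le_trans h1; rewrite -series0; exact: series_homo.
Qed.

Lemma measurable_shift_index_eq m : measurable (shift_index @^-1` [set m] : set
  (measurableTypeR R)).
Proof.
have mI n : measurable (`[F n, F n.+1[%classic : set (measurableTypeR R)) by exact:
  measurable_itv.
have mU : measurable (\bigcup_n (`[F n, F n.+1[%classic : set (measurableTypeR R))) by exact:
  bigcup_measurable.
(* The index 0 also receives the points outside all the pieces, through the default of [xget]. *)
have -> : shift_index @^-1` [set m] = `[F m, F m.+1[%classic `|`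
    (if m is 0%N then ~` (\bigcup_n (`[F n, F n.+1[%classic)) else set0) :> set
      (measurableTypeR R).
  apply/seteqP; split => x /=; rewrite in_itv /=.
    rewrite /shift_index; case: xgetP => [n -> xn <-|nx <-]; first by left.
    by right => -[n _ /=]; rewrite in_itv /=; exact: nx.
  case=> [/shift_indexE //|]; case: m => // nx.
  rewrite /shift_index; case: xgetP => // n _ xn; exfalso; apply: nx.
  by exists n => //=; rewrite in_itv.
by apply: measurableU => //; case: m => [|m] //; exact: measurableC.
Qed.

Lemma measurable_shift_index : measurable_fun [set: measurableTypeR R] shift_index.
Proof.
move=> _ A _; rewrite setTI -[A]image_id -(@bigcup_imset1 _ _ A id) preimage_bigcup.
by apply: bigcup_measurable => m _; exact: measurable_shift_index_eq.
Qed.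

Lemma measurable_shift : measurable_fun [set: measurableTypeR R] (shift : measurableTypeR R ->
  measurableTypeR R).
Proof.
have -> : [set: measurableTypeR R] = \bigcup_m (shift_index @^-1` [set m]).
  by apply/seteqP; split => // x _; exists (shift_index x).
apply/measurable_fun_bigcup => m; first exact: measurable_shift_index_eq.
have mg : measurable_fun [set: measurableTypeR R]
    ((fun x => (x - F m) / q m) : measurableTypeR R -> measurableTypeR R).
  exact: (measurable_funM (measurable_funB (@measurable_id _ _ _) (@measurable_cst _ _ _ _ _
    _)) (@measurable_cst _ _ _ _ _ _)).
apply: (eq_measurable_fun _ _ (measurable_funTS mg)) => //.
by move=> x; rewrite inE /= /shift => ->.
Qed.

Definition unit_mu : set (measurableTypeR R) -> \bar R := mrestr mu mJ.

HB.instance Definition _ := Measure.on unit_mu.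

Let unit_mu_setT : unit_mu setT = 1%E.
Proof. by rewrite /unit_mu /mrestr setTI lebesgue_measure_itv /= lte_fin ltr01 -EFinB subr0.
  Qed.

HB.instance Definition _ := Measure_isProbability.Build _ _ _ unit_mu unit_mu_setT.

Lemma unit_mu_index_shift m (B : set (measurableTypeR R)) : measurable B ->
  unit_mu [set x | shift_index x = m /\ B (shift x)] = ((q m)%:E * unit_mu B)%E.
Proof.
move=> mB; rewrite /unit_mu /mrestr setIC preimage_shift_index lebesgue_measure_affine //.
exact: measurableI.
Qed.

Lemma measurable_index_shift (A : set nat) (B : set (measurableTypeR R)) : measurable B ->
  measurable [set x | A (shift_index x) /\ B (shift x)].
Proof.
move=> mB; apply: measurableI.
  by rewrite -[X in measurable X]setTI; exact: measurable_shift_index.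
by rewrite -[X in measurable X]setTI; exact: measurable_shift.
Qed.

Lemma unit_mu_shift_indep (A : set nat) (B : set (measurableTypeR R)) : measurable B ->
  unit_mu [set x | A (shift_index x) /\ B (shift x)] = (unit_mu (shift_index @^-1` A) * unit_mu
    B)%E.
Proof.
move=> mB.
pose G (B : set (measurableTypeR R)) m := [set x | (shift_index x = m /\ A m) /\ B (shift x)].
have GE B' : measurable B' -> unit_mu [set x | A (shift_index x) /\ B' (shift x)] =
    (\sum_(m <oo) (if m \in A then q m else 0)%:E * unit_mu B')%E.
  move=> mB'.
  have -> : [set x | A (shift_index x) /\ B' (shift x)] = \bigcup_m G B' m.
    apply/seteqP; split => x; first by move=> [Ax Bx]; exists (shift_index x).
    by move=> [m _ [[<- ?] ?]].
  rewrite measure_bigcup //=.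
  - rewrite (@eq_eseriesl _ _ xpredT) => [|m]; last by rewrite in_setT.
    apply: eq_eseriesr => m _; case: ifPn => [/set_mem Am|/negP nA].
      rewrite -unit_mu_index_shift //; congr unit_mu; apply/seteqP; split => x /=;
        [by move=> [[]]|by move=> []].
    rewrite mul0e (_ : G B' m = set0) ?measure0 //; apply/seteqP; split => // x [[_ Am]].
    by case: nA; exact/mem_set.
  - move=> m _; have [Am|nA] := pselect (A m).
      rewrite (_ : G _ _ = [set x | [set m] (shift_index x) /\ B' (shift x)]);
        first exact: measurable_index_shift.
      by apply/seteqP; split => x /=; [move=> [[]]|move=> []].
    by rewrite (_ : G B' m = set0) //; apply/seteqP; split => // x [[_ Am]].
  - by move=> i j _ _ [x [[[<- _] _] [[<- _] _]]].
rewrite (GE B mB).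
have <- : unit_mu [set x | A (shift_index x) /\ setT (shift x)] = unit_mu (shift_index @^-1` A).
  by congr unit_mu; apply/seteqP; split => x //= [].
rewrite (GE setT) // probability_setT.
under [in RHS]eq_eseriesr do rewrite mule1.
rewrite -(fineK (fin_num_measure unit_mu B mB)) [RHS]muleC -nneseriesZl.
  by apply: eq_eseriesr => m _; rewrite muleC.
by move=> m _; case: ifPn; rewrite lee_fin // ltW.
Qed.

Lemma unit_mu_shift (B : set (measurableTypeR R)) : measurable B ->
  unit_mu (shift @^-1` B) = unit_mu B.
Proof.
move=> mB; have := unit_mu_shift_indep [set: nat] mB.
rewrite preimage_setT probability_setT mul1e => <-.
by congr unit_mu; apply/seteqP; split => x //= [].
Qed.

(** The digits of [x] in the expansion with piece lengths [q m]: one uniform point carries a whole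
    independent sequence of law [q]. *)
Definition shift_coord (i : nat) (x : measurableTypeR R) : nat := shift_index (iter i shift x).

Lemma measurable_shift_coord i : measurable_fun [set: measurableTypeR R] (shift_coord i).
Proof.
elim: i => [|i IH]; first exact: measurable_shift_index.
rewrite (_ : shift_coord _ = shift_coord i \o shift); last first.
  by apply/funext => x; rewrite /shift_coord /= -iterSr.
exact: (measurableT_comp IH measurable_shift).
Qed.

Lemma unit_mu_shift_coord i (A : set nat) :
  unit_mu (shift_coord i @^-1` A) = unit_mu (shift_index @^-1` A).
Proof.
elim: i => [//|i IH]; rewrite -IH -[RHS]unit_mu_shift; last first.
  by rewrite -[X in measurable X]setTI; exact: measurable_shift_coord.
by congr unit_mu; apply/seteqP; split => x; rewrite /= /shift_coord -iterSr.
Qed.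

Lemma unit_mu_shift_coord1 i m : unit_mu (shift_coord i @^-1` [set m]) = (q m)%:E.
Proof.
rewrite unit_mu_shift_coord -[RHS]mule1 -(@probability_setT _ _ _ unit_mu) -unit_mu_index_shift
  //.
by congr unit_mu; apply/seteqP; split => x //= [].
Qed.

Lemma measurable_shift_coords (A : nat -> set nat) N :
  measurable [set x : measurableTypeR R | forall i, (i < N)%N -> A i (shift_coord i x)].
Proof.
rewrite (_ : [set x | _] = \bigcap_(i in `I_N) (shift_coord i @^-1` A i)) //.
apply: bigcap_measurableType => i _.
by rewrite -[X in measurable X]setTI; exact: measurable_shift_coord.
Qed.

(** The coordinates after the first one are the coordinates of [shift x], which is independent of
    [shift_index x] and has the same law as [x]. *)
Lemma unit_mu_shift_coords (A : nat -> set nat) N :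
  unit_mu [set x | forall i, (i < N)%N -> A i (shift_coord i x)] =
  (\prod_(i < N) fine (unit_mu (shift_index @^-1` A i)))%:E.
Proof.
elim: N A => [|N IH] A.
  rewrite big_ord0 -(@probability_setT _ _ _ unit_mu); congr unit_mu.
  by apply/seteqP; split.
rewrite big_ord_recl EFinM fineK ?fin_num_measure //; last first.
  by rewrite -[X in measurable X]setTI; exact: measurable_shift_index.
rewrite -[X in (_ * X)%E](IH (fun i => A i.+1)) -unit_mu_shift_indep;
  last exact: (measurable_shift_coords (fun i => A i.+1) N).
congr unit_mu; apply/seteqP; split => x /=.
  by move=> h; split; [exact: (h 0%N)|move=> i iN; have := h i.+1 iN;
    rewrite /shift_coord iterSr].
move=> [h0 h] [|i] // iN; have := h i iN; rewrite /shift_coord -iterSr //.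
Qed.

Lemma shift_coord_independent (I : countType) (A : I -> set nat) :
  independent_events unit_mu (fun u => shift_coord (pickle u) @^-1` A u).
Proof.
move=> s us; pose E u : set (measurableTypeR R) := shift_coord (pickle u) @^-1` A u.
change (unit_mu (\bigcap_(u in [set` s]) E u) = (\prod_(u <- s) fine (unit_mu (E u)))%:E).
have EE u : unit_mu (E u) = unit_mu (shift_index @^-1` A u) by exact: unit_mu_shift_coord.
pose N := (\max_(u <- s) pickle u).+1.
have uN u : u \in s -> (pickle u < N)%N by move=> su; rewrite ltnS; exact: leq_bigmax_seq.
(* The coordinates not in [s] are left free, which reduces the claim to an initial segment. *)
pose B i : set nat := if @pickle_inv I i is Some u then (if u \in s then A u else setT) else
  setT.
have BE u : u \in s -> B (pickle u) = A u by move=> su; rewrite /B pickleK_inv su.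
have -> : \bigcap_(u in [set` s]) E u = [set x | forall i, (i < N)%N -> B i (shift_coord i x)].
  apply/seteqP; split => x /= h.
    move=> i _; rewrite /B; have := @pickle_invK I i; case: pickle_inv => //= u <-.
    by case: ifP => // su; exact: h.
  by move=> u /= su; have := h _ (uN _ su); rewrite BE.
rewrite unit_mu_shift_coords; congr (_%:E).
transitivity (\prod_(i <- map pickle s) fine (unit_mu (shift_index @^-1` B i))); last first.
  by rewrite big_map; apply: eq_big_seq => u su; rewrite EE BE.
rewrite -(big_mkord xpredT (fun i => fine (unit_mu (shift_index @^-1` B i)))).
rewrite (bigID (mem (map pickle s))) /= [X in _ * X]big1 ?mulr1; last first.
  move=> i si; suff -> : B i = setT by rewrite preimage_setT probability_setT.
  rewrite /B; have := @pickle_invK I i; case: pickle_inv => //= u ui.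
  by case: ifP => // su; case/negP: si; rewrite -ui map_f.
rewrite -big_filter; apply: perm_big; apply: uniq_perm.
- by rewrite filter_uniq // /index_iota iota_uniq.
- by rewrite map_inj_uniq //; exact: pcan_inj pickleK_inv.
- move=> i; rewrite mem_filter mem_index_iota /=; apply/andP/idP => [[]//|si]; split=> //.
  by case/mapP: si => u su ->; exact: uN.
Qed.

End bernoulli_shift.

(** * The block Galton-Watson law *)

Section cylinders.
Context {R : realType} {b : nat}.
Implicit Types (x : gw_word b -> nat) (f g : gstar R -> R).

Definition cylinder t x : set (gstar R) :=
  [set y : gstar R | riso (gball (gw_graph R x) [::] t) [::] (gball (repr y) (Defs.root (repr
    y)) t) (Defs.root (repr y))].

Lemma cylinder_gclass t x : cylinder t x (gclass (gw_graph R x) [::]).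
Proof. exact: gclass_gball. Qed.

Lemma cylinder_code t x y : gw_code x t = gw_code y t -> cylinder t x `<=` cylinder t y.
Proof.
by move=> xy z; apply: riso_trans; exact: gw_code_gball (esym xy).
Qed.

Lemma gw_code_le s t x y : (s <= t)%N -> gw_code x t = gw_code y t -> gw_code x s = gw_code y s.
Proof.
move=> st /gw_codeP xy; apply/gw_codeP => u us; apply: xy; move: us.
by rewrite !mem_gw_inner => /andP[-> us]; exact: leq_trans us st.
Qed.

Lemma cylinder_le s t x : (s <= t)%N -> cylinder t x `<=` cylinder s x.
Proof. by move=> st y; exact: riso_gball_le. Qed.

Lemma cylinder_dist t x (y z : gstar R) : cylinder t x y -> cylinder t x z ->
  local_dist y z <= (1 + t%:R)^-1.
Proof.
move=> xy xz; apply: rdist_le; apply: riso_trans xz; apply: riso_sym xy.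
exact: within_root.
Qed.

Lemma cylinder_nbhs x (U : set (gstar R)) : nbhs (gclass (gw_graph R x) [::]) U ->
  exists t, cylinder t x `<=` U.
Proof.
move=> /nbhs_ballP[e /= e0 eU].
have [t te] : exists t : nat, t.+1%:R^-1 < e.
  by have [m] := ltr_add_invr e0; rewrite add0r => me; exists m.
exists t => z xz; apply: eU.
change (local_dist (gclass (gw_graph R x) [::]) z < e).
by apply: le_lt_trans (cylinder_dist (cylinder_gclass t x) xz) _; rewrite nat1r.
Qed.

End cylinders.

Lemma continuous_borel (R : realType) (T : ptopologicalType) (f : T -> R) : continuous f ->
  measurable_fun [set: borel T] (f : borel T -> R).
Proof.
move=> cf; apply: (@measurability _ _ (borel T) (measurableTypeR R) setT f (@RGenOpens.G R));
  first exact: RGenOpens.measurableE.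
move=> _ [_ [x [y ->]] <-]; rewrite setTI; apply: sub_sigma_algebra.
by apply: open_comp; [move=> z _; exact: cf|exact: itv_open].
Qed.

Lemma dominated_approx (d : measure_display) (T : measurableType d) (R : realType)
    (Q : probability T R) (f_ : nat -> T -> R) (f : T -> R) (M eps : R) :
  (forall n, measurable_fun setT (f_ n)) -> (forall n w, 0 <= f_ n w <= M) ->
  (forall w, f_ n w @[n --> \oo] --> f w) -> 0 < eps ->
  exists n, (\int[Q]_w (f w)%:E <= \int[Q]_w (f_ n w)%:E + eps%:E)%E.
Proof.
move=> mf fM ff eps0.
have intM : Q.-integrable setT (EFin \o cst M).
  by apply: finite_measure_integrable_cst.
have cv : ((\int[Q]_w (f_ n w)%:E) @[n --> \oo] --> \int[Q]_w (f w)%:E)%E.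
  apply: (@dominated_cvg _ _ _ Q setT measurableT (fun n w => (f_ n w)%:E) _ (EFin \o cst M))
    => //.
  - by move=> n; exact/measurable_EFinP.
  - by move=> w _; apply: cvg_EFin; [exact: nearW|exact: ff].
  - by move=> n w _ /=; have /andP[h0 hM] := fM n w; rewrite lee_fin ger0_norm.
have f0 w : 0 <= f w <= M.
  have cl := ff w; apply/andP; split.
    by rewrite -(cvg_lim _ cl) //; apply: limr_ge; [apply/cvg_ex;
      exists (f w)|apply: nearW => n; have /andP[] := fM n w].
  by rewrite -(cvg_lim _ cl) //; apply: limr_le; [apply/cvg_ex; exists (f w)|apply: nearW => n;
    have /andP[] := fM n w].
have mlim : measurable_fun setT f.
  by apply: (measurable_fun_cvg mf) => w _; exact: ff.
have fin (h : T -> R) : measurable_fun setT h -> (forall w, 0 <= h w <= M) ->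
  (\int[Q]_w (h w)%:E)%E \is a fin_num.
  move=> mh hM; apply: integrable_fin_num => //; apply: (le_integrable measurableT _ _ intM).
    exact/measurable_EFinP.
  by move=> w _ /=; have /andP[h0 h1] := hM w; rewrite lee_fin !ger0_norm // (le_trans h0).
rewrite -(fineK (fin _ mlim f0)) in cv *.
move/fine_cvgP : cv => [_ /cvgrPdist_le/(_ _ eps0)[n _ /(_ n (leqnn n))]] /=.
rewrite ler_distl => /andP[_ h]; exists n.
by rewrite -(fineK (fin _ (mf n) (fM n))) -EFinD lee_fin.
Qed.

Section block_GW_law.
Context {R : realType} (lambda : R) (b : nat).
Context {d : measure_display} {T : measurableType d} {Q : probability T R}.
Variable X : gw_word b -> {RV Q >-> nat}.
Hypothesis Xp : forall u (m : nat), Q (X u @^-1` [set m]) = (poisson_pmf lambda m)%:E.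
Hypothesis Xi : forall A : gw_word b -> set nat, independent_events Q (fun u => X u @^-1` A u).

Local Notation code t w := (gw_code (fun u => X u w) t).

Lemma code_eventE t x : [set w | code t w = gw_code x t] =
  \bigcap_(u in [set` gw_inner x t]) (X u @^-1` [set x u]).
Proof.
apply/seteqP; split => w /=.
  by move=> /esym/gw_codeP xw u /= uI; rewrite /= xw.
by move=> h; apply/esym/gw_codeP => u uI; have /= -> := h u uI.
Qed.

Lemma measurable_code t s : measurable [set w | code t w = s].
Proof.
have [sE|sE] := eqVneq (gw_code (gw_decode s) t) s.
  rewrite -sE code_eventE; apply: fin_bigcap_measurable; first exact: finite_seq.
  by move=> u _; rewrite -[X in measurable X]setTI; exact: measurable_funP.
rewrite (_ : [set w | _] = set0) //; apply/seteqP; split => // w /= ws; move/eqP: sE; apply.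
by rewrite -ws gw_code_decode.
Qed.

Lemma prob_code t x : Q [set w | code t w = gw_code x t] = (type_mass lambda x t)%:E.
Proof.
rewrite code_eventE (Xi (fun u => [set x u]) (s := gw_inner x t)) ?undup_uniq //.
by congr (_%:E); apply: eq_bigr => u _; rewrite Xp.
Qed.

Lemma countable_code_preimage t (A : set (seq (gw_word b * nat))) : measurable [set w |
  A (code t w)].
Proof.
rewrite (_ : [set w | _] = \bigcup_(s in A) [set w | code t w = s]); last first.
  by apply/seteqP; split => w /=; [exists (code t w)|move=> [s As /= ->]].
rewrite bigcup_mkcond; apply: countable_bigcupT_measurable; first exact: countableP.
by move=> s; case: ifP => // _; exact: measurable_code.
Qed.

Lemma measurable_fun_code t (F : seq (gw_word b * nat) -> R) :
  measurable_fun setT (fun w => F (code t w)).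
Proof. by move=> _ B mB; rewrite setTI; exact: (countable_code_preimage t (F @^-1` B)). Qed.

Definition gw_class (w : T) : borel (gstar R) := gclass (gw_graph R (fun u => X u w)) [::].

(** A class lies in an open set when a whole cylinder around it does, and this event depends on a
    code only, of which there are countably many. *)
Lemma measurable_gw_class : measurable_fun setT gw_class.
Proof.
apply: (@measurability _ _ T (borel (gstar R)) setT gw_class (@open (gstar R))) => // _ [U oU
  <-]; rewrite setTI.
rewrite (_ : _ @^-1` U = \bigcup_t [set w | cylinder t (gw_decode (code t w)) `<=` U]).
  apply: bigcupT_measurable => t.
  exact: (countable_code_preimage t [set s | cylinder t (gw_decode s) `<=` U]).
have eqc t w : gw_code (gw_decode (code t w)) t = code t w by rewrite gw_code_decode.
apply/seteqP; split => w /=.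
  move=> Uw; have [t tU] := cylinder_nbhs (open_nbhs_nbhs (conj oU Uw)).
  by exists t => //= y /(cylinder_code (eqc t w)); exact: tU.
move=> [t _ tU]; apply: tU; apply: cylinder_code (esym (eqc t w)) _ _.
exact: cylinder_gclass.
Qed.

(** The coefficient [a s] is the infimum of [g] on a cylinder. Dominated convergence is used twice:
    in the radius, by continuity of [g], then in the number of codes retained. The latter expresses
    that finitely many types carry almost all the mass. *)
Lemma gw_class_approx (g : gstar R -> R) (M eps : R) : continuous g -> (forall y,
  0 <= g y <= M) -> 0 < eps ->
  exists t (ss : seq (seq (gw_word b * nat))) (a : seq (gw_word b * nat) -> R),
  [/\ uniq ss, forall s, s \in ss -> gw_code (gw_decode s) t.+1 = s, forall s, s \in ss ->
    0 <= a s,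
     forall s y, s \in ss -> cylinder t (gw_decode s) y -> a s <= g y &
     (\int[Q]_w (g (gw_class w))%:E <= (\sum_(s <- ss) a s * type_mass lambda (gw_decode s)
       t.+1 + eps)%:E)%E].
Proof.
move=> cg gM eps0; have M0 : 0 <= M by have /andP[h] := gM point; exact: le_trans.
pose al t (s : seq (gw_word b * nat)) := inf [set g y | y in cylinder t (gw_decode s)].
have cyl0 t (s : seq (gw_word b * nat)) : [set g y | y in cylinder t (gw_decode s)] !=set0.
  by exists (g (gclass (gw_graph R (gw_decode s)) [::])); eexists; [exact: cylinder_gclass|].
have lb t (s : seq (gw_word b * nat)) : lbound [set g y | y in cylinder t (gw_decode s)] 0.
  by move=> _ [y _ <-]; have /andP[] := gM y.
have al_le t s y : cylinder t (gw_decode s) y -> al t s <= g y.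
  by move=> ys; apply: ge_inf; [exists 0; exact: lb|exists y].
have al0 t s : 0 <= al t s by apply: lb_le_inf; [exact: cyl0|exact: lb].
have alM t s : al t s <= M.
  by have [_ [y ys _]] := cyl0 t s; apply: le_trans (al_le _ _ _ ys) _; have /andP[] := gM y.
have dec t w : cylinder t (fun u => X u w) = cylinder t (gw_decode (code t.+1 w)) :> set (gstar
  R).
  have e : gw_code (gw_decode (code t.+1 w)) t = code t w.
    by apply: (gw_code_le (leqnSn t)); rewrite gw_code_decode.
  by apply/seteqP; split; apply: cylinder_code.
(* The codes have depth [t.+1] for balls of radius [t], in accordance with [line_graph_gball]. *)
have [||||t ht] := @dominated_approx _ _ _ Q (fun t w => al t (code t.+1 w)) (fun w => g
  (gw_class w)) M (eps / 2).
- by move=> t; exact: measurable_fun_code.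
- by move=> t w; rewrite al0 alM.
- move=> w; apply/cvgrPdist_le => e e0.
  have /cvgrPdist_le/(_ e e0) := cg (gw_class w); rewrite /gw_class => /cylinder_nbhs[t0 ht0].
  near=> t; have t0t : (t0 <= t)%N by near: t; exact: nbhs_infty_ge.
  rewrite ler_distl; apply/andP; split.
    have h : al t (code t.+1 w) <= g (gclass (gw_graph R (fun u => X u w)) [::]).
      by apply: al_le; rewrite -dec; exact: cylinder_gclass.
    by rewrite lerBlDr; apply: le_trans h _; rewrite lerDl ltW.
  rewrite -lerBlDr; apply: lb_le_inf; first exact: cyl0.
  move=> _ [y yc <-]; rewrite -dec in yc; have := ht0 _ (cylinder_le t0t yc).
  by rewrite /= ler_distl => /andP[_]; rewrite lerBlDr.
- by rewrite divr_gt0.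
have [||||N hN] := @dominated_approx _ _ _ Q
  (fun N w => if (pickle (code t.+1 w) < N)%N then al t (code t.+1 w) else 0) (fun w => al t
    (code t.+1 w)) M (eps / 2).
- by move=> N; exact: (measurable_fun_code _ (fun s => if (pickle s < N)%N then al t s else 0)).
- by move=> N w; case: ifP => _; rewrite ?al0 ?alM ?lexx.
- move=> w; apply: cvg_near_cst; near=> N.
  by rewrite ifT //; near: N; exact: nbhs_infty_gt.
- by rewrite divr_gt0.
(* The filter discards the lists that are not codes of depth [t.+1]. *)
pose ss := [seq s <- pmap pickle_inv (iota 0 N) | gw_code (gw_decode s) t.+1 == s] : seq (seq
  (gw_word b * nat)).
have uss : uniq ss.
  by apply: filter_uniq; apply: (pmap_uniq (@pickle_invK _)); exact: iota_uniq.
have mem_ss w : (code t.+1 w \in ss) = (pickle (code t.+1 w) < N)%N.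
  rewrite mem_filter gw_code_decode eqxx mem_pmap; apply/mapP/idP => [[j]|cN].
    rewrite mem_iota add0n => /= jN cj; have := @pickle_invK (seq (gw_word b * nat)) j.
    by rewrite -cj /= => ->.
  by exists (pickle (code t.+1 w)); rewrite ?mem_iota // pickleK_inv.
exists t, ss, (al t); split=> //.
- by move=> s; rewrite mem_filter => /andP[/eqP].
- by move=> s y _; exact: al_le.
have eS (A : R) : ((A + eps)%:E = (A + eps / 2)%:E + (eps / 2)%:E)%E by rewrite -EFinD -addrA
  -splitr.
apply: le_trans ht _; rewrite eS leeD2rE //.
apply: le_trans hN _; rewrite EFinD leeD2rE //.
pose E (s : seq (gw_word b * nat)) := [set w | code t.+1 w = s].
have mE s : measurable (E s) by exact: measurable_code.
rewrite (eq_integral (fun w => \sum_(s <- ss) (al t s)%:E * (\1_(E s) w)%:E)%E); last first.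
  move=> w _; rewrite -mem_ss; case: ifPn => [cs|ncs].
    rewrite (bigD1_seq (code t.+1 w)) //= indicE mem_set // mule1 big1 ?adde0 // => s sne.
    by rewrite indicE memNset ?mule0 //= => ws; move: sne; rewrite ws eqxx.
  rewrite big_seq big1 // => s sss; rewrite indicE memNset ?mule0 //= => ws.
  by move: ncs; rewrite ws sss.
rewrite ge0_integral_sum //; last 2 first.
- by move=> s; apply: emeasurable_funM => //; apply/measurable_EFinP; exact: measurable_indic.
- by move=> s w _; rewrite mule_ge0 ?lee_fin.
rewrite -sumEFin big_seq [leRHS]big_seq; apply: lee_sum => s sss.
rewrite ge0_integralZl_EFin //; last by apply/measurable_EFinP; exact: measurable_indic.
rewrite integral_indic // setIT EFinM -prob_code; move: sss;
  rewrite mem_filter => /andP[/eqP -> _].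
exact: lexx.
Unshelve. all: by end_near.
Qed.

End block_GW_law.

(** * Weak convergence *)

Section integral_uniform_root.
Context {R : realType} {V : finType} (G : wgraph R V).

Lemma integral_uniform_root (g : gstar R -> R) : measurable_fun setT (g : borel (gstar R) ->
  R) ->
  (forall y, 0 <= g y) ->
  (\int[uniform_root G]_y (g y)%:E =
     (#|[pred o | o \in vset G]|%:R^-1 * \sum_(o | o \in vset G) g (gclass G o))%:E)%E.
Proof.
move=> mg g0.
have mgE : measurable_fun setT (fun y : borel (gstar R) => (g y)%:E) by exact/measurable_EFinP.
have [m mE mI] : exists2 m : {measure set (borel (gstar R)) -> \bar R},
    forall A, m A = (\sum_(o <- enum [pred o | o \in vset G]) \d_(gclass G o : borel (gstar R))
      A)%E &
    (\int[m]_y (g y)%:E = \sum_(o <- enum [pred o | o \in vset G]) (g (gclass G o))%:E)%E.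
  elim: (enum _) => [|o s [m mE mI]].
    exists mzero; first by move=> A; rewrite big_nil.
    by rewrite big_nil integral_measure_zero.
  exists (measure_add (\d_(gclass G o : borel (gstar R))) m).
    by move=> A; rewrite big_cons -mE; exact: measure_addE.
  rewrite ge0_integral_measure_add //=; last by move=> y _; rewrite lee_fin.
  by rewrite big_cons mI integral_dirac // diracT mul1e.
pose c := #|[pred o | o \in vset G]|%:R^-1 : R.
have c0 : 0 <= c by rewrite invr_ge0.
rewrite (eq_measure_integral (mscale (NngNum c0) m)); last first.
  move=> A _ _; rewrite /= /uniform_root /mscale /= mE big_enum /=.
  by congr (_ * _)%E; apply: eq_bigl => o; rewrite inE.
rewrite ge0_integral_mscale //=; last by move=> y _; rewrite lee_fin.
rewrite mI EFinM big_enum /= -sumEFin; congr (_ * _)%E.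
Qed.

Lemma uniform_rootT : (0 < #|[pred o | o \in vset G]|)%N -> uniform_root G setT = 1%E.
Proof.
move=> V0; transitivity (\int[uniform_root G]_y (cst 1%:E y))%E.
  by rewrite integral_cst // mul1e.
rewrite (@integral_uniform_root (cst 1) (@measurable_cst _ _ _ _ _ _) (fun=> ler01)).
rewrite /= sumr_const mulVf //.
by rewrite pnatr_eq0 -lt0n.
Qed.

End integral_uniform_root.

Section bounded_integral.
Context {d : measure_display} {T : measurableType d} {R : realType} (m : {measure set T ->
  \bar R}).
Hypothesis m1 : m setT = 1%E.
Variables (f : T -> R) (M : R).
Hypothesis mf : measurable_fun setT f.
Hypothesis fM : forall x, `|f x| <= M.

Lemma bounded_integrable : m.-integrable setT (EFin \o f).
Proof.
apply: measurable_bounded_integrable => //; first by rewrite m1 ltry.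
exists M; split; first exact: num_real.
by move=> y My x _; apply: le_trans (fM x) (ltW My).
Qed.

Lemma cst_integrable c : m.-integrable setT (EFin \o (cst c : T -> R)).
Proof.
apply: measurable_bounded_integrable => //; first by rewrite m1 ltry.
exists `|c|; split; first exact: num_real.
by move=> y My x _; exact: ltW.
Qed.

Lemma bounded_integral_fin : (\int[m]_x (f x)%:E)%E \is a fin_num.
Proof. exact: integrable_fin_num bounded_integrable. Qed.

Lemma integral_cst1 (c : R) : (\int[m]_x ((EFin \o cst c) x) = c%:E)%E.
Proof. by transitivity (\int[m]_x (cst c%:E x))%E => //; rewrite integral_cst // m1 mule1. Qed.

Lemma integral_cstD c : (\int[m]_x (c + f x)%:E = c%:E + \int[m]_x (f x)%:E)%E.
Proof.
rewrite -(integral_cst1 c).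
exact: (integralD_EFin measurableT (cst_integrable c) bounded_integrable).
Qed.

Lemma integral_cstB c : (\int[m]_x (c - f x)%:E = c%:E - \int[m]_x (f x)%:E)%E.
Proof.
rewrite -(integral_cst1 c).
exact: (integralB_EFin measurableT (cst_integrable c) bounded_integrable).
Qed.

End bounded_integral.

Section poisson.
Context {R : realType} (lambda : R).
Hypothesis lambda_gt0 : 0 < lambda.

Lemma poisson_pmf_gt0 n : 0 < poisson_pmf lambda n.
Proof. by rewrite /poisson_pmf lambda_gt0 !mulr_gt0 ?expR_gt0 ?exprn_gt0 // invr_gt0 ltr0n
  fact_gt0. Qed.

Lemma series_poisson_pmf : series (poisson_pmf lambda) @ \oo --> (1 : R).
Proof.
have -> : series (poisson_pmf lambda) = (fun n => expR (- lambda) * series (exp_coeff lambda)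
  n).
  apply/funext => n; rewrite /series /= mulr_sumr; apply: eq_bigr => i _.
  by rewrite /poisson_pmf lambda_gt0 mulrC.
have -> : (1 : R) = expR (- lambda) * expR lambda by rewrite -expRD addNr expR0.
apply: cvgM; first exact: cvg_cst.
exact: (@is_cvg_series_exp_coeff R lambda).
Qed.

End poisson.

Section line_graph_roots.
Context {R : realType} {n k r : nat} (r_lt_k : (r < k)%N).

(** A root has at most one type, and its class lies in the corresponding cylinder; the roots without
    a type in [ss] contribute nonnegatively. *)
Lemma sum_line_graph_ge (H : {set subsets n k}) (g : gstar R -> R) (t : nat)
    (ss : seq (seq (gw_word ('C(k, r) - 1) * nat))) (a : seq (gw_word ('C(k, r) - 1) * nat) ->
      R) :
  (forall y, 0 <= g y) -> uniq ss -> (forall s, s \in ss -> gw_code (gw_decode s) t.+1 = s) ->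
  (forall s y, s \in ss -> cylinder t (gw_decode s) y -> a s <= g y) ->
  \sum_(s <- ss) a s * (type_count t.+1 s H)%:R <= \sum_(S : subsets n r) g (gclass (line_graph
    R r H) S).
Proof.
move=> g0 uss sE ag.
rewrite (eq_bigr (fun s => \sum_(S : subsets n r) if has_type (hedges H) (val S) t.+1 s then a
  s else 0)); last first.
  move=> s _; rewrite /type_count -sum1_card natr_sum mulr_sumr -big_mkcond /=.
  by apply: eq_big => S; rewrite ?inE ?mulr1.
rewrite exchange_big /=; apply: ler_sum => S _.
pose s0 := gw_code (@nblocks n k r (hedges H) (val S)) t.+1.
have [s0s|s0s] := boolP ((s0 \in ss) && treelike k r (hedges H) (val S) t.+1); last first.
  rewrite big_seq big1 ?g0 // => s sss; case: ifP => // /andP[tl /eqP s0E].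
  by move: s0s; rewrite tl andbT /s0 s0E sss.
have /andP[s0ss tl] := s0s.
rewrite (bigD1_seq s0) //= big1 ?addr0; last first.
  by move=> s; case: ifP => // /andP[_ /eqP <-]; rewrite eqxx.
rewrite /has_type tl eqxx /=; apply: ag => //.
apply: (@cylinder_code _ _ _ (@nblocks n k r (hedges H) (val S))).
  by apply: (gw_code_le (leqnSn t)); rewrite sE.
exact: riso_trans (line_graph_gball R r_lt_k tl) (gclass_gball _ _ _).
Qed.

End line_graph_roots.

Section weak_convergence.
Context {R : realType} (lambda : R) (k r : nat).
Hypothesis r_lt_k : (r < k)%N.
Local Notation b := ('C(k, r) - 1)%N.
Context {d : measure_display} {T : measurableType d} {Q : probability T R}.
Variable X : gw_word b -> {RV Q >-> nat}.
Hypothesis Xp : forall u (m : nat), Q (X u @^-1` [set m]) = (poisson_pmf lambda m)%:E.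
Hypothesis Xi : forall A : gw_word b -> set nat, independent_events Q (fun u => X u @^-1` A u).
Variable Y : {RV Q >-> borel (gstar R)}.
Hypothesis YE : forall w, Y w = gw_class X w.
Variable H : forall n, {set subsets n k}.
Hypothesis freq : forall t (s : seq (gw_word b * nat)) (eps : R), 0 < eps ->
   \forall n \near \oo,
     (type_mass lambda (gw_decode s) t - eps) * 'C(n, r)%:R <=
     (type_count t (gw_code (gw_decode s) t) (H n))%:R.

Local Notation U n := (uniform_root (line_graph R r (H n))).

Lemma card_vset_line n : #|[pred o | o \in vset (line_graph R r (H n))]| = 'C(n, r).
Proof. by rewrite -card_subsets; apply: eq_card => o; rewrite !inE /= in_setT. Qed.

Lemma integral_liminf (g : gstar R -> R) (M eps : R) : continuous g -> (forall y,
  0 <= g y <= M) -> 0 < eps ->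
  \forall n \near \oo, (\int[distribution Q Y]_y (g y)%:E <= \int[U n]_y (g y)%:E + eps%:E)%E.
Proof.
move=> cg gM eps0; have g0 y : 0 <= g y by have /andP[] := gM y.
have mg := continuous_borel cg.
have e20 : 0 < eps / 2 by rewrite divr_gt0.
have [t [ss [a [uss sE a0 ag app]]]] := gw_class_approx Xp Xi cg gM e20.
pose A := \sum_(s <- ss) a s.
have A0 : 0 <= A by rewrite /A big_seq; apply: sumr_ge0.
(* The errors [a s * e'] add up to at most [eps / 2]; the [+ 1] covers the case [A = 0]. *)
pose e' := eps / 2 / (A + 1).
have e'0 : 0 < e' by rewrite divr_gt0 // ltr_wpDl.
have nall : \forall n \near \oo, forall s, s \in ss ->
    (type_mass lambda (gw_decode s) t.+1 - e') * 'C(n, r)%:R <= (type_count t.+1 s (H n))%:R.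
  clear app uss ag A0 a0; elim: ss sE {A e' e'0} (e') e'0 => [|s ss IH] sE e' e'0.
    by apply: nearW.
  have h1 := freq t.+1 s e'0; rewrite sE ?mem_head // in h1.
  have h2 := IH (fun s' s's => sE s' (mem_behead (s := s :: ss) s's)) e' e'0.
  by near=> n => s'; rewrite inE => /orP[/eqP ->|s's]; [near: n|apply: (near h2 n)].
near=> n.
have nr : (r <= n)%N by near: n; exact: nbhs_infty_ge.
have V0 : 0 < 'C(n, r)%:R :> R by rewrite ltr0n bin_gt0.
have mgE : measurable_fun setT (fun y : borel (gstar R) => (g y)%:E) by exact/measurable_EFinP.
have g0E (y : borel (gstar R)) : (0 <= (g y)%:E)%E by rewrite lee_fin.
rewrite (ge0_integral_distribution _ mgE g0E).
rewrite (eq_integral (fun w => (g (gw_class X w))%:E)); last by move=> w _ /=; rewrite YE.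
apply: le_trans app _.
rewrite integral_uniform_root // card_vset_line -EFinD lee_fin [eps in leRHS]splitr addrA
  lerD2r.
rewrite [\sum_(o | _) g _](eq_bigl xpredT); last by move=> o; rewrite mem_set.
have := sum_line_graph_ge r_lt_k (H n) g0 uss sE ag.
rewrite -(ler_pM2l (x := 'C(n, r)%:R^-1)) ?invr_gt0 // => h.
rewrite -lerBlDr; apply: le_trans h; rewrite ler_pdivlMl //.
apply: (@le_trans _ _ (\sum_(s <- ss) a s * ((type_mass lambda (gw_decode s) t.+1 - e') * 'C(n,
  r)%:R))).
  rewrite [leRHS](_ : _ = 'C(n, r)%:R * (\sum_(s <- ss) a s * type_mass lambda (gw_decode s)
    t.+1 - e' * A)).
    rewrite ler_pM2l // lerD2l lerN2 /e' mulrAC ler_pdivrMr ?ltr_wpDl //.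
    by rewrite ler_wpM2l ?(ltW e20) // lerDl.
  rewrite /A mulr_sumr -sumrB mulr_sumr; apply: eq_bigr => s _; lra.
rewrite !big_seq; apply: ler_sum => s sss; rewrite ler_wpM2l ?a0 //.
by apply: (near nall n).
Unshelve. all: by end_near.
Qed.

(** All measures involved have mass 1, eventually in [n], so the one-sided estimate applied to the
    nonnegative functions [M + f] and [M - f] bounds the integral of [f] from both sides. *)
Lemma weak_cvg_uniform_root : weak_cvg (fun n => U n) (distribution Q Y).
Proof.
move=> f cf [M fM].
have mf := continuous_borel cf.
have d1 : distribution Q Y setT = 1%E by exact: probability_setT.
have U1 n : (r <= n)%N -> U n setT = 1%E.
  by move=> rn; apply: uniform_rootT; rewrite card_vset_line bin_gt0.
have cM1 : continuous (fun y : gstar R => M + f y).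
  by move=> y; exact: (cvgD (cvg_cst M) (cf y)).
have cM2 : continuous (fun y : gstar R => M - f y).
  by move=> y; exact: (cvgB (cvg_cst M) (cf y)).
have b1 y : 0 <= M + f y <= M + M.
  by have := fM y; rewrite ler_norml => /andP[h1 h2]; apply/andP; split; lra.
have b2 y : 0 <= M - f y <= M + M.
  by have := fM y; rewrite ler_norml => /andP[h1 h2]; apply/andP; split; lra.
have fd := bounded_integral_fin d1 mf fM.
rewrite -(fineK fd); apply/fine_cvgP; split.
  by near=> n; apply: (bounded_integral_fin (U1 n _) mf fM); near: n; exact: nbhs_infty_ge.
apply/cvgrPdist_le => e e0; near=> n.
have rn : (r <= n)%N by near: n; exact: nbhs_infty_ge.
have h1 : (\int[distribution Q Y]_y (M + f y)%:E <= \int[U n]_y (M + f y)%:E + e%:E)%E.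
  by near: n; exact: (integral_liminf cM1 b1 e0).
have h2 : (\int[distribution Q Y]_y (M - f y)%:E <= \int[U n]_y (M - f y)%:E + e%:E)%E.
  by near: n; exact: (integral_liminf cM2 b2 e0).
have fU := bounded_integral_fin (U1 n rn) mf fM.
rewrite (integral_cstD d1 mf fM) (integral_cstD (U1 n rn) mf fM) in h1.
rewrite (integral_cstB d1 mf fM) (integral_cstB (U1 n rn) mf fM) in h2.
move: h1 h2; rewrite -(fineK fd) -(fineK fU) -!EFinB -!EFinD !lee_fin /= => h1 h2.
rewrite ler_distl; apply/andP; split; lra.
Unshelve. all: by end_near.
Qed.

End weak_convergence.

Theorem theorem3p3 (R : realType) (lambda : R) (k r : nat)
    (d : measure_display) (Omega : measurableType d) (P : probability Omega R)
    (p : nat -> R) (H : forall n : nat, Omega -> {set subsets n k})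
    (lambda_gt0 : 0 < lambda) (r_gt0 : (1 <= r)%N) (r_lt_k : (r <= k - 1)%N)
    (pE : \forall n \near \oo,
      0 < p n <= 1 /\ 'C(n - r, k - r)%:R * p n = lambda)
    (HP : \forall n \near \oo, random_hypergraph P (p n) (H n)) :
  exists nu : probability (borel (gstar R)) R,
    block_GW ('C(k, r) - 1) lambda nu /\
    {ae P, forall w, weak_cvg (fun n => uniform_root (line_graph R r (H n w))) nu}.
Proof.
have rk : (r < k)%N by lia.
pose q := poisson_pmf lambda.
have q0 n : 0 < q n by exact: poisson_pmf_gt0.
have q1 : series q @ \oo --> (1 : R) by exact: series_poisson_pmf.
(* The Galton-Watson process is built on the unit interval: [pickle] assigns to each word its own
   coordinate of the point. *)
pose Q : probability (measurableTypeR R) R := unit_mu.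
have mX (u : gw_word ('C(k, r) - 1)) : measurable_fun [set: measurableTypeR R] (shift_coord q (pickle u)).
  exact: measurable_shift_coord.
pose X (u : gw_word ('C(k, r) - 1)) : {RV Q >-> nat} :=
  HB.pack_for {mfun (measurableTypeR R) >-> nat} (shift_coord q (pickle u)) (isMeasurableFun.Build _ _ _ _ _ (mX u)).
have Xp u (m : nat) : Q (X u @^-1` [set m]) = (poisson_pmf lambda m)%:E.
  exact: unit_mu_shift_coord1.
have Xi (A : gw_word ('C(k, r) - 1) -> set nat) : independent_events Q (fun u => X u @^-1` A u).
  exact: shift_coord_independent.
have mY := measurable_gw_class X.
pose Y : {RV Q >-> borel (gstar R)} :=
  HB.pack_for {mfun (measurableTypeR R) >-> borel (gstar R)} (gw_class X) (isMeasurableFun.Build _ _ _ _ _ mY).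
exists (distribution Q Y); split.
  by exists _, _, Q, X, Y.
have := type_count_ae_all lambda_gt0 r_gt0 rk pE HP.
apply: filterS => w freq.
exact: (weak_cvg_uniform_root rk Xp Xi (Y := Y) _ freq).
Qed.
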